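(* Let $V^{(2)}:M_{\rm nondeg}\to\mathbb{R}$ be the function defined in the context, which depends on real parameters $\lambda_c,\lambda_d$. There exist positive constants $\lambda_0$ and $\delta$ such that $$V^{(2)}(y) \geq \delta \, \Big ( 1 - \frac{\langle y_1 \wedge y_2,e_z \rangle^2}{|y_1 \wedge y_2|^2} \Big )$$ for each point $y = (y_1,y_2) \in M_{\rm nondeg}$ provided $|\lambda_d|\leq \lambda_0$. Moreover, $V^{(2)}(y) = 0$ for each point $y \in \Sigma \cap M_{\rm nondeg}$, where $\Sigma=\{p\in M:\langle p_1,e_z\rangle=\langle p_2,e_z\rangle=0\}$.
   Context: **Background metric.** $S^2\subset\mathbb{R}^3$ is the unit sphere, $M=S^2\times S^2$ with points $p=(p_1,p_2)$; $\langle\cdot,\cdot\rangle$, $\wedge$ denote the inner product and cross product of $\mathbb{R}^3$; $e_x,e_y,e_z$ is the standard basis of $\mathbb{R}^3$. $M_{\rm nondeg}=\{(p_1,p_2)\in M: p_1\neq\pm p_2\}$. On $M_{\rm nondeg}$ put $q_1=\frac{p_1+p_2}{|p_1+p_2|}$, $q_2=\frac{p_2-p_1}{|p_2-p_1|}$, $q_3=\frac{p_1\wedge p_2}{|p_1\wedge p_2|}$, $\theta=\frac12\arccos\langle p_1,p_2\rangle\in(0,\frac\pi2)$, so $\cos(2\theta)=\langle p_1,p_2\rangle$; functions such as $\cos(2n\theta)$ (polynomials in $\langle p_1,p_2\rangle$) are regarded as smooth functions on all of $M$. Put $E_i=(q_i\wedge p_1,q_i\wedge p_2)$ for $i=1,2,3$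 and $\partial_\theta=(-q_3\wedge p_1,q_3\wedge p_2)$, and $m_1=\frac{1}{\sin\theta}E_1$, $m_2=\frac{1}{\cos\theta}E_2$, $m_3=E_3$, $m_4=\partial_\theta$ (a frame on $M_{\rm nondeg}$). $g$ is the smooth Riemannian metric on $M$ (one half of the Cheeger-M\''uter metric with parameter $1$) for which, on $M_{\rm nondeg}$, $m_1,\dots,m_4$ are mutually orthogonal with $|m_1|_g^2=\frac{1}{2-\cos(2\theta)}$, $|m_2|_g^2=\frac{1}{2+\cos(2\theta)}$, $|m_3|_g^2=\frac13$, $|m_4|_g^2=1$. **One-forms.** For $\omega\in\mathbb{R}^3$, or $\omega$ an $\mathbb{R}^3$-valued function on $M$ such as $p_1\pm p_2$, $K_\omega=(\omega\wedge p_1,\omega\wedge p_2)$; for $\omega\in\mathbb{R}^3$, $J_\omega=(\omega\wedge p_1,-\omega\wedge p_2)$. $K^\flat_\omega=g(K_\omega,\cdot)$, $J^\flat_\omega=g(J_\omega,\cdot)$, and $\alpha\odot\beta=\frac12(\alpha\otimes\beta+\beta\otimes\alpha)$. **The tensor $h^{(1)}$.** For real constants $\lambda_c,\lambda_d$, $h^{(1)}=h^{(1)}_a+h^{(1)}_b+\lambda_c h^{(1)}_c+\lambda_d h^{(1)}_d$ with $h^{(1)}_a=\frac65(2-\cos(2\theta))K^\flat_{p_1+p_2}\odot K^\flat_{e_x}-2(1-\cos(2\theta))(2+\cos(2\theta))K^\flat_{p_2-p_1}\odot J^\flat_{e_x}$, $h^{(1)}_b=\frac65(2+\cos(2\theta))K^\flat_{p_2-p_1}\odot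 K^\flat_{e_y}-2(1+\cos(2\theta))(2-\cos(2\theta))K^\flat_{p_1+p_2}\odot J^\flat_{e_y}$, $h^{(1)}_c=K^\flat_{e_z}\odot K^\flat_{e_z}$, $h^{(1)}_d=K^\flat_{e_x}\odot J^\flat_{e_z}$. **The tensor $h^{(2)}$.** $h^{(2)}=h^{(2)}_{aa}+h^{(2)}_{bb}+2h^{(2)}_{ab}+\lambda_c^2h^{(2)}_{cc}+2\lambda_ch^{(2)}_{ac}+2\lambda_ch^{(2)}_{bc}+\lambda_d^2h^{(2)}_{dd}+2\lambda_dh^{(2)}_{ad}+2\lambda_dh^{(2)}_{bd}+2\lambda_c\lambda_dh^{(2)}_{cd}$, where $f_{aa}=-\frac{2203841\cos(2\theta)}{1920}+\frac{5579141\cos(4\theta)}{153600}-\frac{214597\cos(6\theta)}{103680}+\frac{48211\cos(8\theta)}{307200}-\frac{251\cos(10\theta)}{19200}+\frac{25\cos(12\theta)}{165888}-\frac{42025}{6}\sqrt{\frac53}\sum_{n=1}^\infty\frac{(-4+\sqrt{15})^n\cos(2n\theta)}{n^2}$, $f_{bb}=\frac{2203841\cos(2\theta)}{1920}+\frac{5579141\cos(4\theta)}{153600}+\frac{214597\cos(6\theta)}{103680}+\frac{48211\cos(8\theta)}{307200}+\frac{251\cos(10\theta)}{19200}+\frac{25\cos(12\theta)}{165888}-\frac{42025}{6}\sqrt{\frac53}\sum_{n=1}^\infty\frac{(4-\sqrt{15})^n\cos(2n\theta)}{n^2}$, $h^{(2)}_{aa}=9f_{aa}K^\flat_{e_x}\odot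 K^\flat_{e_x}$, $h^{(2)}_{bb}=9f_{bb}K^\flat_{e_y}\odot K^\flat_{e_y}$, $h^{(2)}_{ab}=0$, $h^{(2)}_{cc}=g(K_{e_z},K_{e_z})K^\flat_{e_z}\odot K^\flat_{e_z}$, $h^{(2)}_{ac}=\frac1{20}\langle p_1+p_2,e_z\rangle(-5-14\cos(2\theta)+3\cos(4\theta))K^\flat_{e_x}\odot K^\flat_{e_z}$, $h^{(2)}_{bc}=\frac1{20}\langle p_2-p_1,e_z\rangle(-5+14\cos(2\theta)+3\cos(4\theta))K^\flat_{e_y}\odot K^\flat_{e_z}$, $h^{(2)}_{dd}=\frac1{12}g(J_{e_x},J_{e_x})J^\flat_{e_z}\odot J^\flat_{e_z}$, $h^{(2)}_{ad}=\frac9{80}\langle p_2-p_1,e_x\rangle(-\frac{406}{45}-\frac{92}{45}\cos(2\theta)+\frac25\cos(4\theta))K^\flat_{e_x}\odot K^\flat_{e_z}+\frac92\langle p_2-p_1,e_z\rangle(-\frac{823}{900}+\frac{77}{450}\cos(2\theta)+\frac1{100}\cos(4\theta))K^\flat_{e_x}\odot K^\flat_{e_x}$, $h^{(2)}_{bd}=\frac9{80}\langle p_1+p_2,e_x\rangle(-\frac{406}{45}+\frac{92}{45}\cos(2\theta)+\frac25\cos(4\theta))K^\flat_{e_y}\odot K^\flat_{e_z}+\frac92\langle p_1+p_2,e_z\rangle(-\frac{823}{900}-\frac{77}{450}\cos(2\theta)+\frac1{100}\cos(4\theta))K^\flat_{e_x}\odot K^\flat_{e_y}$, $h^{(2)}_{cd}=-\frac18\big(\langle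 p_1+p_2,e_z\rangle\langle p_2-p_1,e_x\rangle+\langle p_1+p_2,e_x\rangle\langle p_2-p_1,e_z\rangle\big)G\big(\frac{\sin(2\theta)}{\sqrt3}\big)K^\flat_{e_z}\odot K^\flat_{e_z}+\frac{\langle p_1+p_2,e_z\rangle\langle p_2-p_1,e_z\rangle}{2(4-\cos^2(2\theta))}K^\flat_{e_x}\odot K^\flat_{e_z}$, with $G(0)=1$, $G(x)=\frac{\arctan x}{x}$ for $x\in(-1,1)\setminus\{0\}$ (so $G(\sin(2\theta)/\sqrt3)$ extends smoothly to $M$). All these tensors are smooth on $M$. **The function $V^{(2)}$.** $g_s=g+s\,h^{(1)}+s^2h^{(2)}$, a Riemannian metric for $|s|\le s_0$, $s_0>0$ small. The $(0,4)$ curvature tensor is normalized so that $R(X,Y,X,Y)>0$ for linearly independent $X,Y$ when sectional curvature is positive. For $y\in M_{\rm nondeg}$, $z\in\mathbb{R}^4$: $m_3(z)=m_3+z^1m_1+z^3m_2$, $m_4(z)=m_4+z^4m_1+z^2m_2$, and $v(y,z,s)=R_{g_s}(m_3(z),m_4(z),m_3(z),m_4(z))$ at $y$, with Taylor expansion $v=v^{(0)}+s\,v^{(1)}+s^2v^{(2)}+s^3v^{(3)}+O(s^4)$ in $s$. Subscripts $z^\alpha$ denote partial derivatives. The matrix $(v^{(0)}_{z^\alpha z^\beta}(y,0))$ is positive definite, and $\bar z(y)\in\mathbb{R}^4$ is defined by $\sum_\beta v^{(0)}_{z^\alpha z^\beta}(y,0)\bar z^\beta(y)=-v^{(1)}_{z^\alpha}(y,0)$.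 Then $V^{(2)}(y)=v^{(2)}(y,0)+\frac12\sum_\alpha v^{(1)}_{z^\alpha}(y,0)\bar z^\alpha(y)$. *)

(* Defs.v *)
From HB Require Import structures.
From mathcomp Require Import all_boot all_order all_algebra.
From mathcomp Require Import all_classical all_reals all_analysis.
From mathcomp Require Import ring lra.
Set Implicit Arguments.
Unset Strict Implicit.
Unset Printing Implicit Defensive.
Import Order.TTheory GRing.Theory Num.Theory.
Import numFieldNormedType.Exports.

Local Open Scope classical_set_scope.
Local Open Scope ring_scope.

(* Numerals above a few thousand overflow the stack because [ring_scope]
   literals are unary; [th 2203 841] is 2203841. *)
Local Notation th a b := (a * 10 ^+ 3 + b).

(* R^3 x R^3: it carries both the points of M = S^2 x S^2 and the tangent
   vectors of M. *)
Notation R3xR3 R := ('rV[R]_3 * 'rV[R]_3)%type.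

Section Geometry.
Context {R : realType}.
Implicit Types (u w : 'rV[R]_3) (p y X Y Z W : R3xR3 R).

Definition dot u w : R := \sum_i u 0 i * w 0 i.

Definition enorm u : R := Num.sqrt (dot u u).

(* Indices are added in 'I_3, i.e. modulo 3. *)
Definition cross u w : 'rV[R]_3 :=
  \row_i (u 0 (i + 1) * w 0 (i + 2) - u 0 (i + 2) * w 0 (i + 1)).

Definition e_x : 'rV[R]_3 := delta_mx 0 0.
Definition e_y : 'rV[R]_3 := delta_mx 0 1.
Definition e_z : 'rV[R]_3 := delta_mx 0 2.

Definition normalize u : 'rV[R]_3 := (enorm u)^-1 *: u.

Definition dot2 X Y : R := dot X.1 Y.1 + dot X.2 Y.2.

Definition inM p : Prop := enorm p.1 = 1 /\ enorm p.2 = 1.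

Definition M_nondeg p : Prop := [/\ inM p, p.1 <> p.2 & p.1 <> - p.2].

Definition Sigma p : Prop := [/\ inM p, dot p.1 e_z = 0 & dot p.2 e_z = 0].

Definition q1 p := normalize (p.1 + p.2).
Definition q2 p := normalize (p.2 - p.1).
Definition q3 p := normalize (cross p.1 p.2).

Definition theta p : R := acos (dot p.1 p.2) / 2.

Definition K u p : R3xR3 R := (cross u p.1, cross u p.2).
Definition J u p : R3xR3 R := (cross u p.1, - cross u p.2).

Definition m1 p : R3xR3 R := (sin (theta p))^-1 *: K (q1 p) p.
Definition m2 p : R3xR3 R := (cos (theta p))^-1 *: K (q2 p) p.
Definition m3 p : R3xR3 R := K (q3 p) p.
Definition m4 p : R3xR3 R := (- cross (q3 p) p.1, cross (q3 p) p.2).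

Definition frame p (i : 'I_4) : R3xR3 R :=
  tnth [tuple m1 p; m2 p; m3 p; m4 p] i.

(* By [frame_orthogonal] below, the m_i are orthogonal for the Euclidean
   product of R^3 x R^3, so [coef p i X] is the i-th component of a
   tangent vector X in the frame m_1, ..., m_4 at p. *)
Definition coef p (i : 'I_4) X : R :=
  dot2 X (frame p i) / dot2 (frame p i) (frame p i).

Definition frame_sqnorm p (i : 'I_4) : R :=
  tnth [tuple (2 - cos (2 * theta p))^-1; (2 + cos (2 * theta p))^-1; 3^-1; 1] i.

Definition tensor2 := R3xR3 R -> R3xR3 R -> R3xR3 R -> R.

Definition g : tensor2 := fun p X Y =>
  \sum_i frame_sqnorm p i * coef p i X * coef p i Y.

(* One-forms, symmetric products and tensors are functions of the base point
   p first. *)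
Definition Kflat u p X : R := g p (K u p) X.
Definition Jflat u p X : R := g p (J u p) X.

Definition odot (a b : R3xR3 R -> R) X Y : R := (a X * b Y + b X * a Y) / 2.

(* ck k p = cos(k theta). *)
Definition ck (k : nat) p : R := cos (k%:R * theta p).

Definition h1a : tensor2 := fun p X Y =>
    6 / 5 * (2 - ck 2 p) * odot (Kflat (p.1 + p.2) p) (Kflat e_x p) X Y
  - 2 * (1 - ck 2 p) * (2 + ck 2 p)
      * odot (Kflat (p.2 - p.1) p) (Jflat e_x p) X Y.

Definition h1b : tensor2 := fun p X Y =>
    6 / 5 * (2 + ck 2 p) * odot (Kflat (p.2 - p.1) p) (Kflat e_y p) X Y
  - 2 * (1 + ck 2 p) * (2 - ck 2 p)
      * odot (Kflat (p.1 + p.2) p) (Jflat e_y p) X Y.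

Definition h1c : tensor2 := fun p => odot (Kflat e_z p) (Kflat e_z p).

Definition h1d : tensor2 := fun p => odot (Kflat e_x p) (Jflat e_z p).

Definition h1 (lc ld : R) : tensor2 := fun p X Y =>
  h1a p X Y + h1b p X Y + lc * h1c p X Y + ld * h1d p X Y.

Definition faa p : R :=
  - (th 2203 841 * ck 2 p / 1920)
  + th 5579 141 * ck 4 p / th 153 600
  - th 214 597 * ck 6 p / th 103 680
  + th 48 211 * ck 8 p / th 307 200
  - 251 * ck 10 p / th 19 200
  + 25 * ck 12 p / th 165 888
  - th 42 25 / 6 * Num.sqrt (5 / 3)
    * \big[+%R/0]_(1 <= n <oo) ((- 4 + Num.sqrt 15) ^+ n * ck (2 * n) p / n%:R ^+ 2).

Definition fbb p : R :=
  th 2203 841 * ck 2 p / 1920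
  + th 5579 141 * ck 4 p / th 153 600
  + th 214 597 * ck 6 p / th 103 680
  + th 48 211 * ck 8 p / th 307 200
  + 251 * ck 10 p / th 19 200
  + 25 * ck 12 p / th 165 888
  - th 42 25 / 6 * Num.sqrt (5 / 3)
    * \big[+%R/0]_(1 <= n <oo) ((4 - Num.sqrt 15) ^+ n * ck (2 * n) p / n%:R ^+ 2).

Definition G (x : R) : R := if x == 0 then 1 else atan x / x.

Definition h2aa : tensor2 := fun p X Y =>
  9 * faa p * odot (Kflat e_x p) (Kflat e_x p) X Y.

Definition h2bb : tensor2 := fun p X Y =>
  9 * fbb p * odot (Kflat e_y p) (Kflat e_y p) X Y.

Definition h2ab : tensor2 := fun _ _ _ => 0.

Definition h2cc : tensor2 := fun p X Y =>
  g p (K e_z p) (K e_z p) * odot (Kflat e_z p) (Kflat e_z p) X Y.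

Definition h2ac : tensor2 := fun p X Y =>
  1 / 20 * dot (p.1 + p.2) e_z * (- 5 - 14 * ck 2 p + 3 * ck 4 p)
    * odot (Kflat e_x p) (Kflat e_z p) X Y.

Definition h2bc : tensor2 := fun p X Y =>
  1 / 20 * dot (p.2 - p.1) e_z * (- 5 + 14 * ck 2 p + 3 * ck 4 p)
    * odot (Kflat e_y p) (Kflat e_z p) X Y.

Definition h2dd : tensor2 := fun p X Y =>
  1 / 12 * g p (J e_x p) (J e_x p) * odot (Jflat e_z p) (Jflat e_z p) X Y.

Definition h2ad : tensor2 := fun p X Y =>
    9 / 80 * dot (p.2 - p.1) e_x
      * (- (406 / 45) - 92 / 45 * ck 2 p + 2 / 5 * ck 4 p)
      * odot (Kflat e_x p) (Kflat e_z p) X Y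
  + 9 / 2 * dot (p.2 - p.1) e_z
      * (- (823 / 900) + 77 / 450 * ck 2 p + 1 / 100 * ck 4 p)
      * odot (Kflat e_x p) (Kflat e_x p) X Y.

Definition h2bd : tensor2 := fun p X Y =>
    9 / 80 * dot (p.1 + p.2) e_x
      * (- (406 / 45) + 92 / 45 * ck 2 p + 2 / 5 * ck 4 p)
      * odot (Kflat e_y p) (Kflat e_z p) X Y
  + 9 / 2 * dot (p.1 + p.2) e_z
      * (- (823 / 900) - 77 / 450 * ck 2 p + 1 / 100 * ck 4 p)
      * odot (Kflat e_x p) (Kflat e_y p) X Y.

Definition h2cd : tensor2 := fun p X Y =>
  - (1 / 8) * (dot (p.1 + p.2) e_z * dot (p.2 - p.1) e_x
               + dot (p.1 + p.2) e_x * dot (p.2 - p.1) e_z)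
    * G (sin (2 * theta p) / Num.sqrt 3)
    * odot (Kflat e_z p) (Kflat e_z p) X Y
  + dot (p.1 + p.2) e_z * dot (p.2 - p.1) e_z / (2 * (4 - ck 2 p ^+ 2))
    * odot (Kflat e_x p) (Kflat e_z p) X Y.

Definition h2 (lc ld : R) : tensor2 := fun p X Y =>
  h2aa p X Y + h2bb p X Y + 2 * h2ab p X Y
  + lc ^+ 2 * h2cc p X Y + 2 * lc * h2ac p X Y + 2 * lc * h2bc p X Y
  + ld ^+ 2 * h2dd p X Y + 2 * ld * h2ad p X Y + 2 * ld * h2bd p X Y
  + 2 * lc * ld * h2cd p X Y.

Definition g_ (lc ld s : R) : tensor2 := fun p X Y =>
  g p X Y + s * h1 lc ld p X Y + s ^+ 2 * h2 lc ld p X Y.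

Lemma dotE u w : dot u w = u 0 0 * w 0 0 + u 0 1 * w 0 1 + u 0 2 * w 0 2.
Proof.
rewrite /dot !big_ord_recl big_ord0 addr0 addrA.
by congr (_ * _ + _ * _ + _ * _); congr (_ 0 _); apply/val_inj.
Qed.

Lemma dotC u w : dot u w = dot w u.
Proof. by rewrite !dotE; ring. Qed.

Lemma dotDl u u' w : dot (u + u') w = dot u w + dot u' w.
Proof. by rewrite !dotE !mxE; ring. Qed.

Lemma dotNl u w : dot (- u) w = - dot u w.
Proof. by rewrite !dotE !mxE; ring. Qed.

Lemma dotZl c u w : dot (c *: u) w = c * dot u w.
Proof. by rewrite !dotE !mxE; ring. Qed.

Lemma dotDr u w w' : dot u (w + w') = dot u w + dot u w'.
Proof. by rewrite !(dotC u) dotDl. Qed.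

Lemma dotNr u w : dot u (- w) = - dot u w.
Proof. by rewrite !(dotC u) dotNl. Qed.

Lemma dotZr c u w : dot u (c *: w) = c * dot u w.
Proof. by rewrite !(dotC u) dotZl. Qed.

Lemma dot_ge0 u : 0 <= dot u u.
Proof. by rewrite sumr_ge0 // => i _; rewrite -expr2 sqr_ge0. Qed.

Lemma dot_eq0 u : dot u u = 0 -> u = 0.
Proof.
move/eqP; rewrite psumr_eq0; last by move=> i _; rewrite -expr2 sqr_ge0.
move=> /allP h; apply/rowP => i; rewrite mxE.
by have := h i (mem_index_enum _); rewrite mulf_eq0 orbb => /eqP.
Qed.

Lemma enorm_sqr u : enorm u ^+ 2 = dot u u.
Proof. by rewrite /enorm sqr_sqrtr // dot_ge0. Qed.

Lemma crossE u w : [/\ cross u w 0 0 = u 0 1 * w 0 2 - u 0 2 * w 0 1,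
  cross u w 0 1 = u 0 2 * w 0 0 - u 0 0 * w 0 2 &
  cross u w 0 2 = u 0 0 * w 0 1 - u 0 1 * w 0 0].
Proof.
have E (a b : 'I_3) : a = b :> nat -> a = b by apply: val_inj.
split; rewrite mxE.
- by rewrite (E (0 + 1) 1) // (E (0 + 2) 2).
- by rewrite (E (1 + 1) 2) // (E (1 + 2) 0).
- by rewrite (E (2 + 1) 0) // (E (2 + 2) 1).
Qed.

Lemma dot_cross u a w b :
  dot (cross u a) (cross w b) = dot u w * dot a b - dot u b * dot a w.
Proof.
rewrite !dotE; have [-> -> ->] := crossE u a; have [-> -> ->] := crossE w b.
ring.
Qed.

Lemma dot_crossl u w : dot (cross u w) u = 0.
Proof. by rewrite !dotE; have [-> -> ->] := crossE u w; ring. Qed.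

Lemma dot_crossr u w : dot (cross u w) w = 0.
Proof. by rewrite !dotE; have [-> -> ->] := crossE u w; ring. Qed.

Lemma nondeg_dot p : M_nondeg p ->
  [/\ dot p.1 p.1 = 1, dot p.2 p.2 = 1 & -1 < dot p.1 p.2 < 1].
Proof.
move=> [[n1 n2] h1 h2].
have d1 : dot p.1 p.1 = 1 by rewrite -enorm_sqr n1 expr1n.
have d2 : dot p.2 p.2 = 1 by rewrite -enorm_sqr n2 expr1n.
split=> //; apply/andP; split; rewrite lt_neqAle; apply/andP; split.
- apply/eqP => e; apply: h2; apply/eqP; rewrite -addr_eq0; apply/eqP.
  by apply: dot_eq0; rewrite !(dotDl, dotDr) d1 d2 (dotC p.2) -e; ring.
- have := dot_ge0 (p.1 + p.2).
  by rewrite !(dotDl, dotDr) d1 d2 (dotC p.2); lra.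
- apply/eqP => e; apply: h1; apply/eqP; rewrite -subr_eq0; apply/eqP.
  by apply: dot_eq0; rewrite !(dotDl, dotDr, dotNl, dotNr) d1 d2 (dotC p.2) e; ring.
- have := dot_ge0 (p.1 - p.2).
  by rewrite !(dotDl, dotDr, dotNl, dotNr) d1 d2 (dotC p.2); lra.
Qed.

Lemma cross_neq0 p : M_nondeg p -> dot (cross p.1 p.2) (cross p.1 p.2) != 0.
Proof.
move=> /nondeg_dot[d1 d2 /andP[c1 c2]]; rewrite dot_cross d1 d2 (dotC p.2).
by rewrite gt_eqF //; nra.
Qed.

Lemma theta_sqr p : M_nondeg p ->
  sin (theta p) ^+ 2 = (1 - dot p.1 p.2) / 2 /\
  cos (theta p) ^+ 2 = (1 + dot p.1 p.2) / 2.
Proof.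
move=> /nondeg_dot[d1 d2 /andP[c1 c2]].
have e : cos (theta p) ^+ 2 = (1 + dot p.1 p.2) / 2.
  have : cos (theta p *+ 2) = dot p.1 p.2.
    by rewrite mulr2n /theta -splitr acosK // in_itv /= !ltW.
  by rewrite cosD -!expr2 sin2cos2 => <-; field.
by split=> //; rewrite sin2cos2 e; field.
Qed.

Lemma frame_orthogonal p i j : M_nondeg p ->
  dot2 (frame p i) (frame p j) = 2 *+ (i == j).
Proof.
move=> hp; have [d1 d2 /andP[c1 c2]] := nondeg_dot hp.
have [es ec] := theta_sqr hp.
have s0 : sin (theta p) != 0 by rewrite -sqrf_eq0 es; apply/eqP; nra.
have c0 : cos (theta p) != 0 by rewrite -sqrf_eq0 ec; apply/eqP; nra.
have e1 : enorm (p.1 + p.2) ^+ 2 = 2 + 2 * dot p.1 p.2.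
  by rewrite enorm_sqr !(dotDl, dotDr) d1 d2 (dotC p.2); ring.
have e2 : enorm (p.2 - p.1) ^+ 2 = 2 - 2 * dot p.1 p.2.
  by rewrite enorm_sqr !(dotDl, dotDr, dotNl, dotNr) d1 d2 (dotC p.2); ring.
have n1 : enorm (p.1 + p.2) != 0 by rewrite -sqrf_eq0 e1; apply/eqP; nra.
have n2 : enorm (p.2 - p.1) != 0 by rewrite -sqrf_eq0 e2; apply/eqP; nra.
have e3 := enorm_sqr (cross p.1 p.2).
have n3 : enorm (cross p.1 p.2) != 0 by rewrite -sqrf_eq0 e3 cross_neq0.
have z1 : dot p.1 (cross p.1 p.2) = 0 by rewrite dotC dot_crossl.
have z2 : dot p.2 (cross p.1 p.2) = 0 by rewrite dotC dot_crossr.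
have z3 := dot_crossl p.1 p.2; have z4 := dot_crossr p.1 p.2.
have [sq1 sq2] : dot (q1 p) (q1 p) = 1 /\ dot (q2 p) (q2 p) = 1.
  by rewrite /q1 /q2 /normalize !dotZl !dotZr -!enorm_sqr; split; field.
have sq3 : dot (q3 p) (q3 p) = 1.
  by rewrite /q3 /normalize !dotZl !dotZr -!enorm_sqr; field.
have q12 : dot (q1 p) (q2 p) = 0.
  rewrite /q1 /q2 /normalize !dotZl !dotZr !(dotDl, dotDr, dotNr).
  by rewrite d1 d2 (dotC p.2); ring.
have [q13 q23] : dot (q1 p) (q3 p) = 0 /\ dot (q2 p) (q3 p) = 0.
  rewrite /q1 /q2 /q3 /normalize !dotZl !dotZr !(dotDl, dotNl) z1 z2.
  by split; ring.
have [q31 q32] : dot (q3 p) p.1 = 0 /\ dot (q3 p) p.2 = 0.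
  by rewrite /q3 /normalize !dotZl z3 z4 !mulr0.
have [q11 q1e] : dot (q1 p) p.1 = dot (q1 p) p.2 /\ dot (q1 p) p.1 ^+ 2 = cos (theta p) ^+ 2.
  rewrite ec /q1 /normalize !dotZl !dotDl d1 d2 (dotC p.2); split; first by ring.
  by rewrite exprMn exprVn e1; field; apply/eqP; nra.
have [q21 q2e] : dot (q2 p) p.1 = - dot (q2 p) p.2 /\ dot (q2 p) p.1 ^+ 2 = sin (theta p) ^+ 2.
  rewrite es /q2 /normalize !dotZl !(dotDl, dotNl) d1 d2 (dotC p.2); split; first by ring.
  by rewrite exprMn exprVn e2; field; apply/eqP; nra.
have KK u w : dot2 (K u p) (K w p) =
    2 * dot u w - dot u p.1 * dot w p.1 - dot u p.2 * dot w p.2.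
  by rewrite /dot2 /= !dot_cross d1 d2 !(dotC _ w); ring.
have K4 u : dot2 (K u p) (m4 p) = 0.
  by rewrite /dot2 /= dotNr !dot_cross d1 d2 !(dotC _ (q3 p)) q31 q32; ring.
have m44 : dot2 (m4 p) (m4 p) = 2.
  by rewrite /dot2 /= dotNl dotNr !dot_cross d1 d2 q31 q32 sq3; ring.
have Zl c X Y : dot2 (c *: X) Y = c * dot2 X Y.
  by rewrite /dot2 /= !dotZl mulrDr.
have sym X Y : dot2 X Y = dot2 Y X.
  by rewrite /dot2 !(dotC X.1) !(dotC X.2).
have Zr c X Y : dot2 X (c *: Y) = c * dot2 X Y by rewrite sym Zl sym.
have q21' : dot (q2 p) p.2 = - dot (q2 p) p.1 by rewrite q21 opprK.
have K11 : dot2 (m1 p) (m1 p) = 2.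
  rewrite Zl Zr KK sq1 -q11; set a := dot _ _ in q1e *.
  rewrite (_ : _ - _ - _ = 2 * sin (theta p) ^+ 2); first by field.
  by rewrite -!expr2 q1e; lra.
have K22 : dot2 (m2 p) (m2 p) = 2.
  rewrite Zl Zr KK sq2 q21' mulrNN; set a := dot _ _ in q2e *.
  rewrite (_ : _ - _ - _ = 2 * cos (theta p) ^+ 2); first by field.
  by rewrite -!expr2 q2e; lra.
have K33 : dot2 (m3 p) (m3 p) = 2 by rewrite KK sq3 q31 q32; ring.
have K12 : dot2 (m1 p) (m2 p) = 0.
  by rewrite Zl Zr KK q12 q21' -q11; ring.
have K13 : dot2 (m1 p) (m3 p) = 0 by rewrite Zl KK q13 q31 q32; ring.
have K23 : dot2 (m2 p) (m3 p) = 0 by rewrite Zl KK q23 q31 q32; ring.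
have K14 : dot2 (m1 p) (m4 p) = 0 by rewrite Zl K4 mulr0.
have K24 : dot2 (m2 p) (m4 p) = 0 by rewrite Zl K4 mulr0.
have K34 : dot2 (m3 p) (m4 p) = 0 by exact: K4.
rewrite /frame !(tnth_nth 0).
by case: i => [[|[|[|[|//]]]] hi]; case: j => [[|[|[|[|//]]]] hj] /=;
  rewrite ?(K11, K22, K33, m44) ?(K12, K13, K14, K23, K24, K34) //;
  rewrite sym ?(K12, K13, K14, K23, K24, K34).
Qed.

Lemma coef_frame p i j : M_nondeg p -> coef p i (frame p j) = (i == j)%:R.
Proof.
move=> hp; rewrite /coef !frame_orthogonal // eqxx eq_sym.
by case: eqP => _; rewrite ?mul0r // divff // pnatr_eq0.
Qed.

(* g is the metric described by its values on the frame. *)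
Lemma g_frame p i j : M_nondeg p ->
  g p (frame p i) (frame p j) = frame_sqnorm p i *+ (i == j).
Proof.
move=> hp; rewrite /g (bigD1 i) //= big1 => [|k /negPf ki].
  by rewrite !coef_frame // eqxx mulr1 addr0 mulr_natr.
by rewrite !coef_frame // ki mulr0 mul0r.
Qed.

(* Curvature of a metric on a coordinate patch of R^4. *)

Definition partial (f : 'rV[R]_4 -> R) (i : 'I_4) (x : 'rV[R]_4) : R :=
  'D_(delta_mx 0 i) f x.

(* Components of the metric T in the local parametrization phi. *)
Definition pullback (phi : 'rV[R]_4 -> R3xR3 R) (T : tensor2)
    (x : 'rV[R]_4) : 'M[R]_4 :=
  \matrix_(i, j) T (phi x) ('D_(delta_mx 0 i) phi x) ('D_(delta_mx 0 j) phi x).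

(* Gamma^k_{ij} *)
Definition christoffel (A : 'rV[R]_4 -> 'M[R]_4) (k i j : 'I_4)
    (x : 'rV[R]_4) : R :=
  (\sum_l invmx (A x) k l *
     (partial (fun x => A x j l) i x + partial (fun x => A x i l) j x
      - partial (fun x => A x i j) l x)) / 2.

(* The l-th component of R(d_i, d_j) d_k, where
   R(X, Y) = [nabla_X, nabla_Y] - nabla_[X, Y]. *)
Definition riemann13 (A : 'rV[R]_4 -> 'M[R]_4) (l i j k : 'I_4)
    (x : 'rV[R]_4) : R :=
  partial (christoffel A l j k) i x - partial (christoffel A l i k) j x
  + \sum_m (christoffel A l i m x * christoffel A m j k x
            - christoffel A l j m x * christoffel A m i k x).

(* R(d_i, d_j, d_k, d_l) := <R(d_i, d_j) d_l, d_k>, the sign for which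
   R(X, Y, X, Y) is positive on a round sphere. *)
Definition riemann04 (A : 'rV[R]_4 -> 'M[R]_4) (i j k l : 'I_4)
    (x : 'rV[R]_4) : R :=
  \sum_m A x k m * riemann13 A m i j l x.

(* A local parametrization of M around y in M_nondeg. Its partial derivatives
   at 0 are m_1, ..., m_4 at y ([chart_partial]), so that [coef y] gives the
   components of tangent vectors at y in these coordinates. The curvature
   tensor does not depend on the choice of parametrization. *)
Definition chart y (x : 'rV[R]_4) : R3xR3 R :=
  let w := y + \sum_i x 0 i *: frame y i in (normalize w.1, normalize w.2).

Lemma frame_tangent p i :
  dot (frame p i).1 p.1 = 0 /\ dot (frame p i).2 p.2 = 0.
Proof.
rewrite /frame (tnth_nth 0).
by case: i => [[|[|[|[|//]]]] hi] /=; split;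
  rewrite ?(dotZl, dotNl) dot_crossr ?mulr0 ?oppr0.
Qed.

Lemma normalize_derivative u w : dot u u = 1 -> dot w u = 0 ->
  (fun h : R => h^-1 *: (normalize (u + h *: w) - normalize u)) @ 0^' --> w.
Proof.
move=> u1 wu; set c := dot w w.
pose N (h : R) := Num.sqrt (1 + h ^+ 2 * c).
have c0 : 0 <= c := dot_ge0 w.
have N1 h : 1 <= N h.
  by rewrite -[leLHS]sqrtr1 ler_wsqrtr // lerDl mulr_ge0 // sqr_ge0.
have Nn h : enorm (u + h *: w) = N h.
  rewrite /enorm /N !(dotDl, dotDr, dotZl, dotZr) u1 wu (dotC u) wu -/c.
  by congr Num.sqrt; ring.
have N0 : enorm u = 1 by rewrite /enorm u1 sqrtr1.
have N2 h : N h ^+ 2 = 1 + h ^+ 2 * c.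
  by rewrite sqr_sqrtr // addr_ge0 // mulr_ge0 // sqr_ge0.
pose F h := (N h)^-1 *: w - (h * c / (N h * (N h + 1))) *: u.
have cN : N h @[h --> (0 : R)] --> (1 : R).
  apply: (@cvg_comp _ _ _ (fun h : R => 1 + h ^+ 2 * c) Num.sqrt _ (nbhs (1 : R))).
    have -> : nbhs (1 : R) = nbhs (1 + 0 ^+ 2 * c) by rewrite expr0n mul0r addr0.
    apply: cvgD; first exact: cvg_cst.
    by apply: cvgM; [exact: exprn_continuous | exact: cvg_cst].
  by have := @sqrt_continuous R 1; rewrite /continuous_at sqrtr1.
have cA : (N h)^-1 @[h --> (0 : R)] --> (1^-1 : R).
  by apply: cvgV => //; exact: oner_neq0.
have cB : h * c / (N h * (N h + 1)) @[h --> (0 : R)] --> (0 * c / (1 * (1 + 1)) : R).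
  apply: cvgM; first by apply: cvgM; [exact: cvg_id | exact: cvg_cst].
  apply: cvgV; first by rewrite mul1r gt_eqF // addr_gt0.
  by apply: cvgM => //; apply: cvgD => //; exact: cvg_cst.
have cF : F h @[h --> 0^'] --> w.
  apply: (@cvg_trans _ (F h @[h --> (0 : R)])).
    by move=> A; exact: nbhs_dnbhs.
  have -> : nbhs w = nbhs (1^-1 *: w - (0 * c / (1 * (1 + 1))) *: u).
    by rewrite invr1 scale1r !mul0r scale0r subr0.
  exact: (cvgB (cvgZ cA (cvg_cst w)) (cvgZ cB (cvg_cst u))).
apply: cvg_trans cF; apply: near_eq_cvg; near=> h.
have h0 : h != 0 by near: h; exact: nbhs_dnbhs_neq.
have n0 : N h != 0 by rewrite gt_eqF // (lt_le_trans ltr01).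
have n1 : N h + 1 != 0 by rewrite gt_eqF // addr_gt0 // (lt_le_trans ltr01).
rewrite /F /normalize Nn N0 invr1 scale1r; apply/rowP => i; rewrite !mxE.
have -> : c = (N h ^+ 2 - 1) / h ^+ 2 by rewrite N2; field.
by field; rewrite n0 n1 h0.
Unshelve. all: by end_near.
Qed.

Lemma chart0 y : M_nondeg y -> chart y 0 = y.
Proof.
move=> [[n1 n2] _ _]; rewrite /chart big1 => [|i _]; last by rewrite mxE scale0r.
by rewrite addr0 /normalize n1 n2 invr1 !scale1r -surjective_pairing.
Qed.

Lemma chart_partial y i : M_nondeg y ->
  'D_(delta_mx 0 i) (chart y) 0 = frame y i.
Proof.
move=> hy; have [d1 d2 _] := nondeg_dot hy; have [t1 t2] := frame_tangent y i.
rewrite /derive; apply: cvg_lim => //.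
have -> : (fun h : R => h^-1 *:
    ((chart y \o shift 0) (h *: delta_mx 0 i) - chart y 0)) =
  fun h => (h^-1 *: (normalize (y.1 + h *: (frame y i).1) - normalize y.1),
            h^-1 *: (normalize (y.2 + h *: (frame y i).2) - normalize y.2)).
  apply/funext => h /=; rewrite addr0 /chart.
  rewrite (bigD1 i) //= big1 => [|k /negPf ki]; last first.
    by rewrite !mxE eqxx ki mulr0 scale0r.
  rewrite !mxE !eqxx mulr1 addr0 big1 => [|k _]; last by rewrite mxE scale0r.
  have E1 w : w + (0 : R3xR3 R).1 = w := addr0 w.
  have E2 w : w + (0 : R3xR3 R).2 = w := addr0 w.
  by rewrite !E1 ?E2.
rewrite [frame y i]surjective_pairing.
exact: (cvg_pair (normalize_derivative d1 t1) (normalize_derivative d2 t2)).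
Qed.

(* The (0,4) curvature tensor at y in M_nondeg of the metric T. *)
Definition curvature (T : tensor2) y X Y Z W : R :=
  \sum_i \sum_j \sum_k \sum_l coef y i X * coef y j Y * coef y k Z * coef y l W
    * riemann04 (pullback (chart y) T) i j k l 0.

(* z^1, ..., z^4 are the entries 0, ..., 3 of z. *)
Definition m3z y (z : 'rV[R]_4) : R3xR3 R := m3 y + z 0 0 *: m1 y + z 0 2 *: m2 y.
Definition m4z y (z : 'rV[R]_4) : R3xR3 R := m4 y + z 0 3 *: m1 y + z 0 1 *: m2 y.

Definition v (lc ld : R) y (z : 'rV[R]_4) (s : R) : R :=
  curvature (g_ lc ld s) y (m3z y z) (m4z y z) (m3z y z) (m4z y z).

(* v^(k): the Taylor coefficient of order k at s = 0. *)
Definition vcoef (k : nat) (lc ld : R) y (z : 'rV[R]_4) : R :=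
  derive1n k (v lc ld y z) 0 / k`!%:R.

Definition v0_hess (lc ld : R) y : 'M[R]_4 :=
  \matrix_(a, b) partial (partial (vcoef 0 lc ld y) a) b 0.

Definition v1_grad (lc ld : R) y : 'cV[R]_4 :=
  \col_a partial (vcoef 1 lc ld y) a 0.

Definition zbar (lc ld : R) y : 'cV[R]_4 :=
  invmx (v0_hess lc ld y) *m (- v1_grad lc ld y).

Definition V2 (lc ld : R) y : R :=
  vcoef 2 lc ld y 0 + (\sum_a v1_grad lc ld y a 0 * zbar lc ld y a 0) / 2.

End Geometry.

(* Main.v *)
(** At a nondegenerate point put x_i = <e_x, q_i>, y_i = <e_y, q_i> and
    z_i = <e_z, q_i>.  Then
      V^(2) = kappa (x_3^2 + y_3^2) + lambda_d^2 Q,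
    where kappa = (42025/6) sqrt(5/3) - 3472117/384 > 0 and
    |Q| <= 2 (z_1^2 + z_2^2); lambda_c drops out.  Since (q_i) is orthonormal,
    x_3^2 + y_3^2 = z_1^2 + z_2^2 = 1 - z_3^2, which gives the bound, and
    z_1 = z_2 = 0 on Sigma.

    V^(2) depends only on the second-order Taylor expansions, at the base point
    of the chart, of the components of g, h^(1) and h^(2).  The curvature is
    affine in the second derivatives and quadratic in the Christoffel symbols
    of the first kind.  Those of g vanish for the index pairs (3,3), (3,4) and
    (4,4), so that v^(2)(y,0) is linear in h^(2) plus quadratic in h^(1), while
    the Hessian of v^(0) splits into two invertible 2x2 blocks.

    f_aa and f_bb enter through their second derivatives in theta only.  There
    the series becomes sum_n r^n cos(2n theta), a Poisson kernel, hence a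
    rational function of cos(2 theta), and everything but kappa cancels. *)
Require Import Defs.
From mathcomp Require Import all_boot all_order all_algebra.
From mathcomp Require Import all_classical all_reals all_analysis.
From mathcomp Require Import perm ring lra.
Import Order.TTheory GRing.Theory Num.Theory.
Import numFieldNormedType.Exports.
Local Open Scope classical_set_scope.
Local Open Scope ring_scope.
Set Implicit Arguments.
Unset Strict Implicit.
Unset Printing Implicit Defensive.

(** * Second-order Taylor expansions *)

(** The chart components of the tensors are too large to differentiate symbolically. Every function
    is therefore carried with its second-order jet at the origin; jets are combined by the sum,
    product and chain rules, and a computed jet is replaced by a short table as soon as possible.
    What remains to be checked is then a rational identity in C = cos theta and S = sin theta modulo
    S^2 = 1 - C^2. Two choices keep these identities small. In the frame q1, q2, q3 all tensors
    depend on the point only through theta and the coordinates of e_x, e_y, e_z. And the passage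
    from moving-frame components to Christoffel symbols is carried out once, for an arbitrary
    symmetric tensor, so that only the few components that reach V^(2) are ever expanded. The
    functions f_aa and f_bb are solutions of a differential equation: their second derivatives are
    prescribed so that the coefficients of x_3^2 and y_3^2 become one and the same constant. *)

Section DirectionalDerivatives.
Context {R : realType}.
Implicit Types V W : normedModType R.

(** The two difference quotients are the same function of [h]. This transports one-variable rules,
    such as the chain rule, to directional derivatives without any Fréchet differentiability. *)
Lemma is_derive_line V W (f : V -> W) x v d :
  is_derive x v f d <-> is_derive (0 : R) (1 : R) (fun h => f (h *: v + x)) d.
Proof.
have e : (fun h : R => h^-1 *: (((fun h => f (h *: v + x)) \o shift 0) (h *: (1 : R))
    - (fun h => f (h *: v + x)) 0)) =
  (fun h => h^-1 *: ((f \o shift x) (h *: v) - f x)).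
  by apply/funext => h /=; rewrite addr0 scale0r add0r [_ *: 1]mulr1.
split=> -[D E]; (split; [have := D | rewrite -E]); by rewrite /derivable /derive e.
Qed.

Lemma is_derive_comp_real V (F : R -> R) (f : V -> R) x v a b :
  is_derive (f x) 1 F a -> is_derive x v f b ->
  is_derive x v (fun y => F (f y)) (a * b).
Proof.
move=> hF /is_derive_line hf; apply/is_derive_line.
apply: (@is_derive1_comp _ F (fun h => f (h *: v + x))) => //.
by rewrite scale0r add0r.
Qed.

Lemma is_deriveMr V (f g : V -> R) x v df dg :
  is_derive x v f df -> is_derive x v g dg ->
  is_derive x v (fun y => f y * g y) (f x * dg + df * g x).
Proof.
move=> hf hg; have -> : df * g x = g x *: df by rewrite mulrC.
exact: (is_deriveM hf hg).
Qed.

Lemma is_deriveDr V W (f g : V -> W) x v df dg :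
  is_derive x v f df -> is_derive x v g dg ->
  is_derive x v (fun y => f y + g y) (df + dg).
Proof. exact: is_deriveD. Qed.

Lemma is_deriveNr V W (f : V -> W) x v df :
  is_derive x v f df -> is_derive x v (fun y => - f y) (- df).
Proof. exact: is_deriveN. Qed.

Lemma is_derive_scale V W (f : V -> R) (w : W) x v df :
  is_derive x v f df -> is_derive x v (fun y => f y *: w) (df *: w).
Proof.
move=> [hd hv].
have c : h^-1 *: (((fun y => f y *: w) \o shift x) (h *: v) - f x *: w)
    @[h --> (0 : R)^'] --> df *: w.
  have -> : (fun h : R => h^-1 *: (((fun y => f y *: w) \o shift x) (h *: v) - f x *: w)) =
    fun h => (h^-1 *: ((f \o shift x) (h *: v) - f x)) *: w.
    by apply/funext => h /=; rewrite -scalerBl scalerA.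
  apply: cvgZr_tmp.
  by rewrite -hv; exact: hd.
by split; [apply/cvg_ex; exists (df *: w) | apply/cvg_lim].
Qed.

Lemma is_derive_sumr V W (I : Type) (r : seq I) (F : I -> V -> W) x v (dF : I -> W) :
  (forall i, is_derive x v (F i) (dF i)) ->
  is_derive x v (fun y => \sum_(i <- r) F i y) (\sum_(i <- r) dF i).
Proof.
move=> h; elim: r => [|i r IH].
  have -> : (fun y => \sum_(i <- [::]) F i y) = cst 0.
    by apply/funext => y; rewrite big_nil.
  by rewrite big_nil; exact: is_derive_cst.
have -> : (fun y => \sum_(i <- i :: r) F i y) = (fun y => F i y + \sum_(i <- r) F i y).
  by apply/funext => y; rewrite big_cons.
by rewrite big_cons; apply: is_deriveDr.
Qed.

Lemma derivable_prodr V (I : Type) (r : seq I) (F : I -> V -> R) x v :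
  (forall i, derivable (F i) x v) ->
  derivable (fun y => \prod_(i <- r) F i y) x v.
Proof.
move=> h; elim: r => [|i r IH].
  have -> : (fun y => \prod_(i <- [::]) F i y) = cst 1.
    by apply/funext => y; rewrite big_nil.
  exact: derivable_cst.
have -> : (fun y => \prod_(i <- i :: r) F i y) = (F i * (fun y => \prod_(i <- r) F i y)).
  by apply/funext => y; rewrite big_cons.
exact: (derivableM (h i) IH).
Qed.

End DirectionalDerivatives.

Lemma is_derive_pair {R : realType} {V W1 W2 : normedModType R} (f : V -> W1) (g : V -> W2) x v df dg :
  is_derive x v f df -> is_derive x v g dg ->
  is_derive x v (fun y => (f y, g y)) (df, dg).
Proof.
move=> [fd fv] [gd gv].
have c : h^-1 *: (((fun y => (f y, g y)) \o shift x) (h *: v) - (f x, g x))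
    @[h --> (0 : R)^'] --> (df, dg).
  have -> : (fun h : R => h^-1 *: (((fun y => (f y, g y)) \o shift x) (h *: v) - (f x, g x))) =
    fun h => (h^-1 *: ((f \o shift x) (h *: v) - f x), h^-1 *: ((g \o shift x) (h *: v) - g x)) by [].
  by apply: cvg_pair; [rewrite -fv; exact: fd | rewrite -gv; exact: gd].
by split; [apply/cvg_ex; exists (df, dg) | apply/cvg_lim].
Qed.

Section Jets.
Context {R : realType} {n : nat}.
Implicit Types (f g : 'rV[R]_n -> R) (i j : 'I_n).

(* A second-order Taylor expansion at the origin: value, gradient, Hessian. *)
Record jet2 := Jet2 { jv : R; jd : 'I_n -> R; jh : 'I_n -> 'I_n -> R }.

(** First derivatives must exist near 0, second ones only at 0: this is all that a curvature at the
    base point requires. Continuity is a separate clause because directional derivatives do not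
    imply it and the chain rule uses it. The entry [jh J i j] differentiates first along [i], then
    along [j]. *)
Definition has_jet f (J : jet2) := [/\ f 0 = jv J, {for 0, continuous f} &
  forall i, exists df : 'rV[R]_n -> R,
   [/\ \forall x \near 0, is_derive x (delta_mx 0 i) f (df x), df 0 = jd J i &
       forall j, is_derive 0 (delta_mx 0 j) df (jh J i j)]].

Definition jcst c := Jet2 c (fun _ => 0) (fun _ _ => 0).
Definition jadd J K := Jet2 (jv J + jv K) (fun i => jd J i + jd K i)
  (fun i j => jh J i j + jh K i j).
Definition jmul J K := Jet2 (jv J * jv K)
  (fun i => jv J * jd K i + jd J i * jv K)
  (fun i j => jv J * jh K i j + jd J j * jd K i + jd J i * jd K j + jh J i j * jv K).
(** The numbers [F0], [F1], [F2] are the value and the first two derivatives of the outer function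
    at [jv J]. *)
Definition jcomp (F0 F1 F2 : R) J := Jet2 F0 (fun i => F1 * jd J i)
  (fun i j => F1 * jh J i j + F2 * jd J j * jd J i).
Definition jX k := Jet2 0 (fun i => (i == k)%:R) (fun _ _ => 0).

Lemma has_jet_cst c : has_jet (fun _ => c) (jcst c).
Proof.
split=> //; first exact: cst_continuous.
move=> i; exists (cst 0); split=> //; last by move=> j; exact: is_derive_cst.
by near=> x; exact: is_derive_cst.
Unshelve. all: by end_near. Qed.

Lemma has_jet_coord k : has_jet (fun x => x 0 k) (jX k).
Proof.
split; rewrite /= ?mxE //.
  by move=> x; exact: coord_continuous.
move=> i; exists (cst (i == k)%:R); split=> //; last by move=> j; exact: is_derive_cst.
near=> x; apply/is_derive_line.
have -> : (fun h : R => (h *: delta_mx 0 i + x) 0 k) = (fun h : R => h *: (i == k)%:R + x 0 k).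
  by apply/funext => h; rewrite !mxE eqxx eq_sym.
have h1 : is_derive (0 : R) (1 : R) (fun h : R => h *: ((i == k)%:R : R)) (1 *: ((i == k)%:R : R)).
  exact: (is_derive_scale ((i == k)%:R : R) (is_derive_id (0 : R) (1 : R))).
by have := is_deriveDr h1 (is_derive_cst (x 0 k) (0 : R) (1 : R)); rewrite addr0 scale1r.
Unshelve. all: by end_near. Qed.

Lemma has_jet_add f g J K : has_jet f J -> has_jet g K ->
  has_jet (fun x => f x + g x) (jadd J K).
Proof.
move=> [f0 fc fd] [g0 gc gd]; split=> /=; first by rewrite f0 g0.
  exact: (continuousD fc gc).
move=> i; have [df [df1 df2 df3]] := fd i; have [dg [dg1 dg2 dg3]] := gd i.
exists (fun x => df x + dg x); split=> [||j]; last exact: is_deriveDr.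
  by near=> x; apply: is_deriveDr; near: x.
by rewrite df2 dg2.
Unshelve. all: by end_near. Qed.

Lemma has_jet_derive f J : has_jet f J -> forall i, is_derive 0 (delta_mx 0 i) f (jd J i).
Proof. by move=> [_ _ h] i; have [df [h1 <- _]] := h i; exact: (nbhs_singleton h1). Qed.

Lemma has_jet_mul f g J K : has_jet f J -> has_jet g K ->
  has_jet (fun x => f x * g x) (jmul J K).
Proof.
move=> hf hg; have f' := has_jet_derive hf; have g' := has_jet_derive hg.
move: hf hg => [f0 fc fd] [g0 gc gd]; split=> /=; first by rewrite f0 g0.
  exact: (continuousM fc gc).
move=> i; have [df [df1 df2 df3]] := fd i; have [dg [dg1 dg2 dg3]] := gd i.
exists (fun x => f x * dg x + df x * g x); split=> [||j].
- by near=> x; apply: is_deriveMr; near: x.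
- by rewrite df2 dg2 f0 g0.
- have := is_deriveDr (is_deriveMr (f' j) (dg3 j)) (is_deriveMr (df3 j) (g' j)).
  by rewrite f0 g0 df2 dg2 !addrA.
Unshelve. all: by end_near. Qed.

Lemma has_jet_comp f J (F F' : R -> R) (F2 : R) : has_jet f J ->
  (\forall t \near jv J, is_derive (t : R) (1 : R) F (F' t)) ->
  is_derive (jv J) (1 : R) F' F2 ->
  has_jet (fun x => F (f x)) (jcomp (F (jv J)) (F' (jv J)) F2 J).
Proof.
move=> hf hF hF'; have f' := has_jet_derive hf.
move: hf => [f0 fc fd]; split=> /=; first by rewrite f0.
  have [D _] := nbhs_singleton hF.
  apply: (@continuous_comp _ _ _ f F) => //; rewrite f0.
  by apply: differentiable_continuous; apply/derivable1_diffP.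
move=> i; have [df [df1 df2 df3]] := fd i.
exists (fun x => F' (f x) * df x); split=> [||j].
- near=> x; apply: is_derive_comp_real; last by near: x.
  (* Continuity of [f] pulls the neighbourhood of [f 0] on which [F] is differentiable back to a
     neighbourhood of 0. *)
  by near: x; apply: (fc (fun t => is_derive (t : R) (1 : R) F (F' t))); rewrite f0.
- by rewrite df2 f0.
- have hF'0 : is_derive (f 0) (1 : R) F' F2 by rewrite f0.
  have := is_deriveMr (is_derive_comp_real hF'0 (f' j)) (df3 j).
  by rewrite f0 df2.
Unshelve. all: by end_near. Qed.

Lemma has_jet_near f g J : (\forall x \near (0 : 'rV[R]_n), f x = g x) -> has_jet f J -> has_jet g J.
Proof.
move=> fg [f0 fc fd]; have e0 := nbhs_singleton fg; split; first by rewrite -e0.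
  by apply: cvg_trans (near_eq_cvg fg) _; rewrite -e0.
move=> i; have [df [df1 df2 df3]] := fd i; exists df; split=> //.
near=> x; apply: (near_eq_is_derive (f := f)); last by near: x.
(* Equality near 0 also holds near each point close to 0, which is what the derivative at [x]
   depends on. *)
by near: x; exact: (near_join fg).
Unshelve. all: by end_near. Qed.

(** Pointwise equality of gradients and Hessians suffices, so a jet produced by the calculus can be
    exchanged for a simplified table after finitely many [ring] or [field] checks. *)
Lemma has_jet_eq f J K : has_jet f J -> jv J = jv K -> jd J =1 jd K ->
  (forall i j, jh J i j = jh K i j) -> has_jet f K.
Proof.
move=> [f0 fc fd] e0 e1 e2; split=> //; first by rewrite -e0.
move=> i; have [df [df1 df2 df3]] := fd i; exists df; split=> //; first by rewrite -e1.
by move=> j; rewrite -e2.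
Qed.

Lemma has_jet_ext f g J : f =1 g -> has_jet f J -> has_jet g J.
Proof. by move=> /funext ->. Qed.

End Jets.

(** * Derivative of the inverse matrix *)

Section InverseMatrix.
Context {R : realType}.

Lemma derivableMr (V : normedModType R) (f g : V -> R) x v :
  derivable f x v -> derivable g x v -> derivable (fun y => f y * g y) x v.
Proof.
move=> /derivableP hf /derivableP hg; exact (@ex_derive _ _ _ _ _ _ _ (is_deriveMr hf hg)).
Qed.

Lemma derivable_det (V : normedModType R) n (B : V -> 'M[R]_n) x v :
  (forall i j, derivable (fun y => B y i j) x v) ->
  derivable (fun y => \det (B y)) x v.
Proof.
move=> h; rewrite /determinant.
pose F (s : 'S_n) := fun y => (-1) ^+ s * \prod_(i < n) B y i (s i).
have hF s : derivable (F s) x v.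
  have hp : derivable (fun y => \prod_(i < n) B y i (s i)) x v.
    by apply: (derivable_prodr (F := fun i y => B y i (s i))) => i; exact: h.
  exact: (derivableMr (derivable_cst ((-1) ^+ s : R) x v) hp).
exact (@ex_derive _ _ _ _ _ _ _ (is_derive_sumr _ (fun s => derivableP (hF s)))).
Qed.

(** The determinant stays nonzero near [t], and there [invmx] is given by the cofactor formula, a
    quotient of polynomials in the entries. Outside the units [invmx] follows a different clause,
    hence the passage through a neighbourhood. *)
Lemma derivable_invmx n (B : R -> 'M[R]_n) (t : R) :
  (forall i j, derivable (fun u => B u i j) t 1) -> B t \in unitmx ->
  (\forall u \near t, B u \in unitmx) /\
  forall i j, derivable (fun u => invmx (B u) i j) t 1.
Proof.
move=> h Bt; have hd := derivable_det h.
have nu : \forall u \near t, B u \in unitmx.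
  have c : {for t, continuous (fun u => \det (B u))}.
    by apply: differentiable_continuous; apply/derivable1_diffP.
  have d0 : \det (B t) != 0 by rewrite -unitfE -unitmxE.
  near=> u; rewrite unitmxE unitfE; near: u.
  by apply: (c [set z | z != 0]); exact: open_neq.
split=> [|i j]; first exact: nu.
have e : \forall u \near t, (\det (B u))^-1 * ((-1) ^+ (j + i) * \det (row' j (col' i (B u))))
    = invmx (B u) i j.
  near=> u; have Bu : B u \in unitmx by near: u.
  by rewrite /invmx Bu !mxE.
have dadj : derivable (fun u => \det (row' j (col' i (B u)))) t 1.
  apply: derivable_det => k l.
  have -> : (fun u => row' j (col' i (B u)) k l) = (fun u => B u (lift j k) (lift i l)).
    by apply/funext => u; rewrite !mxE.
  exact: h.
have dv : derivable (fun u => (\det (B u))^-1 * ((-1) ^+ (j + i) * \det (row' j (col' i (B u))))) t 1.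
  apply: (derivableMr (f := fun u => (\det (B u))^-1)); last first.
    exact: (derivableMr (derivable_cst _ _ _) dadj).
  by apply: derivableV; [rewrite -unitfE -unitmxE | exact: hd].
have [D _] := near_eq_is_derive e (derivableP dv); exact: D.
Unshelve. all: by end_near. Qed.

Lemma is_derive_invmx (V : normedModType R) n (B : V -> 'M[R]_n) x v (dB : 'M[R]_n) :
  (forall i j, is_derive x v (fun y => B y i j) (dB i j)) -> B x \in unitmx ->
  forall i j, is_derive x v (fun y => invmx (B y) i j)
    (- (invmx (B x) *m dB *m invmx (B x)) i j).
Proof.
move=> h Bx i j; apply/is_derive_line.
pose C h := B (h *: v + x).
have C0 : C 0 = B x by rewrite /C scale0r add0r.
have hC k l : is_derive (0 : R) (1 : R) (fun u => C u k l) (dB k l).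
  by have /is_derive_line := h k l.
have [|nu hd] := derivable_invmx (B := C) (t := 0) (fun k l => @ex_derive _ _ _ _ _ _ _ (hC k l)).
  by rewrite C0.
pose D : 'M[R]_n := \matrix_(k, l) 'D_1 (fun u => invmx (C u) k l) 0.
have hD k l : is_derive (0 : R) (1 : R) (fun u => invmx (C u) k l) (D k l).
  by rewrite mxE; exact: derivableP (hd k l).
suff DE : D = - (invmx (B x) *m dB *m invmx (B x)).
  by have := hD i j; rewrite DE [X in is_derive _ _ _ X -> _]mxE.
(* The product rule applied to [C u *m invmx (C u)], which is the constant identity matrix near
   0. *)
have E : B x *m D + dB *m invmx (B x) = 0.
  apply/matrixP => k l; rewrite !mxE -big_split /=.
  have H : is_derive (0 : R) (1 : R) (fun u => \sum_m C u k m * invmx (C u) m l)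
     (\sum_m (C 0 k m * D m l + dB k m * invmx (C 0) m l)).
    apply: (is_derive_sumr _ (F := fun m u => C u k m * invmx (C u) m l)) => m.
    exact: is_deriveMr (hC k m) (hD m l).
  have H' : is_derive (0 : R) (1 : R) (fun u => \sum_m C u k m * invmx (C u) m l) 0.
    have hn : \forall u \near (0 : R), cst ((k == l)%:R : R) u = \sum_m C u k m * invmx (C u) m l.
      near=> u; have Cu : C u \in unitmx by near: u.
      by have := congr1 (fun M : 'M[R]_n => M k l) (mulmxV Cu); rewrite !mxE => <-.
    exact: (near_eq_is_derive hn (is_derive_cst ((k == l)%:R : R) (0 : R) (1 : R))).
  by have [_] := H'; have [_ ->] := H; rewrite C0.
have -> : D = invmx (B x) *m (B x *m D) by rewrite mulmxA mulVmx // mul1mx.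
by rewrite (_ : B x *m D = - (dB *m invmx (B x))) ?mulmxN ?mulmxA //; apply/eqP; rewrite -addr_eq0 E.
Unshelve. all: by end_near. Qed.

End InverseMatrix.

(** * Curvature from Taylor expansions *)

Section RiemannJet.
Context {R : realType}.
Local Notation U := 'rV[R]_4.
Implicit Types (a : 'I_4 -> 'I_4 -> @jet2 R 4) (B : 'M[R]_4).

(* Christoffel symbols of the first kind and their derivatives. *)
Definition chr1 a (l i j : 'I_4) : R :=
  (jd (a j l) i + jd (a i l) j - jd (a i j) l) / 2.
Definition dchr1 a (m l i j : 'I_4) : R :=
  (jh (a j l) i m + jh (a i l) j m - jh (a i j) l m) / 2.

Definition riem_lin a (i j k l : 'I_4) : R := dchr1 a i k j l - dchr1 a j k i l.

(** [B] is the inverse metric. The form is bilinear in two jet matrices because differentiation in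
    [s] produces mixed products of the symbols of g and of h^(1). *)
Definition riem_quad B a a' (i j k l : 'I_4) : R :=
  \sum_m \sum_n B m n * (chr1 a m j k * chr1 a' n i l - chr1 a m i k * chr1 a' n j l).

(** Differentiating a Christoffel symbol requires its formula on a whole neighbourhood. Choice fixes
    derivative functions [d1] for all entries; near 0 they agree with [partial], and the symbol
    becomes a sum of products of [invmx (A x)] with the differentiable functions [E l]. *)
Lemma christoffel_jet (A : U -> 'M[R]_4) a (k i j : 'I_4) :
  (forall i j, has_jet (fun x => A x i j) (a i j)) -> A 0 \in unitmx ->
  christoffel A k i j 0 = \sum_l invmx (A 0) k l * chr1 a l i j /\
  forall m, is_derive (0 : U) (delta_mx 0 m) (christoffel A k i j)
    (\sum_l (invmx (A 0) k l * dchr1 a m l i j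
       - (invmx (A 0) *m (\matrix_(p, q) jd (a p q) m) *m invmx (A 0)) k l * chr1 a l i j)).
Proof.
move=> hA uA.
have hd p q r : exists df : U -> R,
   [/\ \forall x \near 0, is_derive x (delta_mx 0 r) (fun x => A x p q) (df x), df 0 = jd (a p q) r &
       forall m, is_derive 0 (delta_mx 0 m) df (jh (a p q) r m)].
  by have [_ _] := hA p q; apply.
have [d1 hd1] : {d1 : 'I_4 -> 'I_4 -> 'I_4 -> U -> R & forall p q r,
   [/\ \forall x \near 0, is_derive x (delta_mx 0 r) (fun x => A x p q) (d1 p q r x),
       d1 p q r 0 = jd (a p q) r &
       forall m, is_derive 0 (delta_mx 0 m) (d1 p q r) (jh (a p q) r m)]}.
  have [f hf] := boolp.choice (fun pqr : 'I_4 * 'I_4 * 'I_4 => hd pqr.1.1 pqr.1.2 pqr.2).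
  by exists (fun p q r => f (p, q, r)) => p q r; exact: hf (p, q, r).
pose E (l : 'I_4) (x : U) := (d1 j l i x + d1 i l j x - d1 i j l x) / 2.
have E0 l : E l 0 = chr1 a l i j.
  by rewrite /E /chr1; have [_ -> _] := hd1 j l i; have [_ -> _] := hd1 i l j;
    have [_ -> _] := hd1 i j l.
have hE l m : is_derive (0 : U) (delta_mx 0 m) (E l) (dchr1 a m l i j).
  have [_ _ e1] := hd1 j l i; have [_ _ e2] := hd1 i l j; have [_ _ e3] := hd1 i j l.
  have e4 := is_deriveB (is_deriveD (e1 m) (e2 m)) (e3 m).
  have := is_deriveMr e4 (is_derive_cst (2^-1 : R) (0 : U) (delta_mx 0 m)).
  by rewrite mulr0 add0r.
have hpart p q r : \forall x \near (0 : U), partial (fun x => A x p q) r x = d1 p q r x.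
  have [e _ _] := hd1 p q r; near=> x.
  have e' : is_derive x (delta_mx 0 r) (fun x => A x p q) (d1 p q r x) by near: x.
  by rewrite /partial; case: e'.
have near_sum : \forall x \near (0 : U),
    \sum_l invmx (A x) k l * E l x = christoffel A k i j x.
  have hall l : \forall x \near (0 : U), [/\ partial (fun x => A x j l) i x = d1 j l i x,
      partial (fun x => A x i l) j x = d1 i l j x & partial (fun x => A x i j) l x = d1 i j l x].
    by near=> x; split; near: x; exact: hpart.
  have {}hall := filter_forall (nbhs_filter (0 : U)) hall.
  near=> x; rewrite /christoffel mulr_suml; apply: eq_bigr => l _.
  have [-> -> ->] : [/\ partial (fun x => A x j l) i x = d1 j l i x,
      partial (fun x => A x i l) j x = d1 i l j x & partial (fun x => A x i j) l x = d1 i j l x].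
    by move: l; near: x.
  by rewrite /E mulrA.
split.
  rewrite -(nbhs_singleton near_sum); apply: eq_bigr => l _; by rewrite E0.
move=> m; apply: (near_eq_is_derive near_sum).
pose dA : 'M[R]_4 := \matrix_(p, q) jd (a p q) m.
have hdA p q : is_derive (0 : U) (delta_mx 0 m) (fun x => A x p q) (dA p q).
  by rewrite mxE; exact: has_jet_derive.
have hI := is_derive_invmx hdA uA.
have := is_derive_sumr (index_enum 'I_4) (fun l => is_deriveMr (hI k l) (hE l m)).
congr is_derive; apply: eq_bigr => l _.
by rewrite E0 mulNr.
Unshelve. all: by end_near. Qed.

Lemma riemann04_jet (A : U -> 'M[R]_4) a (i j k l : 'I_4) :
  (forall i j, has_jet (fun x => A x i j) (a i j)) -> A 0 \in unitmx ->
  (forall p q r, jd (a p q) r = jd (a q p) r) ->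
  riemann04 A i j k l 0 = riem_lin a i j k l + riem_quad (invmx (A 0)) a a i j k l.
Proof.
move=> hA uA sA; set B := invmx (A 0).
have G p q r : christoffel A p q r 0 = \sum_n B p n * chr1 a n q r.
  by have [] := christoffel_jet p q r hA uA.
pose c p q : 'cV[R]_4 := \col_n chr1 a n p q.
pose dc m p q : 'cV[R]_4 := \col_n dchr1 a m n p q.
pose D m : 'M[R]_4 := \matrix_(p, q) jd (a p q) m.
have GE p q r : christoffel A p q r 0 = (B *m c q r) p 0.
  by rewrite G mxE; apply: eq_bigr => n _; rewrite mxE.
have dG p q r m : partial (christoffel A p q r) m 0 = (B *m (dc m q r - D m *m B *m c q r)) p 0.
  have [_ /(_ m)[_ e]] := christoffel_jet p q r hA uA.
  rewrite /partial e mulmxBr !mulmxA !mxE -sumrB; apply: eq_bigr => n _.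
  by rewrite !mxE.
pose C m : 'M[R]_4 := \matrix_(p, q) chr1 a p m q.
have GC i1 j1 l1 m : \sum_q christoffel A m i1 q 0 * christoffel A q j1 l1 0 = (B *m (C i1 *m (B *m c j1 l1))) m 0.
  rewrite mulmxA [RHS]mxE; apply: eq_bigr => q _; rewrite !GE; congr (_ * _).
  by rewrite !mxE; apply: eq_bigr => n _; rewrite !mxE.
have r13 : forall p, riemann13 A p i j l 0 = (B *m (dc i j l - D i *m B *m c j l - (dc j i l - D j *m B *m c i l)
   + C i *m (B *m c j l) - C j *m (B *m c i l))) p 0.
  move=> p; rewrite /riemann13 !dG big_split /= GC sumrN GC.
  rewrite !(mulmxDr, mulmxN) ![in RHS]mxE ![in LHS]mxE; ring.
rewrite /riemann04; under eq_bigr do rewrite r13.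
have -> : forall X : 'cV[R]_4, \sum_p A 0 k p * (B *m X) p 0 = X k 0.
  move=> X.
  transitivity ((A 0 *m (B *m X)) k 0); first by rewrite [in RHS]mxE.
  by rewrite mulmxA mulmxV // mul1mx.
(* Metric compatibility: a derivative of the metric is the sum of the symbols of the first kind and
   their transpose. It merges the derivative of the inverse metric with the products of Christoffel
   symbols into a single quadratic term. *)
have DC m : D m - C m = (C m)^T.
  by apply/matrixP => p q; rewrite !mxE /chr1 (sA q p) (sA m p) (sA m q); field.
have -> : dc i j l - D i *m B *m c j l - (dc j i l - D j *m B *m c i l)
   + C i *m (B *m c j l) - C j *m (B *m c i l) = dc i j l - dc j i l + (C j)^T *m (B *m c i l) - (C i)^T *m (B *m c j l).
  rewrite -!DC !mulmxBl -!mulmxA; move: (D i *m _) (D j *m _) (C i *m _) (C j *m _) => u1 u2 u3 u4.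
  by apply/matrixP => p q; rewrite !mxE; ring.
rewrite /riem_lin /riem_quad !mxE -addrA; congr (_ + _).
rewrite -sumrB; apply: eq_bigr => m _; rewrite !mxE !mulr_sumr -sumrB.
apply: eq_bigr => n _; rewrite !mxE; ring.
Qed.

End RiemannJet.

(** * Existence of jets whose value is not computed *)

Section JetExistence.
Context {R : realType} {n : nat}.
Implicit Types (f g : 'rV[R]_n -> R).

(** Bare existence suffices for a function multiplied by [s ^+ 2]: its value at 0 alone enters the
    second derivative. In [riemann04_derive2] this spares the second derivative of an inverse
    matrix. *)
Definition twice_diff f := exists J, has_jet f J.

Lemma twice_diff_cst c : twice_diff (fun _ => c).
Proof. by exists (jcst c); exact: has_jet_cst. Qed.

Lemma twice_diff_add f g : twice_diff f -> twice_diff g -> twice_diff (fun x => f x + g x).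
Proof. by move=> [J hJ] [K hK]; exists (jadd J K); exact: has_jet_add. Qed.

Lemma twice_diff_mul f g : twice_diff f -> twice_diff g -> twice_diff (fun x => f x * g x).
Proof. by move=> [J hJ] [K hK]; exists (jmul J K); exact: has_jet_mul. Qed.

Lemma twice_diff_sum (I : Type) (r : seq I) (F : I -> 'rV[R]_n -> R) :
  (forall i, twice_diff (F i)) -> twice_diff (fun x => \sum_(i <- r) F i x).
Proof.
move=> h; elim: r => [|i r IH].
  by rewrite (_ : (fun x => _) = fun _ => 0) ?funeqE => [|x]; rewrite ?big_nil //; exact: twice_diff_cst.
rewrite (_ : (fun x => _) = fun x => F i x + \sum_(i <- r) F i x) ?funeqE => [|x]; rewrite ?big_cons //.
exact: twice_diff_add.
Qed.

Lemma twice_diff_prod (I : Type) (r : seq I) (F : I -> 'rV[R]_n -> R) :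
  (forall i, twice_diff (F i)) -> twice_diff (fun x => \prod_(i <- r) F i x).
Proof.
move=> h; elim: r => [|i r IH].
  by rewrite (_ : (fun x => _) = fun _ => 1) ?funeqE => [|x]; rewrite ?big_nil //; exact: twice_diff_cst.
rewrite (_ : (fun x => _) = fun x => F i x * \prod_(i <- r) F i x) ?funeqE => [|x]; rewrite ?big_cons //.
exact: twice_diff_mul.
Qed.

Lemma is_derive_inv (t : R) : t != 0 -> is_derive t (1 : R) (fun u => u^-1) (- t ^- 2).
Proof.
by move=> t0; have := is_deriveV t0 (is_derive_id t (1 : R)); rewrite [_ *: 1]mulr1.
Qed.

Lemma has_jet_inv f J : jv J != 0 -> has_jet f J ->
  has_jet (fun x => (f x)^-1) (jcomp (jv J)^-1 (- (jv J) ^- 2) (2 * (jv J) ^- 3) J).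
Proof.
move=> J0 hf; apply: (has_jet_comp (F := fun u => u^-1) (F' := fun u => - u ^- 2)) => //.
  near=> t; apply: is_derive_inv; near: t.
  by apply: open_nbhs_nbhs; split; [exact: open_neq | exact: J0].
set a := jv J in J0 *.
have h2 : is_derive a (1 : R) (fun u : R => u * u) (a * 1 + 1 * a).
  exact: is_deriveMr (is_derive_id _ _) (is_derive_id _ _).
have a2 : a * a != 0 by rewrite mulf_neq0.
have := is_deriveN (is_derive_comp_real (F := fun u => u^-1) (f := fun u : R => u * u) (x := a) (is_derive_inv a2) h2).
have -> : (- (fun y : R => (y * y)^-1)) = (fun u : R => - u ^- 2) by [].
by congr is_derive; field.
Unshelve. all: by end_near. Qed.

Lemma twice_diff_inv f : f 0 != 0 -> twice_diff f -> twice_diff (fun x => (f x)^-1).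
Proof.
move=> f0 [J hJ]; have [e _ _] := hJ; rewrite e in f0.
by exists (jcomp (jv J)^-1 (- (jv J) ^- 2) (2 * (jv J) ^- 3) J); exact: has_jet_inv.
Qed.

Lemma twice_diff_continuous f : twice_diff f -> {for 0, continuous f}.
Proof. by move=> [J []]. Qed.

Lemma twice_diff_det m (B : 'rV[R]_n -> 'M[R]_m) :
  (forall i j, twice_diff (fun x => B x i j)) -> twice_diff (fun x => \det (B x)).
Proof.
move=> h; apply: (@twice_diff_sum _ _ (fun (s : 'S_m) x => (-1) ^+ s * \prod_i B x i (s i))) => s.
apply: twice_diff_mul; first exact: twice_diff_cst.
exact: (@twice_diff_prod _ _ (fun i x => B x i (s i))).
Qed.

Lemma unitmx_near m (B : 'rV[R]_n -> 'M[R]_m) :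
  (forall i j, twice_diff (fun x => B x i j)) -> B 0 \in unitmx ->
  \forall x \near (0 : 'rV[R]_n), B x \in unitmx.
Proof.
move=> h B0; have c := twice_diff_continuous (twice_diff_det h).
have d0 : \det (B 0) != 0 by rewrite -unitfE -unitmxE.
near=> x; rewrite unitmxE unitfE; near: x.
by apply: (c [set z | z != 0]); apply: open_nbhs_nbhs; split=> //; exact: open_neq.
Unshelve. all: by end_near. Qed.

Lemma twice_diff_invmx m (B : 'rV[R]_n -> 'M[R]_m) i j :
  (forall i j, twice_diff (fun x => B x i j)) -> B 0 \in unitmx ->
  twice_diff (fun x => invmx (B x) i j).
Proof.
move=> h B0.
have [J hJ] : twice_diff (fun x => (\det (B x))^-1 * ((-1) ^+ (j + i) * \det (row' j (col' i (B x))))).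
  apply: twice_diff_mul.
    by apply: twice_diff_inv; [rewrite -unitfE -unitmxE | exact: twice_diff_det].
  apply: twice_diff_mul; first exact: twice_diff_cst.
  apply: twice_diff_det => k l.
  rewrite (_ : (fun x => _) = fun x => B x (lift j k) (lift i l)) //.
  by apply/funext => x; rewrite !mxE.
exists J; apply: has_jet_near hJ; near=> x.
have Bx : B x \in unitmx by near: x; exact: unitmx_near.
by rewrite /invmx Bx !mxE.
Unshelve. all: by end_near. Qed.

End JetExistence.

Section OneVariable.
Context {R : realType}.

(** Regarding a real function as a function on row vectors of length one makes the jet calculus
    available for the parameter [s] as well. *)
Lemma derive1n2_jet (f : R -> R) (J : @jet2 R 1) :
  has_jet (fun x : 'rV[R]_1 => f (x 0 0)) J -> derive1n 2 f 0 = jh J 0 0.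
Proof.
move=> [f0 fc /(_ 0)[df [df1 df2 df3]]].
pose e : 'rV[R]_1 := delta_mx 0 0.
have lineE (s h : R) : (h *: e + s *: e) 0 0 = h + s by rewrite !mxE /= !mulr1.
have ce : {for (0 : R), continuous (fun s : R => s *: e)}.
  by move=> ?; apply: cvgZr_tmp; exact: cvg_id.
have near1 : \forall s \near (0 : R), is_derive s (1 : R) f (df (s *: e)).
  near=> s.
  have : is_derive (s *: e) e (fun x : 'rV[R]_1 => f (x 0 0)) (df (s *: e)).
    near: s; apply: (ce (fun x => is_derive x e (fun x : 'rV[R]_1 => f (x 0 0)) (df x))).
    by rewrite scale0r.
  move=> /is_derive_line h; apply/is_derive_line; move: h; congr is_derive.
  by apply/funext => h; rewrite lineE [_ *: 1]mulr1.
rewrite derive1nS /= derive1E.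
have near2 : \forall s \near (0 : R), df (s *: e) = f^`()%classic s.
  by near=> s; rewrite derive1E; have [_ ->] : is_derive s (1 : R) f (df (s *: e)) by near: s.
have [_ <-] : is_derive (0 : R) (1 : R) (fun s => df (s *: e)) (jh J 0 0).
  have /is_derive_line := df3 0; congr is_derive.
  by apply/funext => h; rewrite addr0.
by symmetry; apply: near_eq_derive.
Unshelve. all: by end_near. Qed.

End OneVariable.

Notation o0 := (@Ordinal 4 0 isT).
Notation o1 := (@Ordinal 4 1 isT).
Notation o2 := (@Ordinal 4 2 isT).
Notation o3 := (@Ordinal 4 3 isT).

Lemma ord4P (P : 'I_4 -> Prop) : P o0 -> P o1 -> P o2 -> P o3 -> forall i, P i.
Proof.
move=> h0 h1 h2 h3 [[|[|[|[|//]]]] hi].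
- by rewrite (_ : Ordinal hi = o0) //; apply: val_inj.
- by rewrite (_ : Ordinal hi = o1) //; apply: val_inj.
- by rewrite (_ : Ordinal hi = o2) //; apply: val_inj.
- by rewrite (_ : Ordinal hi = o3) //; apply: val_inj.
Qed.

Lemma ord4_numE : [/\ (0 : 'I_4) = o0, (1 : 'I_4) = o1, (2 : 'I_4) = o2 & (3 : 'I_4) = o3].
Proof. by split; apply: val_inj. Qed.

Lemma sum4 (V : zmodType) (F : 'I_4 -> V) : \sum_i F i = F o0 + F o1 + F o2 + F o3.
Proof.
rewrite !big_ord_recl big_ord0 addr0 !addrA.
by congr (_ + _ + _ + _); congr F; apply: val_inj.
Qed.

(** * The curvature as a quartic polynomial in z *)

Section QuarticForm.
Context {R : realType}.
Local Notation U := 'rV[R]_4.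
Implicit Types (T : 'I_4 -> 'I_4 -> 'I_4 -> 'I_4 -> R) (z : U).

(** Contraction of one index with [m3z], whose frame components are (z^1, z^3, 1, 0); [slot4] does
    the same for [m4z], with components (z^4, z^2, 0, 1). *)
Definition slot3 (F : 'I_4 -> R) z := F o2 + z 0 o0 * F o0 + z 0 o2 * F o1.
Definition slot4 (F : 'I_4 -> R) z := F o3 + z 0 o3 * F o0 + z 0 o1 * F o1.

Definition quartic T z :=
  slot3 (fun i => slot4 (fun j => slot3 (fun k => slot4 (T i j k) z) z) z) z.

Definition jslot3 (J : 'I_4 -> @jet2 R 4) :=
  jadd (jadd (J o2) (jmul (jX o0) (J o0))) (jmul (jX o2) (J o1)).
Definition jslot4 (J : 'I_4 -> @jet2 R 4) :=
  jadd (jadd (J o3) (jmul (jX o3) (J o0))) (jmul (jX o1) (J o1)).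

Definition jquartic T := jslot3 (fun i => jslot4 (fun j => jslot3 (fun k =>
  jslot4 (fun l => jcst (T i j k l))))).

Lemma has_jet_slot3 (F : 'I_4 -> U -> R) J : (forall i, has_jet (F i) (J i)) ->
  has_jet (fun z => slot3 (fun i => F i z) z) (jslot3 J).
Proof.
move=> h; apply: has_jet_add; first apply: has_jet_add; first exact: h.
  by apply: has_jet_mul => //; exact: has_jet_coord.
by apply: has_jet_mul => //; exact: has_jet_coord.
Qed.

Lemma has_jet_slot4 (F : 'I_4 -> U -> R) J : (forall i, has_jet (F i) (J i)) ->
  has_jet (fun z => slot4 (fun i => F i z) z) (jslot4 J).
Proof.
move=> h; apply: has_jet_add; first apply: has_jet_add; first exact: h.
  by apply: has_jet_mul => //; exact: has_jet_coord.
by apply: has_jet_mul => //; exact: has_jet_coord.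
Qed.

Lemma has_jet_quartic T : has_jet (quartic T) (jquartic T).
Proof.
apply: has_jet_slot3 => i; apply: has_jet_slot4 => j; apply: has_jet_slot3 => k.
by apply: has_jet_slot4 => l; exact: has_jet_cst.
Qed.

Definition quartic_grad T : 'I_4 -> R := fun a => nth 0
  [:: T o0 o3 o2 o3 + T o2 o3 o0 o3; T o2 o1 o2 o3 + T o2 o3 o2 o1;
      T o1 o3 o2 o3 + T o2 o3 o1 o3; T o2 o0 o2 o3 + T o2 o3 o2 o0] a.

Lemma jd_quartic T a : jd (jquartic T) a = quartic_grad T a.
Proof. by move: a; apply: ord4P; rewrite /= /quartic_grad /=; ring. Qed.

Definition quartic_hess T : 'I_4 -> 'I_4 -> R := fun a b => nth 0 (nth [::]
  [:: [:: T o0 o3 o0 o3 *+ 2;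
          T o0 o1 o2 o3 + T o0 o3 o2 o1 + T o2 o1 o0 o3 + T o2 o3 o0 o1;
          T o0 o3 o1 o3 + T o1 o3 o0 o3;
          T o0 o0 o2 o3 + T o0 o3 o2 o0 + T o2 o0 o0 o3 + T o2 o3 o0 o0];
      [:: T o0 o1 o2 o3 + T o0 o3 o2 o1 + T o2 o1 o0 o3 + T o2 o3 o0 o1;
          T o2 o1 o2 o1 *+ 2;
          T o1 o1 o2 o3 + T o1 o3 o2 o1 + T o2 o1 o1 o3 + T o2 o3 o1 o1;
          T o2 o1 o2 o0 + T o2 o0 o2 o1];
      [:: T o0 o3 o1 o3 + T o1 o3 o0 o3;
          T o1 o1 o2 o3 + T o1 o3 o2 o1 + T o2 o1 o1 o3 + T o2 o3 o1 o1;
          T o1 o3 o1 o3 *+ 2;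
          T o1 o0 o2 o3 + T o1 o3 o2 o0 + T o2 o0 o1 o3 + T o2 o3 o1 o0];
      [:: T o0 o0 o2 o3 + T o0 o3 o2 o0 + T o2 o0 o0 o3 + T o2 o3 o0 o0;
          T o2 o1 o2 o0 + T o2 o0 o2 o1;
          T o1 o0 o2 o3 + T o1 o3 o2 o0 + T o2 o0 o1 o3 + T o2 o3 o1 o0;
          T o2 o0 o2 o0 *+ 2]] a) b.

Lemma jh_quartic T a b : jh (jquartic T) a b = quartic_hess T a b.
Proof.
by move: a b; apply: ord4P; apply: ord4P; rewrite /= /quartic_hess /=; ring.
Qed.

Lemma quartic0 T : quartic T 0 = T o2 o3 o2 o3.
Proof. by rewrite /quartic /slot3 /slot4 !mxE; ring. Qed.

Lemma partial_jet (f : U -> R) J a : has_jet f J -> partial f a 0 = jd J a.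
Proof. by move=> /has_jet_derive /(_ a)[_ e]. Qed.

Lemma partial2_jet (f : U -> R) J a b : has_jet f J -> partial (partial f a) b 0 = jh J a b.
Proof.
move=> [_ _ /(_ a)[df [df1 df2 /(_ b) df3]]].
have e : \forall x \near (0 : U), df x = partial f a x.
  near=> x; have [_ <-] : is_derive x (delta_mx 0 a) f (df x) by near: x.
  by [].
by have [_ <-] := df3; rewrite /partial; symmetry; apply: near_eq_derive.
Unshelve. all: by end_near. Qed.

End QuarticForm.

Section CurvaturePolynomial.
Context {R : realType}.
Implicit Types (y : R3xR3 R) (z : 'rV[R]_4).

Lemma dot2Dl (X X' Y : R3xR3 R) : dot2 (X + X') Y = dot2 X Y + dot2 X' Y.
Proof. by rewrite /dot2 /= !dotDl; ring. Qed.

Lemma dot2Zl a (X Y : R3xR3 R) : dot2 (a *: X) Y = a * dot2 X Y.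
Proof. by rewrite /dot2 /= !dotZl; ring. Qed.

Lemma coefD y i X X' : coef y i (X + X') = coef y i X + coef y i X' :> R.
Proof. by rewrite /coef dot2Dl mulrDl. Qed.

Lemma coefZ y i a X : coef y i (a *: X) = a * coef y i X :> R.
Proof. by rewrite /coef dot2Zl mulrA. Qed.

Lemma sum_coef_m3z y z (F : 'I_4 -> R) : M_nondeg y ->
  \sum_i coef y i (m3z y z) * F i = slot3 F z.
Proof.
move=> hy; have [e0 e1 e2 e3] := ord4_numE.
have -> : m3z y z = frame y o2 + z 0 o0 *: frame y o0 + z 0 o2 *: frame y o1.
  by rewrite -e0 -e2.
rewrite sum4 !coefD ![coef _ _ (z 0 _ *: _)]coefZ !coef_frame // /slot3 /=; ring.
Qed.

Lemma sum_coef_m4z y z (F : 'I_4 -> R) : M_nondeg y ->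
  \sum_i coef y i (m4z y z) * F i = slot4 F z.
Proof.
move=> hy; have [e0 e1 e2 e3] := ord4_numE.
have -> : m4z y z = frame y o3 + z 0 o3 *: frame y o0 + z 0 o1 *: frame y o1.
  by rewrite -e1 -e3.
rewrite sum4 !coefD ![coef _ _ (z 0 _ *: _)]coefZ !coef_frame // /slot4 /=; ring.
Qed.

Lemma v_quartic lc ld y z s : M_nondeg y ->
  v lc ld y z s = quartic (fun i j k l =>
    riemann04 (pullback (chart y) (g_ lc ld s)) i j k l 0) z :> R.
Proof.
move=> hy; rewrite /v /curvature /quartic.
rewrite -(sum_coef_m3z z _ hy); apply: eq_bigr => i _.
rewrite -(sum_coef_m4z z _ hy) mulr_sumr; apply: eq_bigr => j _.
rewrite -(sum_coef_m3z z _ hy) !mulr_sumr; apply: eq_bigr => k _.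
rewrite -(sum_coef_m4z z _ hy) !mulr_sumr; apply: eq_bigr => l _.
by rewrite !mulrA.
Qed.

End CurvaturePolynomial.

(** * Expansion in s of the curvature of a quadratic pencil of metrics *)

Section CurvatureExpansion.
Context {R : realType}.
Local Notation U := 'rV[R]_4.
Local Notation JM := ('I_4 -> 'I_4 -> @jet2 R 4).
Implicit Types (a : JM) (N : 'I_4 -> R).

Definition jval a : 'M[R]_4 := \matrix_(i, j) jv (a i j).

Definition riem_diag N a a' (i j k l : 'I_4) : R :=
  \sum_m (N m)^-1 * (chr1 a m j k * chr1 a' m i l - chr1 a m i k * chr1 a' m j l).

Definition diag_inv N : 'M[R]_4 := diag_mx (\row_i (N i)^-1).

Lemma riem_quad_diag N a a' i j k l :
  riem_quad (diag_inv N) a a' i j k l = riem_diag N a a' i j k l.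
Proof.
apply: eq_bigr => m _; rewrite (bigD1 m) //= big1 => [|n /negPf nm].
  by rewrite !mxE eqxx addr0.
by rewrite !mxE eq_sym nm mul0r.
Qed.

Lemma diag_invP N : (forall i, N i != 0) ->
  diag_mx (\row_i N i) \in unitmx /\ invmx (diag_mx (\row_i N i)) = diag_inv N.
Proof.
move=> N0.
have e : diag_mx (\row_i N i) *m diag_inv N = 1%:M.
  apply/matrixP => i j; rewrite mul_diag_mx !mxE.
  by case: eqP => [->|_]; rewrite ?mulr0 // divff.
have [u _] := mulmx1_unit e; split=> //.
by rewrite -[LHS]mulmx1 -e mulmxA mulVmx // mul1mx.
Qed.

Definition jpencil (a0 a1 a2 : JM) (s : R) : JM := fun i j =>
  jadd (jadd (a0 i j) (jmul (jcst s) (a1 i j))) (jmul (jcst (s ^+ 2)) (a2 i j)).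

Lemma chr1_pencil a0 a1 a2 s m i j : chr1 (jpencil a0 a1 a2 s) m i j =
  chr1 a0 m i j + s * chr1 a1 m i j + s ^+ 2 * chr1 a2 m i j.
Proof. by rewrite /chr1 /=; ring. Qed.

Lemma riem_lin_pencil a0 a1 a2 s i j k l : riem_lin (jpencil a0 a1 a2 s) i j k l =
  riem_lin a0 i j k l + s * riem_lin a1 i j k l + s ^+ 2 * riem_lin a2 i j k l.
Proof. by rewrite /riem_lin /dchr1 /=; ring. Qed.

Lemma jval_pencil a0 a1 a2 s :
  jval (jpencil a0 a1 a2 s) = jval a0 + s *: jval a1 + s ^+ 2 *: jval a2.
Proof. by apply/matrixP => i j; rewrite !mxE. Qed.

(** The first variation of the curvature at [a0] in the direction [a1]; the last term is the
    variation of the inverse metric. *)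
Definition riem1 N a0 a1 i j k l : R :=
  riem_lin a1 i j k l + riem_diag N a1 a0 i j k l + riem_diag N a0 a1 i j k l
  - riem_quad (diag_inv N *m jval a1 *m diag_inv N) a0 a0 i j k l.

Context (A : R -> U -> 'M[R]_4) (a0 a1 a2 : JM) (N : 'I_4 -> R)
  (hA : forall s i j, has_jet (fun x => A s x i j) (jpencil a0 a1 a2 s i j))
  (hN : jval a0 = diag_mx (\row_i N i))
  (N0 : forall i, N i != 0)
  (sym : forall p q r, [/\ jd (a0 p q) r = jd (a0 q p) r,
    jd (a1 p q) r = jd (a1 q p) r & jd (a2 p q) r = jd (a2 q p) r]).

Let M s : 'M[R]_4 := jval a0 + s *: jval a1 + s ^+ 2 *: jval a2.

Lemma pencil_value s : A s 0 = M s.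
Proof.
by rewrite /M -jval_pencil; apply/matrixP => i j; rewrite mxE; have [-> _ _] := hA s i j.
Qed.

Let rr s i j k l := riemann04 (A s) i j k l 0.
Let rs s i j k l := riem_lin a0 i j k l + s * riem_lin a1 i j k l
  + s ^+ 2 * riem_lin a2 i j k l
  + riem_quad (invmx (M s)) (jpencil a0 a1 a2 s) (jpencil a0 a1 a2 s) i j k l.

Lemma riemann04_pencil s i j k l : M s \in unitmx -> rr s i j k l = rs s i j k l.
Proof.
move=> u; rewrite /rr (riemann04_jet _ _ _ _ (hA s)) ?pencil_value //.
  by rewrite riem_lin_pencil.
by move=> p q r; have [e0 e1 e2] := sym p q r; rewrite /jpencil /= !mul0r e0 e1 e2.
Qed.

Lemma pencil0 : M 0 = diag_mx (\row_i N i).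
Proof. by rewrite /M scale0r expr0n scale0r !addr0. Qed.

Lemma pencil0_unit : M 0 \in unitmx.
Proof. by rewrite pencil0; have [] := diag_invP N0. Qed.

Lemma invmx_pencil0 : invmx (M 0) = diag_inv N.
Proof. by rewrite pencil0; have [] := diag_invP N0. Qed.

Lemma pencil_entry i j s :
  is_derive s (1 : R) (fun s => M s i j) (jval a1 i j + 2 * s * jval a2 i j).
Proof.
have e : (fun s => M s i j) = (fun s => jval a0 i j + s * jval a1 i j + (s * s) * jval a2 i j).
  by apply/funext => u; rewrite /M 5!mxE expr2 [in X in _ + X]mxE.
rewrite e.
have c x := is_derive_cst (x : R) s (1 : R).
have i1 := is_derive_id s (1 : R).
apply: (is_derive_eq (is_deriveDr (is_deriveDr (c (jval a0 i j)) (is_deriveMr i1 (c (jval a1 i j))))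
  (is_deriveMr (is_deriveMr i1 i1) (c (jval a2 i j))))).
rewrite /cst /=; ring.
Qed.

Lemma pencil_unit_near : \forall s \near (0 : R), M s \in unitmx.
Proof.
have [|//] := @derivable_invmx _ _ M 0 _ pencil0_unit.
by move=> i j; have [] := pencil_entry i j 0.
Qed.

Lemma riemann04_at0 i j k l : rr 0 i j k l = riem_lin a0 i j k l + riem_diag N a0 a0 i j k l.
Proof.
rewrite riemann04_pencil ?pencil0_unit // /rs invmx_pencil0 riem_quad_diag expr0n !mul0r !addr0.
congr (_ + _); apply: eq_bigr => m _; rewrite !chr1_pencil; ring.
Qed.

Lemma riemann04_derive1 i j k l :
  is_derive (0 : R) (1 : R) (fun s => rr s i j k l) (riem1 N a0 a1 i j k l).
Proof.
have e : \forall s \near (0 : R), rs s i j k l = rr s i j k l.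
  by near=> s; rewrite riemann04_pencil //; near: s; exact: pencil_unit_near.
apply: (near_eq_is_derive e).
have c x := is_derive_cst (x : R) (0 : R) (1 : R).
have i1 := is_derive_id (0 : R) (1 : R).
have poly (p q r : R) : is_derive (0 : R) (1 : R) (fun s => p + s * q + s ^+ 2 * r) q.
  apply: (is_derive_eq (is_deriveDr (is_deriveDr (c p) (is_deriveMr i1 (c q)))
    (is_deriveMr (is_deriveMr i1 i1) (c r)))).
  rewrite /cst /=; ring.
have hM p q : is_derive (0 : R) (1 : R) (fun s => M s p q) (jval a1 p q).
  by apply: (is_derive_eq (pencil_entry p q 0)); rewrite mulr0 mul0r addr0.
have dI m n := is_derive_invmx hM pencil0_unit m n.
have hc m p q : is_derive (0 : R) (1 : R) (fun s => chr1 (jpencil a0 a1 a2 s) m p q) (chr1 a1 m p q).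
  by apply: (is_derive_eq _ (erefl _)); rewrite (_ : (fun s => _) = fun s =>
    chr1 a0 m p q + s * chr1 a1 m p q + s ^+ 2 * chr1 a2 m p q) ?funeqE // => s; exact: chr1_pencil.
have c00 m p q : chr1 (jpencil a0 a1 a2 0) m p q = chr1 a0 m p q.
  by rewrite chr1_pencil expr0n !mul0r !addr0.
have hq := is_derive_sumr (index_enum 'I_4) (fun m => is_derive_sumr (index_enum 'I_4)
  (fun n => is_deriveMr (dI m n) (is_deriveDr (is_deriveMr (hc m j k) (hc n i l))
     (is_deriveNr (is_deriveMr (hc m i k) (hc n j l)))))).
apply: (is_derive_eq (is_deriveDr (poly (riem_lin a0 i j k l) (riem_lin a1 i j k l)
   (riem_lin a2 i j k l)) hq)).
rewrite /riem1 -!riem_quad_diag; move: (riem_lin a1 i j k l) => L; rewrite -!addrA; congr (L + _).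
rewrite /riem_quad -sumrB -!big_split /=; apply: eq_bigr => m _.
rewrite -sumrB -!big_split /=; apply: eq_bigr => n _.
rewrite !c00 invmx_pencil0; ring.
Unshelve. all: by end_near. Qed.

(** The hypothesis makes the relevant symbols of the pencil divisible by [s], with quotient [D]. The
    quadratic part is therefore [s ^+ 2] times a function of which only the value at 0 counts, and
    there the inverse metric is the one of [a0]. *)
Lemma riemann04_derive2 i j k l : (forall m, [/\ chr1 a0 m j k = 0, chr1 a0 m i l = 0,
    chr1 a0 m i k = 0 & chr1 a0 m j l = 0]) ->
  derive1n 2 (fun s => rr s i j k l) 0 =
    2 * (riem_lin a2 i j k l + riem_diag N a1 a1 i j k l).
Proof.
move=> h0.
pose D s m p q := chr1 a1 m p q + s * chr1 a2 m p q.
pose Q s := riem_lin a2 i j k l + \sum_m \sum_n invmx (M s) m n *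
  (D s m j k * D s n i l - D s m i k * D s n j l).
pose s1 (x : 'rV[R]_1) := x 0 0.
have tc c : twice_diff (fun _ : 'rV[R]_1 => c : R) by exact: twice_diff_cst.
have t1 : twice_diff s1 by exists (jX 0); exact: has_jet_coord.
have tM p q : twice_diff (fun x => M (s1 x) p q).
  have := twice_diff_add (twice_diff_add (tc (jval a0 p q)) (twice_diff_mul t1 (tc (jval a1 p q))))
    (twice_diff_mul (twice_diff_mul t1 t1) (tc (jval a2 p q))).
  by congr twice_diff; apply/funext => x; rewrite /M !mxE expr2.
have M0 : M (s1 0) \in unitmx by rewrite /s1 mxE; exact: pencil0_unit.
have tD m p q : twice_diff (fun x => D (s1 x) m p q).
  exact: (twice_diff_add (tc _) (twice_diff_mul t1 (tc _))).
have [J hJ] : twice_diff (fun x => Q (s1 x)).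
  apply: twice_diff_add; first exact: tc.
  apply: (@twice_diff_sum _ _ _ _ (fun m x => \sum_n invmx (M (s1 x)) m n *
    (D (s1 x) m j k * D (s1 x) n i l - D (s1 x) m i k * D (s1 x) n j l))) => m.
  apply: (@twice_diff_sum _ _ _ _ (fun n x => invmx (M (s1 x)) m n *
    (D (s1 x) m j k * D (s1 x) n i l - D (s1 x) m i k * D (s1 x) n j l))) => n.
  apply: twice_diff_mul; first exact: (@twice_diff_invmx _ _ _ (fun x => M (s1 x))).
  have := twice_diff_add (twice_diff_mul (tD m j k) (tD n i l))
    (twice_diff_mul (tc (-1)) (twice_diff_mul (tD m i k) (tD n j l))).
  by congr twice_diff; apply/funext => x; rewrite mulN1r.
have JQ : jv J = Q 0 by have [<- _ _] := hJ; rewrite /s1 mxE.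
have hX := has_jet_coord (R := R) (0 : 'I_1).
have hF := has_jet_add (has_jet_add (@has_jet_cst R 1 (riem_lin a0 i j k l))
  (has_jet_mul hX (@has_jet_cst R 1 (riem_lin a1 i j k l)))) (has_jet_mul (has_jet_mul hX hX) hJ).
have nr : \forall x \near (0 : 'rV[R]_1), riem_lin a0 i j k l + s1 x * riem_lin a1 i j k l
    + s1 x * s1 x * Q (s1 x) = rr (s1 x) i j k l.
  near=> x; rewrite riemann04_pencil; last first.
    by near: x; exact: (unitmx_near tM M0).
  rewrite /rs /Q expr2.
  move: (riem_lin a0 _ _ _ _) (riem_lin a1 _ _ _ _) (riem_lin a2 _ _ _ _) => L0 L1 L2.
  rewrite mulrDr -!addrA; congr (L0 + (_ + (_ + _))).
  rewrite /riem_quad mulr_sumr; apply: eq_bigr => m _.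
  rewrite mulr_sumr; apply: eq_bigr => n _.
  have [e1 _ e2 _] := h0 m; have [_ e3 _ e4] := h0 n.
  by rewrite !chr1_pencil e1 e2 e3 e4 /D; ring.
rewrite (derive1n2_jet (has_jet_near nr hF)) /= JQ.
have -> : Q 0 = riem_lin a2 i j k l + riem_diag N a1 a1 i j k l.
  rewrite /Q -riem_quad_diag invmx_pencil0; congr (_ + _).
  apply: eq_bigr => m _; apply: eq_bigr => n _; rewrite /D; ring.
ring.
Unshelve. all: by end_near. Qed.

End CurvatureExpansion.

(** * V^(2) in terms of the jets of g, h^(1) and h^(2) *)

Section V2Jets.
Context {R : realType}.
Local Notation U := 'rV[R]_4.
Local Notation JM := ('I_4 -> 'I_4 -> @jet2 R 4).

Lemma is_derive_slot3 (F : 'I_4 -> R -> R) dF (z : U) t : (forall i, is_derive t (1 : R) (F i) (dF i)) ->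
  is_derive t (1 : R) (fun s => slot3 (fun i => F i s) z) (slot3 dF z).
Proof.
move=> h; have c k := is_derive_cst (z 0 k) t (1 : R).
apply: (is_derive_eq (is_deriveDr (is_deriveDr (h o2) (is_deriveMr (c o0) (h o0)))
  (is_deriveMr (c o2) (h o1)))).
by rewrite /slot3 /cst /= !mul0r !addr0.
Qed.

Lemma is_derive_slot4 (F : 'I_4 -> R -> R) dF (z : U) t : (forall i, is_derive t (1 : R) (F i) (dF i)) ->
  is_derive t (1 : R) (fun s => slot4 (fun i => F i s) z) (slot4 dF z).
Proof.
move=> h; have c k := is_derive_cst (z 0 k) t (1 : R).
apply: (is_derive_eq (is_deriveDr (is_deriveDr (h o3) (is_deriveMr (c o3) (h o0)))
  (is_deriveMr (c o1) (h o1)))).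
by rewrite /slot4 /cst /= !mul0r !addr0.
Qed.

Lemma is_derive_quartic (T : R -> 'I_4 -> 'I_4 -> 'I_4 -> 'I_4 -> R) dT (z : U) t :
  (forall i j k l, is_derive t (1 : R) (fun s => T s i j k l) (dT i j k l)) ->
  is_derive t (1 : R) (fun s => quartic (T s) z) (quartic dT z).
Proof.
move=> h.
have h4 i j k := is_derive_slot4 z (h i j k).
have h3 i j := is_derive_slot3 z (h4 i j).
have h2 i := is_derive_slot4 z (h3 i).
exact: (is_derive_slot3 z h2).
Qed.

(** The vector [zb] is given by the linear system that it solves, so an explicit candidate can be
    verified row by row; invertibility of the Hessian identifies it with [zbar]. *)
Lemma V2_jets lc ld (y : R3xR3 R) (a0 a1 a2 : JM) (N zb : 'I_4 -> R) :
  M_nondeg y ->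
  (forall i j, has_jet (fun x => pullback (chart y) g x i j) (a0 i j)) ->
  (forall i j, has_jet (fun x => pullback (chart y) (h1 lc ld) x i j) (a1 i j)) ->
  (forall i j, has_jet (fun x => pullback (chart y) (h2 lc ld) x i j) (a2 i j)) ->
  jval a0 = diag_mx (\row_i N i) -> (forall i, N i != 0) ->
  (forall p q r, [/\ jd (a0 p q) r = jd (a0 q p) r,
    jd (a1 p q) r = jd (a1 q p) r & jd (a2 p q) r = jd (a2 q p) r]) ->
  (forall m, [/\ chr1 a0 m o3 o2 = 0, chr1 a0 m o2 o3 = 0,
    chr1 a0 m o2 o2 = 0 & chr1 a0 m o3 o3 = 0]) ->
  let H := quartic_hess (fun i j k l => riem_lin a0 i j k l + riem_diag N a0 a0 i j k l) in
  let dv := quartic_grad (riem1 N a0 a1) in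
  (\matrix_(a, b) H a b : 'M[R]_4) \in unitmx ->
  (forall a, \sum_b H a b * zb b = - dv a) ->
  V2 lc ld y = riem_lin a2 o2 o3 o2 o3 + riem_diag N a1 a1 o2 o3 o2 o3
    + (\sum_a dv a * zb a) / 2.
Proof.
move=> hy j0 j1 j2 hN N0 hs c0 H dv uH Hzb.
pose A s := pullback (chart y) (g_ lc ld s).
have hA s i j : has_jet (fun x => A s x i j) (jpencil a0 a1 a2 s i j).
  have := has_jet_add (has_jet_add (j0 i j) (has_jet_mul (has_jet_cst s) (j1 i j)))
    (has_jet_mul (has_jet_cst (s ^+ 2)) (j2 i j)).
  by apply: has_jet_ext => x; rewrite /A !mxE.
have v0E : vcoef 0 lc ld y = quartic (fun i j k l => riem_lin a0 i j k l + riem_diag N a0 a0 i j k l).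
  apply/funext => z; rewrite /vcoef /= divr1 v_quartic //; congr quartic.
  apply/funext => i; apply/funext => j; apply/funext => k; apply/funext => l.
  exact: (riemann04_at0 hA hN N0 hs).
have v1E : vcoef 1 lc ld y = quartic (riem1 N a0 a1).
  apply/funext => z; rewrite /vcoef divr1 derive1nS /= derive1E.
  have -> : v lc ld y z = fun s => quartic (fun i j k l => riemann04 (A s) i j k l 0) z.
    by apply/funext => s; rewrite v_quartic.
  have [_ //] := is_derive_quartic z (riemann04_derive1 hA hN N0 hs).
have v2E : vcoef 2 lc ld y 0 = riem_lin a2 o2 o3 o2 o3 + riem_diag N a1 a1 o2 o3 o2 o3.
  have e : v lc ld y 0 = fun s => riemann04 (A s) o2 o3 o2 o3 0.
    by apply/funext => s; rewrite v_quartic // quartic0.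
  rewrite /vcoef e (riemann04_derive2 hA hN N0 hs) => [|m]; last by have [] := c0 m.
  by rewrite mulrC mulKf // pnatr_eq0.
have HE : v0_hess lc ld y = \matrix_(a, b) H a b.
  apply/matrixP => a b; rewrite !mxE v0E.
  by rewrite (partial2_jet _ _ (has_jet_quartic _)) jh_quartic.
have dvE a : v1_grad lc ld y a 0 = dv a.
  by rewrite !mxE v1E (partial_jet _ (has_jet_quartic _)) jd_quartic.
have zE a : zbar lc ld y a 0 = zb a.
  rewrite /zbar HE; set HM : 'M[R]_4 := \matrix_(a, b) H a b.
  have -> : - v1_grad lc ld y = HM *m \col_b zb b.
    apply/colP => b; rewrite mxE dvE -Hzb mxE; apply: eq_bigr => k _.
    by rewrite !mxE.
  by rewrite mulmxA mulVmx // mul1mx mxE.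
rewrite /V2 v2E; congr (_ + _ / 2); apply: eq_bigr => a _.
by rewrite dvE zE.
Qed.

End V2Jets.

(** * The moving frame and the chart *)

Section NondegPoint.
Context {R : realType}.
Implicit Types (p X Y : R3xR3 R) (u w : 'rV[R]_3).

Lemma crossDl u u' w : cross (u + u') w = cross u w + cross u' w.
Proof. by apply/rowP => i; rewrite !mxE; ring. Qed.
Lemma crossZl (a : R) u w : cross (a *: u) w = a *: cross u w.
Proof. by apply/rowP => i; rewrite !mxE; ring. Qed.
Lemma crossC u w : cross u w = - cross w u.
Proof. by apply/rowP => i; rewrite !mxE; ring. Qed.
Lemma crossDr u w w' : cross u (w + w') = cross u w + cross u w'.
Proof. by apply/rowP => i; rewrite !mxE; ring. Qed.
Lemma crossZr (a : R) u w : cross u (a *: w) = a *: cross u w.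
Proof. by apply/rowP => i; rewrite !mxE; ring. Qed.
Lemma crossuu u : cross u u = 0.
Proof. by apply/rowP => i; rewrite !mxE; ring. Qed.

Lemma sqrt_eq (a b : R) : 0 <= b -> a = b ^+ 2 -> Num.sqrt a = b.
Proof. by move=> b0 ->; rewrite sqrtr_sqr ger0_norm. Qed.

(** The frame [q1], [q2], [q3] is orthonormal and right-handed, and the two points lie in the plane
    of [q1], [q2] at the angles -theta and theta from [q1]. The later geometry is computed from
    these relations. *)
Record nondeg_spec p (C S : R) : Prop := NondegSpec {
  nd_C : C = cos (theta p);
  nd_S : S = sin (theta p);
  nd_C0 : 0 < C;
  nd_S0 : 0 < S;
  nd_CS : S ^+ 2 = 1 - C ^+ 2;
  nd_p1 : p.1 = C *: q1 p - S *: q2 p;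
  nd_p2 : p.2 = C *: q1 p + S *: q2 p;
  nd_11 : dot (q1 p) (q1 p) = 1;
  nd_22 : dot (q2 p) (q2 p) = 1;
  nd_33 : dot (q3 p) (q3 p) = 1;
  nd_12 : dot (q1 p) (q2 p) = 0;
  nd_13 : dot (q1 p) (q3 p) = 0;
  nd_23 : dot (q2 p) (q3 p) = 0;
  nd_c12 : cross (q1 p) (q2 p) = q3 p;
  nd_c23 : cross (q2 p) (q3 p) = q1 p;
  nd_c31 : cross (q3 p) (q1 p) = q2 p }.

Lemma cross_cross u w z : cross (cross u w) z = dot u z *: w - dot w z *: u.
Proof.
rewrite !dotE; have [e0 e1 e2] := crossE u w; have [f0 f1 f2] := crossE (cross u w) z.
have ord3 (i : 'I_3) : i = 0 \/ i = 1 \/ i = 2.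
  by case: i => [[|[|[|//]]] hi]; [left|right; left|right; right]; apply: val_inj.
by apply/rowP => i; case: (ord3 i) => [|[]] ->; rewrite ?(f0, f1, f2) ?(e0, e1, e2) !mxE; ring.
Qed.

Lemma theta_range p : M_nondeg p -> 0 < theta p < pi / 2.
Proof.
move=> /nondeg_dot[_ _ /andP[c1 c2]]; rewrite /theta.
have h : -1 <= dot p.1 p.2 <= 1 by rewrite !ltW.
apply/andP; split; first by rewrite divr_gt0 // acos_gt0 // c2 (ltW c1).
by rewrite ltr_pM2r ?invr_gt0 // acos_ltpi // c1 (ltW c2).
Qed.

Lemma nondegP p : M_nondeg p -> nondeg_spec p (cos (theta p)) (sin (theta p)).
Proof.
move=> hp; have [d1 d2 /andP[c1 c2]] := nondeg_dot hp.
have /andP[t0 t1] := theta_range hp.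
have S0 : 0 < sin (theta p).
  by apply: sin_gt0_pi; rewrite t0 (lt_trans t1) // ltr_pdivrMr // mulr_natr mulr2n ltrDl pi_gt0.
have C0 : 0 < cos (theta p).
  by apply: cos_gt0_pihalf; rewrite t1 (lt_trans _ t0) // oppr_lt0 divr_gt0 // pi_gt0.
have [es ec] := theta_sqr hp.
set C := cos (theta p) in C0 ec *; set S := sin (theta p) in S0 es *.
have e1 : enorm (p.1 + p.2) = 2 * C.
  apply: sqrt_eq; first by rewrite mulr_ge0 // ltW.
  by rewrite exprMn ec !(dotDl, dotDr) d1 d2 (dotC p.2); field.
have e2 : enorm (p.2 - p.1) = 2 * S.
  apply: sqrt_eq; first by rewrite mulr_ge0 // ltW.
  by rewrite exprMn es !(dotDl, dotDr, dotNl, dotNr) d1 d2 (dotC p.2); field.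
have e3 : enorm (cross p.1 p.2) = 2 * S * C.
  apply: sqrt_eq; first by rewrite !mulr_ge0 // ltW.
  by rewrite !exprMn es ec dot_cross d1 d2 (dotC p.2); field.
have C1 : C != 0 by rewrite gt_eqF.
have S1 : S != 0 by rewrite gt_eqF.
have Q1 : q1 p = (2 * C)^-1 *: (p.1 + p.2) by rewrite /q1 /normalize e1.
have Q2 : q2 p = (2 * S)^-1 *: (p.2 - p.1) by rewrite /q2 /normalize e2.
have Q3 : q3 p = (2 * S * C)^-1 *: cross p.1 p.2 by rewrite /q3 /normalize e3.
have P1 : p.1 = C *: q1 p - S *: q2 p.
  by rewrite Q1 Q2; apply/rowP => i; rewrite !mxE; field; rewrite C1 S1.
have P2 : p.2 = C *: q1 p + S *: q2 p.
  by rewrite Q1 Q2; apply/rowP => i; rewrite !mxE; field; rewrite C1 S1.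
have D : dot p.1 p.2 = 2 * C ^+ 2 - 1 by rewrite ec; field.
have CS : S ^+ 2 = 1 - C ^+ 2 by rewrite es ec; field.
have D11 : dot (q1 p) (q1 p) = 1.
  by rewrite Q1 !dotZl !dotZr !(dotDl, dotDr) d1 d2 (dotC p.2) D; field.
have D22 : dot (q2 p) (q2 p) = 1.
  rewrite Q2 !dotZl !dotZr !(dotDl, dotDr, dotNl, dotNr) d1 d2 (dotC p.2) D.
  by field: CS.
have D12 : dot (q1 p) (q2 p) = 0.
  by rewrite Q1 Q2 !dotZl !dotZr !(dotDl, dotDr, dotNl, dotNr) d1 d2 (dotC p.2); ring.
have c12 : cross (q1 p) (q2 p) = q3 p.
  rewrite Q1 Q2 Q3 crossZl crossZr crossDl !crossDr; apply/rowP => i; rewrite !mxE.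
  by field; rewrite C1 S1.
have D13 : dot (q1 p) (q3 p) = 0 by rewrite -c12 dotC dot_crossl.
have D23 : dot (q2 p) (q3 p) = 0 by rewrite -c12 dotC dot_crossr.
split=> //.
- by rewrite -c12 dot_cross D11 D22 (dotC (q2 p)) D12; ring.
- by rewrite crossC -{1}c12 cross_cross D22 D12 -scaleNr; apply/rowP => i; rewrite !mxE; ring.
- by rewrite -{1}c12 cross_cross D11 (dotC (q2 p)) D12; apply/rowP => i; rewrite !mxE; ring.
Qed.

End NondegPoint.

Section FrameComponents.
Context {R : realType}.
Implicit Types (p X Y : R3xR3 R) (u w : 'rV[R]_3).

(** The vectors [t1], [t2] are the two points turned by a right angle within their common plane,
    that is, their cross products with [q3] (see [t12E]). *)
Definition t1 p : 'rV[R]_3 := sin (theta p) *: q1 p + cos (theta p) *: q2 p.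
Definition t2 p : 'rV[R]_3 := - sin (theta p) *: q1 p + cos (theta p) *: q2 p.

(** The factors 1/sin and 1/cos in m1 and m2 cancel against the lengths of the cross products, so
    the frame is built from [q3], [t1], [t2] without division. *)
Lemma frameE p : M_nondeg p ->
  [/\ frame p o0 = (- q3 p, q3 p), frame p o1 = (- q3 p, - q3 p),
      frame p o2 = (t1 p, t2 p) & frame p o3 = (- t1 p, t2 p)].
Proof.
move=> /nondegP[_ _ C0 S0 CS p1 p2 d11 d22 d33 d12 d13 d23 c12 c23 c31].
have C1 := lt0r_neq0 C0; have S1 := lt0r_neq0 S0.
have c21 : cross (q2 p) (q1 p) = - q3 p by rewrite crossC c12.
have c32 : cross (q3 p) (q2 p) = - q1 p by rewrite crossC c23.
have a1 : (cos (theta p) *: q1 p - sin (theta p) *: q2 p) =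
  (cos (theta p) *: q1 p + (- sin (theta p)) *: q2 p) by rewrite scaleNr.
have e (P Q : R3xR3 R) : P.1 = Q.1 -> P.2 = Q.2 -> P = Q.
  by case: P => ? ?; case: Q => ? ? /= -> ->.
split; apply: e; rewrite /frame (tnth_nth 0) /m1 /m2 /m3 /m4 /K /= ?p1 ?p2 ?a1 /t1 /t2.
all: move: c12 c23 c31 c21 c32 {p1 p2 a1 d11 d22 d33 d12 d13 d23}; move: (q1 p) (q2 p) (q3 p).
all: move=> a b c c12 c23 c31 c21 c32; rewrite !(crossDr, crossZr) ?(c31, c32, c12, c21, crossuu).
all: by apply/rowP => i; rewrite !mxE; field.
Qed.

Lemma coef2 p i X : M_nondeg p -> coef p i X = dot2 X (frame p i) / 2.
Proof. by move=> hp; rewrite /coef frame_orthogonal // eqxx. Qed.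

Lemma coef_dot p X : M_nondeg p ->
  [/\ coef p o0 X = (dot X.2 (q3 p) - dot X.1 (q3 p)) / 2,
      coef p o1 X = - (dot X.1 (q3 p) + dot X.2 (q3 p)) / 2,
      coef p o2 X = (dot X.1 (t1 p) + dot X.2 (t2 p)) / 2 &
      coef p o3 X = (dot X.2 (t2 p) - dot X.1 (t1 p)) / 2].
Proof.
move=> hp; have [f0 f1 f2 f3] := frameE hp.
by rewrite !coef2 // f0 f1 f2 f3 /dot2 /= !dotNr; split; ring.
Qed.

Lemma dot_cross_triple u w z : dot (cross u w) z = dot u (cross w z).
Proof.
rewrite !dotE; have [-> -> ->] := crossE u w; have [-> -> ->] := crossE w z; ring.
Qed.

Lemma coef_K p u : M_nondeg p ->
  [/\ coef p o0 (K u p) = sin (theta p) * dot u (q1 p),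
      coef p o1 (K u p) = cos (theta p) * dot u (q2 p),
      coef p o2 (K u p) = dot u (q3 p) &
      coef p o3 (K u p) = 0].
Proof.
move=> hp; have [-> -> -> ->] := coef_dot (K u p) hp.
have [_ _ C0 S0 CS p1 p2 d11 d22 d33 d12 d13 d23 c12 c23 c31] := nondegP hp.
have c13 : cross (q1 p) (q3 p) = - q2 p by rewrite crossC c31.
have c21 : cross (q2 p) (q1 p) = - q3 p by rewrite crossC c12.
have a1 : p.1 = cos (theta p) *: q1 p + (- sin (theta p)) *: q2 p by rewrite scaleNr.
rewrite /K /= !dot_cross_triple p2 a1 /t1 /t2.
move: c12 c23 c31 c21 c13 CS {p1 p2 a1 d11 d22 d33 d12 d13 d23 C0 S0}.
move: (q1 p) (q2 p) (q3 p) (cos (theta p)) (sin (theta p)) => a b c C S c12 c23 c31 c21 c13 CS.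
have c32 : cross c b = - a by rewrite crossC c23.
rewrite !(crossDr, crossZr, crossDl, crossZl) ?(c12, c21, c23, c32, c13, c31, crossuu).
rewrite !(dotDr, dotZr, dotNr) (_ : dot u 0 = 0); last by rewrite dotE !mxE; ring.
by split; field: CS.
Qed.

(** Reversing the sign on the second factor exchanges m1 with m2 and sends m3 to -m4; the components
    of [K u p] are permuted accordingly. *)
Lemma coef_J p u : M_nondeg p ->
  [/\ coef p o0 (J u p) = cos (theta p) * dot u (q2 p),
      coef p o1 (J u p) = sin (theta p) * dot u (q1 p),
      coef p o2 (J u p) = 0 &
      coef p o3 (J u p) = - dot u (q3 p)].
Proof.
move=> hp; have [-> -> -> ->] := coef_dot (J u p) hp.
have [_ _ C0 S0 CS p1 p2 d11 d22 d33 d12 d13 d23 c12 c23 c31] := nondegP hp.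
have c13 : cross (q1 p) (q3 p) = - q2 p by rewrite crossC c31.
have c21 : cross (q2 p) (q1 p) = - q3 p by rewrite crossC c12.
have a1 : p.1 = cos (theta p) *: q1 p + (- sin (theta p)) *: q2 p by rewrite scaleNr.
rewrite /J /= !dotNl !dot_cross_triple p2 a1 /t1 /t2.
move: c12 c23 c31 c21 c13 CS {p1 p2 a1 d11 d22 d33 d12 d13 d23 C0 S0}.
move: (q1 p) (q2 p) (q3 p) (cos (theta p)) (sin (theta p)) => a b c C S c12 c23 c31 c21 c13 CS.
have c32 : cross c b = - a by rewrite crossC c23.
rewrite !(crossDr, crossZr, crossDl, crossZl) ?(c12, c21, c23, c32, c13, c31, crossuu).
rewrite !(dotDr, dotZr, dotNr) (_ : dot u 0 = 0); last by rewrite dotE !mxE; ring.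
by split; field: CS.
Qed.

Lemma gE p X Y : g p X Y =
  (2 - cos (2 * theta p))^-1 * coef p o0 X * coef p o0 Y
  + (2 + cos (2 * theta p))^-1 * coef p o1 X * coef p o1 Y
  + 3^-1 * coef p o2 X * coef p o2 Y + coef p o3 X * coef p o3 Y.
Proof. by rewrite /g sum4 /frame_sqnorm !(tnth_nth 0) /= mul1r. Qed.

Lemma KflatE u p X : M_nondeg p -> Kflat u p X =
  (2 - cos (2 * theta p))^-1 * (sin (theta p) * dot u (q1 p)) * coef p o0 X
  + (2 + cos (2 * theta p))^-1 * (cos (theta p) * dot u (q2 p)) * coef p o1 X
  + 3^-1 * dot u (q3 p) * coef p o2 X.
Proof.
by move=> hp; rewrite /Kflat gE; have [-> -> -> ->] := coef_K u hp; rewrite mul0r addr0.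
Qed.

Lemma JflatE u p X : M_nondeg p -> Jflat u p X =
  (2 - cos (2 * theta p))^-1 * (cos (theta p) * dot u (q2 p)) * coef p o0 X
  + (2 + cos (2 * theta p))^-1 * (sin (theta p) * dot u (q1 p)) * coef p o1 X
  - dot u (q3 p) * coef p o3 X.
Proof.
by move=> hp; rewrite /Jflat gE; have [-> -> -> ->] := coef_J u hp; rewrite mulr0 mul0r addr0 mulNr.
Qed.

Lemma dot_sum_q p : M_nondeg p ->
  [/\ dot (p.1 + p.2) (q1 p) = 2 * cos (theta p), dot (p.1 + p.2) (q2 p) = 0
    & dot (p.1 + p.2) (q3 p) = 0] /\
  [/\ dot (p.2 - p.1) (q1 p) = 0, dot (p.2 - p.1) (q2 p) = 2 * sin (theta p)
    & dot (p.2 - p.1) (q3 p) = 0].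
Proof.
move=> /nondegP[_ _ C0 S0 CS p1 p2 d11 d22 d33 d12 d13 d23 _ _ _].
have a1 : p.1 = cos (theta p) *: q1 p + (- sin (theta p)) *: q2 p by rewrite scaleNr.
rewrite a1 p2; move: d11 d22 d33 d12 d13 d23 CS {p1 p2 a1 C0 S0}.
move: (q1 p) (q2 p) (q3 p) (cos (theta p)) (sin (theta p)) => a b c C S.
move=> d11 d22 d33 d12 d13 d23 CS.
rewrite !(dotDl, dotNl, dotZl) !(dotC b a) d11 d22 d12 d13 d23.
by split; split; ring.
Qed.

Lemma dot_sum_e p u : M_nondeg p ->
  dot (p.1 + p.2) u = 2 * cos (theta p) * dot u (q1 p) /\
  dot (p.2 - p.1) u = 2 * sin (theta p) * dot u (q2 p).
Proof.
move=> /nondegP[_ _ _ _ _ p1 p2 _ _ _ _ _ _ _ _ _].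
rewrite p1 p2; move: (q1 p) (q2 p) => a b.
by rewrite !(dotDl, dotNl, dotZl) !(dotC u); split; ring.
Qed.

Lemma cos2_theta p : cos (2 * theta p) = 2 * cos (theta p) ^+ 2 - 1.
Proof. by rewrite mulr_natl cos_mulr2n mulr2n; ring. Qed.

End FrameComponents.

Section ChartFunctions.
Context {R : realType}.
Local Notation U := 'rV[R]_4.
Implicit Types (x : U) (i : 'I_4) (y : R3xR3 R).

Definition tab4 (s : seq R) i := nth 0 s i.

Context (C S : R).

(* The chart is (w1/|w1|, w2/|w2|); w1 and w2 are given by their coordinates
   in the basis q1, q2, q3 at the base point. *)
Definition ca x := x 0 o2 - x 0 o3.
Definition cb x := - x 0 o0 - x 0 o1.
Definition ca' x := x 0 o2 + x 0 o3.
Definition cb' x := x 0 o0 - x 0 o1.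
(** In terms of the base point, w1 = p1 + ca t1 + cb q3 and w2 = p2 + ca' t2 + cb' q3. *)
Definition w11 x := C + S * ca x.
Definition w12 x := - S + C * ca x.
Definition w21 x := C - S * ca' x.
Definition w22 x := S + C * ca' x.
Definition r1 x := 1 + ca x ^+ 2 + cb x ^+ 2.
Definition r2 x := 1 + ca' x ^+ 2 + cb' x ^+ 2.
Definition rho1 x := (Num.sqrt (r1 x))^-1.
Definition rho2 x := (Num.sqrt (r2 x))^-1.
Definition f11 := tab4 [:: 0; 0; S; - S].
Definition f12 := tab4 [:: 0; 0; C; - C].
Definition f13 := tab4 [:: -1; -1; 0; 0].
Definition f21 := tab4 [:: 0; 0; - S; - S].
Definition f22 := tab4 [:: 0; 0; C; C].
Definition f23 := tab4 [:: 1; -1; 0; 0].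
(** Half of the partial derivatives of the squared lengths [r1] (here) and [r2] (in [g2]). *)
Definition g1 i x := tab4 [:: - cb x; - cb x; ca x; - ca x] i.
Definition g2 i x := tab4 [:: cb' x; - cb' x; ca' x; ca' x] i.

Definition nu1 x := w12 x * cb' x - cb x * w22 x.
Definition nu2 x := cb x * w21 x - w11 x * cb' x.
Definition nu3 x := w11 x * w22 x - w12 x * w21 x.
Definition nusq x := nu1 x ^+ 2 + nu2 x ^+ 2 + nu3 x ^+ 2.
(** The factor 2 is the squared Euclidean length of the frame vectors, by which [coef_dot]
    divides. *)
Definition eta x := (2 * Num.sqrt (nusq x))^-1.
Definition ww x := w11 x * w21 x + w12 x * w22 x + cb x * cb' x.

(* <f1, nu>, <f2, nu>, <f1, nu x w1> and <f2, nu x w2>, where f1 and f2 are the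
   derivatives of w1 and w2 in the direction i, and nu = w1 x w2. *)
Definition fnu1 i x := f11 i * nu1 x + f12 i * nu2 x + f13 i * nu3 x.
Definition fnu2 i x := f21 i * nu1 x + f22 i * nu2 x + f23 i * nu3 x.
Definition fnw1 i x := f11 i * (nu2 x * cb x - nu3 x * w12 x)
  + f12 i * (nu3 x * w11 x - nu1 x * cb x) + f13 i * (nu1 x * w12 x - nu2 x * w11 x).
Definition fnw2 i x := f21 i * (nu2 x * cb' x - nu3 x * w22 x)
  + f22 i * (nu3 x * w21 x - nu1 x * cb' x) + f23 i * (nu1 x * w22 x - nu2 x * w21 x).

(* The component along m_a of the i-th partial derivative of the chart. *)
Definition phi (a i : 'I_4) x := tab4
  [:: (rho2 x * fnu2 i x - rho1 x * fnu1 i x) * eta x;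
      - (rho1 x * fnu1 i x + rho2 x * fnu2 i x) * eta x;
      ((r1 x)^-1 * fnw1 i x + (r2 x)^-1 * fnw2 i x) * eta x;
      ((r2 x)^-1 * fnw2 i x - (r1 x)^-1 * fnw1 i x) * eta x] a.

Definition th x := acos (rho1 x * rho2 x * ww x) / 2.

(** Coordinates along [q1], [q2], [q3] at the chart point of a fixed vector whose coordinates at the
    base point are [u]. The first two come from p1 + p2 = 2 cos(theta) q1 and p2 - p1 = 2 sin(theta)
    q2. *)
Definition e1 (u : R * R * R) x := (rho1 x * (u.1.1 * w11 x + u.1.2 * w12 x + u.2 * cb x)
  + rho2 x * (u.1.1 * w21 x + u.1.2 * w22 x + u.2 * cb' x)) * (2 * cos (th x))^-1.
Definition e2 (u : R * R * R) x := (rho2 x * (u.1.1 * w21 x + u.1.2 * w22 x + u.2 * cb' x)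
  - rho1 x * (u.1.1 * w11 x + u.1.2 * w12 x + u.2 * cb x)) * (2 * sin (th x))^-1.
Definition e3 (u : R * R * R) x := (u.1.1 * nu1 x + u.1.2 * nu2 x + u.2 * nu3 x) * (2 * eta x).

End ChartFunctions.

Section Chart.
Context {R : realType} (y : R3xR3 R) (hy : M_nondeg y).
Local Notation U := 'rV[R]_4.
Local Notation C := (cos (theta y)).
Local Notation S := (sin (theta y)).

Definition vec (a b c : R) : 'rV[R]_3 := a *: q1 y + b *: q2 y + c *: q3 y.

Lemma CS1 : S ^+ 2 = 1 - C ^+ 2. Proof. by rewrite sin2cos2. Qed.

Lemma dot_vec a b c a' b' c' : dot (vec a b c) (vec a' b' c') = a * a' + b * b' + c * c'.
Proof.
have [_ _ _ _ _ _ _ d11 d22 d33 d12 d13 d23 _ _ _] := nondegP hy.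
rewrite /vec; move: d11 d22 d33 d12 d13 d23; move: (q1 y) (q2 y) (q3 y) => u v w d11 d22 d33 d12 d13 d23.
rewrite !(dotDl, dotDr, dotZl, dotZr) (dotC v u) (dotC w u) (dotC w v) d11 d22 d33 d12 d13 d23.
by ring.
Qed.

Lemma cross_vec a b c a' b' c' : cross (vec a b c) (vec a' b' c') =
  vec (b * c' - c * b') (c * a' - a * c') (a * b' - b * a').
Proof.
have [_ _ _ _ _ _ _ _ _ _ _ _ _ c12 c23 c31] := nondegP hy.
rewrite /vec; move: c12 c23 c31; move: (q1 y) (q2 y) (q3 y) => u v w c12 c23 c31.
have c21 : cross v u = - w by rewrite crossC c12.
have c32 : cross w v = - u by rewrite crossC c23.
have c13 : cross u w = - v by rewrite crossC c31.
rewrite !(crossDl, crossDr, crossZl, crossZr) !crossuu c12 c23 c31 c21 c32 c13.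
by apply/rowP => i; rewrite !mxE; ring.
Qed.

Lemma vecZ k a b c : k *: vec a b c = vec (k * a) (k * b) (k * c).
Proof. by apply/rowP => i; rewrite !mxE; ring. Qed.

Lemma dot_vecr u a b c : dot u (vec a b c) = a * dot u (q1 y) + b * dot u (q2 y) + c * dot u (q3 y).
Proof. by rewrite /vec; move: (q1 y) (q2 y) (q3 y) => ? ? ?; rewrite !(dotDr, dotZr). Qed.

Lemma w1_sq (x : U) : w11 C S x * w11 C S x + w12 C S x * w12 C S x + cb x * cb x = r1 x.
Proof. by rewrite /w11 /w12 /r1; ring: CS1. Qed.
Lemma w2_sq (x : U) : w21 C S x * w21 C S x + w22 C S x * w22 C S x + cb' x * cb' x = r2 x.
Proof. by rewrite /w21 /w22 /r2; ring: CS1. Qed.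

Lemma r1_gt0 (x : U) : 0 < r1 x.
Proof. by rewrite /r1 -addrA ltr_pwDl // addr_ge0 // sqr_ge0. Qed.
Lemma r2_gt0 (x : U) : 0 < r2 x.
Proof. by rewrite /r2 -addrA ltr_pwDl // addr_ge0 // sqr_ge0. Qed.
Lemma rho1_sq (x : U) : rho1 x ^+ 2 = (r1 x)^-1.
Proof. by rewrite exprVn sqr_sqrtr // ltW // r1_gt0. Qed.
Lemma rho2_sq (x : U) : rho2 x ^+ 2 = (r2 x)^-1.
Proof. by rewrite exprVn sqr_sqrtr // ltW // r2_gt0. Qed.
Lemma rho1_gt0 (x : U) : 0 < rho1 x.
Proof. by rewrite invr_gt0 sqrtr_gt0 r1_gt0. Qed.
Lemma rho2_gt0 (x : U) : 0 < rho2 x.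
Proof. by rewrite invr_gt0 sqrtr_gt0 r2_gt0. Qed.

Lemma chartE (x : U) : chart y x =
  (vec (rho1 x * w11 C S x) (rho1 x * w12 C S x) (rho1 x * cb x),
   vec (rho2 x * w21 C S x) (rho2 x * w22 C S x) (rho2 x * cb' x)).
Proof.
have [fr0 fr1 fr2 fr3] := frameE hy.
have [_ _ _ _ _ p1 p2 _ _ _ _ _ _ _ _ _] := nondegP hy.
rewrite /chart sum4 fr0 fr1 fr2 fr3 /t1 /t2 /=.
have -> : y.1 + (x 0 o0 *: - q3 y + x 0 o1 *: - q3 y + x 0 o2 *: (S *: q1 y + C *: q2 y)
   + x 0 o3 *: - (S *: q1 y + C *: q2 y)) = vec (w11 C S x) (w12 C S x) (cb x).
  rewrite p1 /vec /w11 /w12 /cb /ca; move: (q1 y) (q2 y) (q3 y) => u v w.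
  by apply/rowP => i; rewrite !mxE; ring.
have -> : y.2 + (x 0 o0 *: q3 y + x 0 o1 *: - q3 y + x 0 o2 *: (- S *: q1 y + C *: q2 y)
   + x 0 o3 *: (- S *: q1 y + C *: q2 y)) = vec (w21 C S x) (w22 C S x) (cb' x).
  rewrite p2 /vec /w21 /w22 /cb' /ca'; move: (q1 y) (q2 y) (q3 y) => u v w.
  by apply/rowP => i; rewrite !mxE; ring.
by rewrite /normalize /enorm !dot_vec w1_sq w2_sq !vecZ.
Qed.

Definition dP (rho fk gi wk : R) := rho * fk - rho ^+ 3 * gi * wk.

Lemma is_derive_coord (x : U) k i : is_derive x (delta_mx 0 i) (fun x : U => x 0 k) ((i == k)%:R : R).
Proof.
have [_ _ h] := has_jet_coord (R := R) k; apply/is_derive_line.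
have e : (fun h : R => (h *: delta_mx 0 i + x) 0 k) = fun h : R => h * (i == k)%:R + x 0 k.
  by apply/funext => t; rewrite !mxE eqxx eq_sym.
rewrite e; have i1 := is_derive_id (0 : R) (1 : R).
apply: (is_derive_eq (is_deriveDr (is_deriveMr i1 (is_derive_cst ((i == k)%:R : R) _ _)) (is_derive_cst (x 0 k) _ _))).
by rewrite /cst /=; ring.
Qed.

End Chart.

Section ChartDerivative.
Context {R : realType} (y : R3xR3 R) (hy : M_nondeg y).
Local Notation U := 'rV[R]_4.
Local Notation C := (cos (theta y)).
Local Notation S := (sin (theta y)).
Local Notation vec := (vec y).

Lemma is_derive_invsqrt (t : R) : 0 < t ->
  is_derive t (1 : R) (fun u => (Num.sqrt u)^-1) (- 2^-1 * (Num.sqrt t) ^- 3).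
Proof.
move=> t0; have s0 : Num.sqrt t != 0 by rewrite gt_eqF // sqrtr_gt0.
apply: (is_derive_eq (is_derive_comp_real (F := fun u => u^-1) (is_derive_inv s0) (is_derive1_sqrt t0))).
by field.
Qed.

Lemma is_derive_ca (x : U) i : [/\ is_derive x (delta_mx 0 i) ca (tab4 [:: 0; 0; 1; -1 : R] i),
  is_derive x (delta_mx 0 i) cb (tab4 [:: -1; -1; 0; 0 : R] i),
  is_derive x (delta_mx 0 i) ca' (tab4 [:: 0; 0; 1; 1 : R] i) &
  is_derive x (delta_mx 0 i) cb' (tab4 [:: 1; -1; 0; 0 : R] i)].
Proof.
have h k := is_derive_coord x k i.
split.
- apply: (is_derive_eq (is_deriveDr (h o2) (is_deriveNr (h o3)))).
  by move: i {h}; apply: ord4P; rewrite /tab4 /= ?oppr0 ?addr0 ?add0r.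
- apply: (is_derive_eq (is_deriveDr (is_deriveNr (h o0)) (is_deriveNr (h o1)))).
  by move: i {h}; apply: ord4P; rewrite /tab4 /= ?oppr0 ?addr0 ?add0r.
- apply: (is_derive_eq (is_deriveDr (h o2) (h o3))).
  by move: i {h}; apply: ord4P; rewrite /tab4 /= ?oppr0 ?addr0 ?add0r.
- apply: (is_derive_eq (is_deriveDr (h o0) (is_deriveNr (h o1)))).
  by move: i {h}; apply: ord4P; rewrite /tab4 /= ?oppr0 ?addr0 ?add0r.
Qed.

Lemma is_derive_w (x : U) i :
  [/\ is_derive x (delta_mx 0 i) (w11 C S) (f11 S i),
      is_derive x (delta_mx 0 i) (w12 C S) (f12 C i),
      is_derive x (delta_mx 0 i) (w21 C S) (f21 S i) &
      is_derive x (delta_mx 0 i) (w22 C S) (f22 C i)].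
Proof.
have [ha _ ha' _] := is_derive_ca x i; have c k := is_derive_cst (k : R) x (delta_mx 0 i).
split.
- apply: (is_derive_eq (is_deriveDr (c C) (is_deriveMr (c S) ha))).
  by rewrite /cst /f11; move: i {ha ha' c}; apply: ord4P; rewrite /tab4 /=; ring.
- apply: (is_derive_eq (is_deriveDr (c (- S)) (is_deriveMr (c C) ha))).
  by rewrite /cst /f12; move: i {ha ha' c}; apply: ord4P; rewrite /tab4 /=; ring.
- apply: (is_derive_eq (is_deriveDr (c C) (is_deriveNr (is_deriveMr (c S) ha')))).
  by rewrite /cst /f21; move: i {ha ha' c}; apply: ord4P; rewrite /tab4 /=; ring.
- apply: (is_derive_eq (is_deriveDr (c S) (is_deriveMr (c C) ha'))).
  by rewrite /cst /f22; move: i {ha ha' c}; apply: ord4P; rewrite /tab4 /=; ring.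
Qed.

Lemma is_derive_rho (x : U) i :
  is_derive x (delta_mx 0 i) rho1 (- rho1 x ^+ 3 * g1 i x) /\
  is_derive x (delta_mx 0 i) rho2 (- rho2 x ^+ 3 * g2 i x).
Proof.
have [ha hb ha' hb'] := is_derive_ca x i; have c k := is_derive_cst (k : R) x (delta_mx 0 i).
have d1 := is_deriveDr (is_deriveDr (c 1) (is_deriveMr ha ha)) (is_deriveMr hb hb).
have d2 := is_deriveDr (is_deriveDr (c 1) (is_deriveMr ha' ha')) (is_deriveMr hb' hb').
have s1 : (Num.sqrt (r1 x)) != 0 by rewrite gt_eqF // sqrtr_gt0 r1_gt0.
have s2 : (Num.sqrt (r2 x)) != 0 by rewrite gt_eqF // sqrtr_gt0 r2_gt0.
split.
- apply: (is_derive_eq (is_derive_comp_real (F := fun u => (Num.sqrt u)^-1) (f := r1) (is_derive_invsqrt (r1_gt0 x)) d1)).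
  rewrite /rho1 /cst /g1; move: (Num.sqrt _) s1 => s s1 {d1 d2 c ha hb ha' hb'}.
  by move: i; apply: ord4P; rewrite /tab4 /=; field.
- apply: (is_derive_eq (is_derive_comp_real (F := fun u => (Num.sqrt u)^-1) (f := r2) (is_derive_invsqrt (r2_gt0 x)) d2)).
  rewrite /rho2 /cst /g2; move: (Num.sqrt (r2 x)) s2 => s s2 {d1 d2 c ha hb ha' hb'}.
  by move: i; apply: ord4P; rewrite /tab4 /=; field.
Qed.

Lemma is_derive_vec (a b c : U -> R) x v da db dc : is_derive x v a da -> is_derive x v b db ->
  is_derive x v c dc -> is_derive x v (fun x => vec (a x) (b x) (c x)) (vec da db dc).
Proof.
move=> ha hb hc; apply: is_deriveDr; last exact: is_derive_scale.
by apply: is_deriveDr; exact: is_derive_scale.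
Qed.

Lemma t12E (p : R3xR3 R) : M_nondeg p -> t1 p = cross (q3 p) p.1 /\ t2 p = cross (q3 p) p.2.
Proof.
move=> /frameE[_ _ f2 _]; have -> : t1 p = (frame p o2).1 by rewrite f2.
by have -> : t2 p = (frame p o2).2 by rewrite f2.
Qed.

Definition dchart i (x : U) : R3xR3 R :=
  (vec (dP (rho1 x) (f11 S i) (g1 i x) (w11 C S x)) (dP (rho1 x) (f12 C i) (g1 i x) (w12 C S x))
       (dP (rho1 x) (f13 i) (g1 i x) (cb x)),
   vec (dP (rho2 x) (f21 S i) (g2 i x) (w21 C S x)) (dP (rho2 x) (f22 C i) (g2 i x) (w22 C S x))
       (dP (rho2 x) (f23 i) (g2 i x) (cb' x))).

Lemma derive_chart (x : U) i : 'D_(delta_mx 0 i) (chart y) x = dchart i x.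
Proof.
have [a1 a2 a3 a4] := is_derive_w x i; have [h1 h2] := is_derive_rho x i.
have [_ hb _ hb'] := is_derive_ca x i.
have -> : chart y = fun x =>
  (vec (rho1 x * w11 C S x) (rho1 x * w12 C S x) (rho1 x * cb x),
   vec (rho2 x * w21 C S x) (rho2 x * w22 C S x) (rho2 x * cb' x)).
  by apply/funext => z; exact: chartE.
have [_ ->] := is_derive_pair (is_derive_vec (is_deriveMr h1 a1) (is_deriveMr h1 a2) (is_deriveMr h1 hb))
  (is_derive_vec (is_deriveMr h2 a3) (is_deriveMr h2 a4) (is_deriveMr h2 hb')).
by rewrite /dchart /dP !mulNr.
Qed.

(** Lagrange's identity for the cross product; it turns [0 < nusq] into nondegeneracy of the chart
    point. *)
Lemma nusq_id (x : U) : nusq C S x = r1 x * r2 x - ww C S x ^+ 2.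
Proof.
by rewrite -!(w1_sq y) -(w2_sq y) /nusq /nu1 /nu2 /nu3 /ww; ring.
Qed.

Lemma chart_dot (x : U) : dot (chart y x).1 (chart y x).2 = rho1 x * rho2 x * ww C S x.
Proof. by rewrite chartE // dot_vec // /ww; ring. Qed.

Lemma chart_nondeg (x : U) : 0 < nusq C S x -> M_nondeg (chart y x).
Proof.
move=> n0.
have i1 : r1 x != 0 by rewrite gt_eqF // r1_gt0.
have i2 : r2 x != 0 by rewrite gt_eqF // r2_gt0.
have k1 : enorm (chart y x).1 = 1.
  rewrite chartE // /enorm; apply: sqrt_eq => //=; rewrite dot_vec // expr1n.
  have := rho1_sq x; have := w1_sq y x => <- h.
  transitivity (rho1 x ^+ 2 * r1 x); last by rewrite rho1_sq mulVf.
  by rewrite -(w1_sq y); ring.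
have k2 : enorm (chart y x).2 = 1.
  rewrite chartE // /enorm; apply: sqrt_eq => //=; rewrite dot_vec // expr1n.
  transitivity (rho2 x ^+ 2 * r2 x); last by rewrite rho2_sq mulVf.
  by rewrite -(w2_sq y); ring.
have sq : (dot (chart y x).1 (chart y x).2) ^+ 2 < 1.
  rewrite chart_dot !exprMn rho1_sq rho2_sq -invfM mulrC ltr_pdivrMr ?mulr_gt0 ?r1_gt0 ?r2_gt0 //.
  by rewrite mul1r -subr_gt0 -nusq_id.
split=> // e; move: sq; rewrite e.
- by rewrite -enorm_sqr k2 !expr1n ltxx.
- by rewrite dotNl -enorm_sqr k2 sqrrN !expr1n ltxx.
Qed.

Lemma chart_q3 (x : U) : 0 < nusq C S x ->
  q3 (chart y x) = vec (nu1 C S x * (2 * eta C S x)) (nu2 C S x * (2 * eta C S x)) (nu3 C S x * (2 * eta C S x)).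
Proof.
move=> n0; set N := Num.sqrt (nusq C S x).
have N0 : 0 < N by rewrite sqrtr_gt0.
have p1 := rho1_gt0 x; have p2 := rho2_gt0 x.
have ce : cross (chart y x).1 (chart y x).2 = (rho1 x * rho2 x) *: vec (nu1 C S x) (nu2 C S x) (nu3 C S x).
  by rewrite chartE // cross_vec // vecZ /nu1 /nu2 /nu3; congr vec; ring.
have en : enorm (cross (chart y x).1 (chart y x).2) = rho1 x * rho2 x * N.
  rewrite ce /enorm dotZl dotZr dot_vec //; apply: sqrt_eq; first by rewrite !mulr_ge0 // ltW.
  by rewrite !exprMn sqr_sqrtr ?ltW // /nusq; ring.
have h1 := lt0r_neq0 p1; have h2 := lt0r_neq0 p2; have h3 := lt0r_neq0 N0.
rewrite /q3 /normalize en ce scalerA vecZ /eta -/N; congr vec; field; by rewrite h1 h2 h3.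
Qed.

(** The derivative of w/|w| contains a multiple of w itself, which is orthogonal to [q3] and to the
    tangent vectors [t1], [t2]. Only the derivatives of w1 and w2 survive in [phi]. *)
Lemma coef_chart (x : U) a i : 0 < nusq C S x -> coef (chart y x) a (dchart i x) = phi C S a i x.
Proof.
move=> n0; have hx := chart_nondeg n0.
have [c0 c1 c2 c3] := coef_dot (dchart i x) hx.
have e3 := chart_q3 n0.
have t1E : Defs.dot (dchart i x).1 (t1 (chart y x)) = 2 * ((r1 x)^-1 * fnw1 C S i x * eta C S x).
  have [-> _] := t12E hx; rewrite e3 chartE // cross_vec // dot_vec // -rho1_sq.
  by rewrite /dP /fnw1; ring.
have t2E : Defs.dot (dchart i x).2 (t2 (chart y x)) = 2 * ((r2 x)^-1 * fnw2 C S i x * eta C S x).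
  have [_ ->] := t12E hx; rewrite e3 chartE // cross_vec // dot_vec // -rho2_sq.
  by rewrite /dP /fnw2; ring.
have q1E : Defs.dot (dchart i x).1 (q3 (chart y x)) = 2 * (rho1 x * fnu1 C S i x * eta C S x).
  by rewrite e3 dot_vec // /dP /fnu1 /nu1 /nu2 /nu3; ring.
have q2E : Defs.dot (dchart i x).2 (q3 (chart y x)) = 2 * (rho2 x * fnu2 C S i x * eta C S x).
  by rewrite e3 dot_vec // /dP /fnu2 /nu1 /nu2 /nu3; ring.
move: a; apply: ord4P; rewrite ?c0 ?c1 ?c2 ?c3 /phi /tab4 /= ?t1E ?t2E ?q1E ?q2E; move: (r1 x)^-1 (r2 x)^-1 => ? ?; by field.
Qed.

Lemma th_chart (x : U) : theta (chart y x) = th C S x.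
Proof. by rewrite /theta /th chart_dot. Qed.

Lemma e_chart (x : U) u : 0 < nusq C S x ->
  let c := (dot u (q1 y), dot u (q2 y), dot u (q3 y)) in
  [/\ dot u (q1 (chart y x)) = e1 C S c x, dot u (q2 (chart y x)) = e2 C S c x &
      dot u (q3 (chart y x)) = e3 C S c x].
Proof.
move=> n0 c; have hx := chart_nondeg n0.
have [_ _ C0 S0 _ _ _ _ _ _ _ _ _ _ _ _] := nondegP hx.
have C1 := lt0r_neq0 C0; have S1 := lt0r_neq0 S0.
have [h1 h2] := dot_sum_e u hx.
split.
- apply: (mulfI (x := 2 * cos (theta (chart y x)))); first by rewrite mulf_neq0 // pnatr_eq0.
  rewrite -h1 /e1 -th_chart /c; move: (cos (theta (chart y x))) C1 => t C1.
  rewrite dotC dotDr chartE // !dot_vecr /=.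
  by field.
- apply: (mulfI (x := 2 * sin (theta (chart y x)))); first by rewrite mulf_neq0 // pnatr_eq0.
  rewrite -h2 /e2 -th_chart /c; move: (sin (theta (chart y x))) S1 => t S1.
  rewrite dotC dotDr dotNr chartE // !dot_vecr /=.
  by field.
- by rewrite chart_q3 // dot_vecr /e3 /c /=; ring.
Qed.

End ChartDerivative.

(** * Taylor coefficients of the chart *)

Section JetTables.
Context {R : realType}.
Local Notation U := 'rV[R]_4.
Local Notation J4 := (@jet2 R 4).

Definition jtab (v : R) (d : seq R) (h : seq (seq R)) : J4 :=
  Jet2 v (tab4 d) (fun i j => nth 0 (nth [::] h i) j).

Context (C S t0 : R).
Context (CS : S ^+ 2 = 1 - C ^+ 2).
Context (C0 : 0 < C).
Context (S0 : 0 < S).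
Context (Ct : C = cos t0).
Context (St : S = sin t0).
Context (t0r : 0 < t0 < pi / 2).

Let C1 : C != 0 := lt0r_neq0 C0.
Let S1 : S != 0 := lt0r_neq0 S0.

(** The values form the identity matrix because the coordinate fields coincide with the frame at the
    origin. The gradients and Hessians measure how the two part; all effects of the frame not being
    a coordinate frame come from here. *)
Definition phi_tab (a i : 'I_4) : J4 :=
  let k := S / C in let k' := C / S in
  nth (jcst 0) (nth [::] [::
  [:: jtab 1 [:: 0; 0; 0; 0] [:: [:: - (1 + S^-2); 0; 0; 0]; [:: 0; - (1 + C^-2); 0; 0]; [:: 0; 0; -1; 0]; [:: 0; 0; 0; -1]];
      jtab 0 [:: 0; 0; 0; 0] [:: [:: 0; -1; 0; 0]; [:: -1; 0; 0; 0]; [:: 0; 0; 0; 1]; [:: 0; 0; 1; 0]];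
      jtab 0 [:: 0; - k; 0; 0] [:: [:: 0; 0; -1; 0]; [:: 0; 0; 0; - k ^+ 2]; [:: -1; 0; 0; 0]; [:: 0; - k ^+ 2; 0; 0]];
      jtab 0 [:: - k'; 0; 0; 0] [:: [:: 0; 0; 0; k' ^+ 2]; [:: 0; 0; 1; 0]; [:: 0; 1; 0; 0]; [:: k' ^+ 2; 0; 0; 0]]];
  [:: jtab 0 [:: 0; 0; 0; 0] [:: [:: 0; -1; 0; 0]; [:: -1; 0; 0; 0]; [:: 0; 0; 0; 1]; [:: 0; 0; 1; 0]];
      jtab 1 [:: 0; 0; 0; 0] [:: [:: - (1 + S^-2); 0; 0; 0]; [:: 0; - (1 + C^-2); 0; 0]; [:: 0; 0; -1; 0]; [:: 0; 0; 0; -1]];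
      jtab 0 [:: k'; 0; 0; 0] [:: [:: 0; 0; 0; - k' ^+ 2]; [:: 0; 0; -1; 0]; [:: 0; -1; 0; 0]; [:: - k' ^+ 2; 0; 0; 0]];
      jtab 0 [:: 0; k; 0; 0] [:: [:: 0; 0; 1; 0]; [:: 0; 0; 0; k ^+ 2]; [:: 1; 0; 0; 0]; [:: 0; k ^+ 2; 0; 0]]];
  [:: jtab 0 [:: 0; k; 0; 0] [:: [:: 0; 0; 0; 0]; [:: 0; 0; 0; C^-2]; [:: 0; 0; 0; 0]; [:: 0; C^-2; 0; 0]];
      jtab 0 [:: - k'; 0; 0; 0] [:: [:: 0; 0; 0; S^-2]; [:: 0; 0; 0; 0]; [:: 0; 0; 0; 0]; [:: S^-2; 0; 0; 0]];
      jtab 1 [:: 0; 0; 0; 0] [:: [:: - S^-2; 0; 0; 0]; [:: 0; - C^-2; 0; 0]; [:: 0; 0; -2; 0]; [:: 0; 0; 0; -2]];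
      jtab 0 [:: 0; 0; 0; 0] [:: [:: 0; 0; 0; 0]; [:: 0; 0; 0; 0]; [:: 0; 0; 0; -2]; [:: 0; 0; -2; 0]]];
  [:: jtab 0 [:: k'; 0; 0; 0] [:: [:: 0; 0; 0; - S^-2]; [:: 0; 0; 0; 0]; [:: 0; 0; 0; 0]; [:: - S^-2; 0; 0; 0]];
      jtab 0 [:: 0; - k; 0; 0] [:: [:: 0; 0; 0; 0]; [:: 0; 0; 0; - C^-2]; [:: 0; 0; 0; 0]; [:: 0; - C^-2; 0; 0]];
      jtab 0 [:: 0; 0; 0; 0] [:: [:: 0; 0; 0; 0]; [:: 0; 0; 0; 0]; [:: 0; 0; 0; -2]; [:: 0; 0; -2; 0]];
      jtab 1 [:: 0; 0; 0; 0] [:: [:: - S^-2; 0; 0; 0]; [:: 0; - C^-2; 0; 0]; [:: 0; 0; -2; 0]; [:: 0; 0; 0; -2]]]] a) i.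

Definition th_tab : J4 := jtab t0 [:: 0; 0; 0; 1]
  [:: [:: C / S; 0; 0; 0]; [:: 0; - (S / C); 0; 0]; [:: 0; 0; 0; 0]; [:: 0; 0; 0; 0]].

Definition e1_tab (u : R * R * R) : J4 :=
  let: (u1, u2, u3) := u in jtab u1 [:: 0; - (u3 / C); u2; 0]
  [:: [:: 0; u2 * S / C; 0; 0]; [:: u2 * S / C; - (u1 / C ^+ 2); 0; - (u3 * S / C ^+ 2)];
      [:: 0; 0; - u1; 0]; [:: 0; - (u3 * S / C ^+ 2); 0; 0]].
Definition e2_tab (u : R * R * R) : J4 :=
  let: (u1, u2, u3) := u in jtab u2 [:: u3 / S; 0; - u1; 0]
  [:: [:: - (u2 / S ^+ 2); u1 * C / S; 0; - (u3 * C / S ^+ 2)]; [:: u1 * C / S; 0; 0; 0];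
      [:: 0; 0; - u2; 0]; [:: - (u3 * C / S ^+ 2); 0; 0; 0]].
Definition e3_tab (u : R * R * R) : J4 :=
  let: (u1, u2, u3) := u in jtab u3 [:: - (u2 / S); u1 / C; 0; 0]
  [:: [:: - (u3 / S ^+ 2); 0; u1 / S; u2 * C / S ^+ 2]; [:: 0; - (u3 / C ^+ 2); u2 / C; u1 * S / C ^+ 2];
      [:: u1 / S; u2 / C; 0; 0]; [:: u2 * C / S ^+ 2; u1 * S / C ^+ 2; 0; 0]].

Let z4 : seq (seq R) := [:: [:: 0; 0; 0; 0]; [:: 0; 0; 0; 0]; [:: 0; 0; 0; 0]; [:: 0; 0; 0; 0]].

Ltac jcase := move=> /=; repeat (apply: ord4P); rewrite /tab4 /=.
Ltac by_jet h := refine (@has_jet_eq _ _ _ _ _ h _ _ _); jcase.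

Lemma has_jet_opp (f : U -> R) J : has_jet f J -> has_jet (fun x => - f x) (jmul (jcst (-1)) J).
Proof.
by move=> h; apply: has_jet_ext (has_jet_mul (has_jet_cst (-1)) h) => x; rewrite mulN1r.
Qed.

Lemma has_jet_sub (f g : U -> R) J K : has_jet f J -> has_jet g K ->
  has_jet (fun x => f x - g x) (jadd J (jmul (jcst (-1)) K)).
Proof. by move=> hf hg; apply: has_jet_add => //; exact: has_jet_opp. Qed.

Lemma has_jet_sqr (f : U -> R) J : has_jet f J -> has_jet (fun x => f x ^+ 2) (jmul J J).
Proof. by move=> h; apply: has_jet_ext (has_jet_mul h h) => x; rewrite expr2. Qed.

Lemma has_jet_ca : [/\ has_jet ca (jtab 0 [:: 0; 0; 1; -1] z4),
  has_jet cb (jtab 0 [:: -1; -1; 0; 0] z4), has_jet ca' (jtab 0 [:: 0; 0; 1; 1] z4) &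
  has_jet cb' (jtab 0 [:: 1; -1; 0; 0] z4)].
Proof.
have h k := has_jet_coord (R := R) (k : 'I_4).
split.
- by_jet (has_jet_sub (h o2) (h o3)); ring.
- by_jet (has_jet_sub (has_jet_opp (h o0)) (h o1)); ring.
- by_jet (has_jet_add (h o2) (h o3)); ring.
- by_jet (has_jet_sub (h o0) (h o1)); ring.
Qed.

Lemma has_jet_w : [/\ has_jet (w11 C S) (jtab C [:: 0; 0; S; - S] z4),
  has_jet (w12 C S) (jtab (- S) [:: 0; 0; C; - C] z4),
  has_jet (w21 C S) (jtab C [:: 0; 0; - S; - S] z4) &
  has_jet (w22 C S) (jtab S [:: 0; 0; C; C] z4)].
Proof.
have [ha _ ha' _] := has_jet_ca; have c (k : R) := @has_jet_cst R 4 k.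
split.
- by_jet (has_jet_add (c C) (has_jet_mul (c S) ha)); ring.
- by_jet (has_jet_add (c (- S)) (has_jet_mul (c C) ha)); ring.
- by_jet (has_jet_sub (c C) (has_jet_mul (c S) ha')); ring.
- by_jet (has_jet_add (c S) (has_jet_mul (c C) ha')); ring.
Qed.

Lemma has_jet_r : [/\
  has_jet r1 (jtab 1 [:: 0; 0; 0; 0] [:: [:: 2; 2; 0; 0]; [:: 2; 2; 0; 0]; [:: 0; 0; 2; -2]; [:: 0; 0; -2; 2]]) &
  has_jet r2 (jtab 1 [:: 0; 0; 0; 0] [:: [:: 2; -2; 0; 0]; [:: -2; 2; 0; 0]; [:: 0; 0; 2; 2]; [:: 0; 0; 2; 2]])].
Proof.
have [ha hb ha' hb'] := has_jet_ca; have c (k : R) := @has_jet_cst R 4 k.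
split.
- by_jet (has_jet_add (has_jet_add (c 1) (has_jet_sqr ha)) (has_jet_sqr hb)); ring.
- by_jet (has_jet_add (has_jet_add (c 1) (has_jet_sqr ha')) (has_jet_sqr hb')); ring.
Qed.

Lemma is_derive_invsqrt2 (t : R) : 0 < t ->
  is_derive t (1 : R) (fun u => - 2^-1 * (Num.sqrt u) ^- 3) (3 / 4 * (Num.sqrt t) ^- 5).
Proof.
move=> t0'; have s0 : Num.sqrt t != 0 by rewrite gt_eqF // sqrtr_gt0.
have h := is_derive_invsqrt t0'.
have := is_deriveMr (is_derive_cst (- 2^-1 : R) t (1 : R)) (is_deriveMr h (is_deriveMr h h)).
rewrite (_ : (fun u => _) = (fun u => - 2^-1 * (Num.sqrt u) ^- 3)); last first.
  by apply/funext => u; rewrite /cst -!invfM exprS expr2.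
by move=> /is_derive_eq; apply; rewrite /cst; field.
Qed.

(** The square root [s] of the value is supplied in advance, which keeps the resulting jet free of
    radicals. *)
Lemma has_jet_invsqrt (f : U -> R) J (s : R) : has_jet f J -> 0 < s -> jv J = s ^+ 2 ->
  has_jet (fun x => (Num.sqrt (f x))^-1) (jcomp s^-1 (- 2^-1 * s ^- 3) (3 / 4 * s ^- 5) J).
Proof.
move=> h s0 e.
have se : Num.sqrt (jv J) = s by rewrite e sqrtr_sqr gtr0_norm.
have p0 : 0 < jv J by rewrite e exprn_gt0.
have := has_jet_comp (F := fun u => (Num.sqrt u)^-1) (F' := fun u => - 2^-1 * (Num.sqrt u) ^- 3) h _ (is_derive_invsqrt2 p0).
rewrite se; apply; near=> t; apply: is_derive_invsqrt; near: t.
by apply: open_nbhs_nbhs; split; [exact: open_gt | exact: p0].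
Unshelve. all: by end_near. Qed.

Lemma has_jet_rho : [/\
  has_jet rho1 (jtab 1 [:: 0; 0; 0; 0] [:: [:: -1; -1; 0; 0]; [:: -1; -1; 0; 0]; [:: 0; 0; -1; 1]; [:: 0; 0; 1; -1]]),
  has_jet rho2 (jtab 1 [:: 0; 0; 0; 0] [:: [:: -1; 1; 0; 0]; [:: 1; -1; 0; 0]; [:: 0; 0; -1; -1]; [:: 0; 0; -1; -1]]),
  has_jet (fun x => (r1 x)^-1) (jtab 1 [:: 0; 0; 0; 0] [:: [:: -2; -2; 0; 0]; [:: -2; -2; 0; 0]; [:: 0; 0; -2; 2]; [:: 0; 0; 2; -2]]) &
  has_jet (fun x => (r2 x)^-1) (jtab 1 [:: 0; 0; 0; 0] [:: [:: -2; 2; 0; 0]; [:: 2; -2; 0; 0]; [:: 0; 0; -2; -2]; [:: 0; 0; -2; -2]])].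
Proof.
have [h1 h2] := has_jet_r.
split.
- by_jet (has_jet_invsqrt h1 ltr01 (esym (expr1n _ 2))); by field.
- by_jet (has_jet_invsqrt h2 ltr01 (esym (expr1n _ 2))); by field.
- by_jet (has_jet_inv (oner_neq0 _ : jv (jtab 1 _ _) != 0) h1); by field.
- by_jet (has_jet_inv (oner_neq0 _ : jv (jtab 1 _ _) != 0) h2); by field.
Qed.

Let dd := C ^+ 2 - S ^+ 2.

Lemma has_jet_nu : [/\
  has_jet (nu1 C S) (jtab 0 [:: 0; 2 * S; 0; 0] [:: [:: 0; 0; 2 * C; 0]; [:: 0; 0; 0; 2 * C]; [:: 2 * C; 0; 0; 0]; [:: 0; 2 * C; 0; 0]]),
  has_jet (nu2 C S) (jtab 0 [:: - (2 * C); 0; 0; 0] [:: [:: 0; 0; 0; 2 * S]; [:: 0; 0; 2 * S; 0]; [:: 0; 2 * S; 0; 0]; [:: 2 * S; 0; 0; 0]]),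
  has_jet (nu3 C S) (jtab (2 * C * S) [:: 0; 0; 0; 2 * dd] [:: [:: 0; 0; 0; 0]; [:: 0; 0; 0; 0]; [:: 0; 0;
    4 * S * C; 0]; [:: 0; 0; 0; - (4 * S * C)]]) &
  has_jet (nusq C S) (jtab (4 * C ^+ 2 * S ^+ 2) [:: 0; 0; 0; 8 * C * S * dd]
    [:: [:: 8 * C ^+ 2; 0; 0; 0]; [:: 0; 8 * S ^+ 2; 0; 0]; [:: 0; 0; 16 * C ^+ 2 * S ^+ 2; 0];
        [:: 0; 0; 0; 8 * dd ^+ 2 - 16 * C ^+ 2 * S ^+ 2]])].
Proof.
have [ha hb ha' hb'] := has_jet_ca; have [h11 h12 h21 h22] := has_jet_w.
have n1 : has_jet (nu1 C S) (jtab 0 [:: 0; 2 * S; 0; 0] [:: [:: 0; 0; 2 * C; 0]; [:: 0; 0; 0; 2 * C]; [:: 2 * C; 0; 0; 0]; [:: 0; 2 * C; 0; 0]]).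
  by_jet (has_jet_sub (has_jet_mul h12 hb') (has_jet_mul hb h22)); ring.
have n2 : has_jet (nu2 C S) (jtab 0 [:: - (2 * C); 0; 0; 0] [:: [:: 0; 0; 0; 2 * S]; [:: 0; 0; 2 * S; 0]; [:: 0; 2 * S; 0; 0]; [:: 2 * S; 0; 0; 0]]).
  by_jet (has_jet_sub (has_jet_mul hb h21) (has_jet_mul h11 hb')); ring.
have n3 : has_jet (nu3 C S) (jtab (2 * C * S) [:: 0; 0; 0; 2 * dd] [:: [:: 0; 0; 0; 0]; [:: 0; 0; 0; 0];
  [:: 0; 0; 4 * S * C; 0]; [:: 0; 0; 0; - (4 * S * C)]]).
  by_jet (has_jet_sub (has_jet_mul h11 h22) (has_jet_mul h12 h21)); rewrite /dd; ring.
split=> //.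
by_jet (has_jet_add (has_jet_add (has_jet_sqr n1) (has_jet_sqr n2)) (has_jet_sqr n3)); rewrite /dd; ring.
Qed.

Lemma has_jet_eta : has_jet (eta C S) (jtab (4 * C * S)^-1 [:: 0; 0; 0; - dd / (4 * C ^+ 2 * S ^+ 2)]
  [:: [:: - (4 * C * S ^+ 3)^-1; 0; 0; 0]; [:: 0; - (4 * C ^+ 3 * S)^-1; 0; 0];
      [:: 0; 0; - (2 * C * S)^-1; 0]; [:: 0; 0; 0; (2 * C * S)^-1 + dd ^+ 2 / (2 * C ^+ 3 * S ^+ 3)]]).
Proof.
have [_ _ _ hn] := has_jet_nu.
have s0 : 0 < 2 * C * S by rewrite !mulr_gt0.
have e : eta C S = fun x => 2^-1 * (Num.sqrt (nusq C S x))^-1.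
  by apply/funext => x; rewrite /eta invfM.
rewrite e.
have e2 : jv (jtab (4 * C ^+ 2 * S ^+ 2) [:: 0; 0; 0; 8 * C * S * dd]
    [:: [:: 8 * C ^+ 2; 0; 0; 0]; [:: 0; 8 * S ^+ 2; 0; 0]; [:: 0; 0; 16 * C ^+ 2 * S ^+ 2; 0];
        [:: 0; 0; 0; 8 * dd ^+ 2 - 16 * C ^+ 2 * S ^+ 2]]) = (2 * C * S) ^+ 2 by rewrite /=; ring.
by_jet (has_jet_mul (has_jet_cst 2^-1) (has_jet_invsqrt hn s0 e2)); rewrite /dd; field; by rewrite ?C1 ?S1.
Qed.

End JetTables.

Section PhiTables.
Context {R : realType} (C S t0 : R).
Context (CS : S ^+ 2 = 1 - C ^+ 2) (C0 : 0 < C) (S0 : 0 < S)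
  (Ct : C = cos t0) (St : S = sin t0) (t0r : 0 < t0 < pi / 2).
Let C1 : C != 0 := lt0r_neq0 C0.
Let S1 : S != 0 := lt0r_neq0 S0.

Ltac jcase := move=> /=; repeat (apply: ord4P); rewrite /tab4 /=.
Ltac unfold_f := rewrite /= /f11 /f12 /f13 /f21 /f22 /f23 /tab4 /=.
Ltac fld := field: CS; rewrite ?C1 ?S1.
Ltac by_jet h := refine (@has_jet_eq _ _ _ _ _ h _ _ _); jcase.

Definition n1_tab : @jet2 R 4 := jtab 0 [:: 0; (2 * C)^-1; 0; 0]
  [:: [:: 0; 0; (2 * S)^-1; 0]; [:: 0; 0; 0; S / (2 * C ^+ 2)]; [:: (2 * S)^-1; 0; 0; 0]; [:: 0; S / (2 * C ^+ 2); 0; 0]].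
Definition n2_tab : @jet2 R 4 := jtab 0 [:: - (2 * S)^-1; 0; 0; 0]
  [:: [:: 0; 0; 0; C / (2 * S ^+ 2)]; [:: 0; 0; (2 * C)^-1; 0]; [:: 0; (2 * C)^-1; 0; 0]; [:: C / (2 * S ^+ 2); 0; 0; 0]].
Definition n3_tab : @jet2 R 4 := jtab (2^-1) [:: 0; 0; 0; 0]
  [:: [:: - (2 * S ^+ 2)^-1; 0; 0; 0]; [:: 0; - (2 * C ^+ 2)^-1; 0; 0]; [:: 0; 0; 0; 0]; [:: 0; 0; 0; 0]].

Ltac entries := repeat (apply: ord4P); cbv beta iota zeta delta
  [jv jd jh jmul jadd jcst jtab phi_tab n1_tab n2_tab n3_tab tab4 nth nat_of_ord f11 f12 f13 f21 f22 f23].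

(* The third vector q3 of the moving frame is 2 eta nu. *)
Lemma has_jet_nu_eta : [/\ has_jet (fun x => nu1 C S x * eta C S x) n1_tab,
  has_jet (fun x => nu2 C S x * eta C S x) n2_tab &
  has_jet (fun x => nu3 C S x * eta C S x) n3_tab].
Proof.
have [h1 h2 h3 _] := has_jet_nu C S; have he := has_jet_eta C0 S0.
by split; [by_jet (has_jet_mul h1 he) | by_jet (has_jet_mul h2 he) | by_jet (has_jet_mul h3 he)];
  by fld.
Qed.

Lemma has_jet_phi01 i : has_jet (phi C S o0 i) (phi_tab C S o0 i) /\
  has_jet (phi C S o1 i) (phi_tab C S o1 i).
Proof.
have [n1 n2 n3] := has_jet_nu_eta; have [p1 p2 _ _] := has_jet_rho (R := R).
have c (k : R) := @has_jet_cst R 4 k.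
have F1 := has_jet_mul p1 (has_jet_add (has_jet_add (has_jet_mul (c (f11 S i)) n1) (has_jet_mul (c (f12 C i)) n2)) (has_jet_mul (c (f13 i)) n3)).
have F2 := has_jet_mul p2 (has_jet_add (has_jet_add (has_jet_mul (c (f21 S i)) n1) (has_jet_mul (c (f22 C i)) n2)) (has_jet_mul (c (f23 i)) n3)).
have := has_jet_opp (has_jet_add F1 F2); have := has_jet_sub F2 F1.
clear F1 F2 n1 n2 n3 p1 p2 c => q0 q1; split.
- apply: (@has_jet_ext _ _ _ (phi C S o0 i) _ _ (has_jet_eq q0 _ _ _)).
  + by move=> x; rewrite /phi /tab4 /= /fnu1 /fnu2; ring.
  + by move: i {q0 q1}; apply: ord4P; unfold_f; by field.
  + by move: i {q0 q1}; apply: ord4P; jcase; unfold_f; by field; rewrite ?C1 ?S1.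
  + by move: i {q0 q1}; entries; by fld.
- apply: (@has_jet_ext _ _ _ (phi C S o1 i) _ _ (has_jet_eq q1 _ _ _)).
  + by move=> x; rewrite /phi /tab4 /= /fnu1 /fnu2; ring.
  + by move: i {q0 q1}; apply: ord4P; unfold_f; by field.
  + by move: i {q0 q1}; apply: ord4P; jcase; unfold_f; by field; rewrite ?C1 ?S1.
  + by move: i {q0 q1}; entries; by fld.
Qed.

Lemma has_jet_phi23 i : has_jet (phi C S o2 i) (phi_tab C S o2 i) /\
  has_jet (phi C S o3 i) (phi_tab C S o3 i).
Proof.
have [n1 n2 n3] := has_jet_nu_eta; have [_ _ i1 i2] := has_jet_rho (R := R).
have [_ hb _ hb'] := has_jet_ca (R := R); have [h11 h12 h21 h22] := has_jet_w C S.
have c (k : R) := @has_jet_cst R 4 k.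
have F1 := has_jet_mul i1 (has_jet_add (has_jet_add
  (has_jet_mul (c (f11 S i)) (has_jet_sub (has_jet_mul n2 hb) (has_jet_mul n3 h12)))
  (has_jet_mul (c (f12 C i)) (has_jet_sub (has_jet_mul n3 h11) (has_jet_mul n1 hb))))
  (has_jet_mul (c (f13 i)) (has_jet_sub (has_jet_mul n1 h12) (has_jet_mul n2 h11)))).
have F2 := has_jet_mul i2 (has_jet_add (has_jet_add
  (has_jet_mul (c (f21 S i)) (has_jet_sub (has_jet_mul n2 hb') (has_jet_mul n3 h22)))
  (has_jet_mul (c (f22 C i)) (has_jet_sub (has_jet_mul n3 h21) (has_jet_mul n1 hb'))))
  (has_jet_mul (c (f23 i)) (has_jet_sub (has_jet_mul n1 h22) (has_jet_mul n2 h21)))).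
have := has_jet_sub F2 F1; have := has_jet_add F1 F2.
clear F1 F2 n1 n2 n3 i1 i2 hb hb' h11 h12 h21 h22 c => q0 q1; split.
- apply: (@has_jet_ext _ _ _ (phi C S o2 i) _ _ (has_jet_eq q0 _ _ _)).
  + by move=> x; rewrite /phi /tab4 /= /fnw1 /fnw2; move: (r1 x)^-1 (r2 x)^-1 => ? ?; ring.
  + by move: i {q0 q1}; apply: ord4P; unfold_f; by field: CS.
  + by move: i {q0 q1}; entries; by fld.
  + by move: i {q0 q1}; entries; by fld.
- apply: (@has_jet_ext _ _ _ (phi C S o3 i) _ _ (has_jet_eq q1 _ _ _)).
  + by move=> x; rewrite /phi /tab4 /= /fnw1 /fnw2; move: (r1 x)^-1 (r2 x)^-1 => ? ?; ring.
  + by move: i {q0 q1}; apply: ord4P; unfold_f; by field: CS.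
  + by move: i {q0 q1}; entries; by fld.
  + by move: i {q0 q1}; entries; by fld.
Qed.

Lemma has_jet_phi a i : has_jet (phi C S a i) (phi_tab C S a i).
Proof.
have [h0 h1] := has_jet_phi01 i; have [h2 h3] := has_jet_phi23 i.
by move: a; apply: ord4P.
Qed.

End PhiTables.

Section ThetaTables.
Context {R : realType} (C S t0 : R).
Context (CS : S ^+ 2 = 1 - C ^+ 2) (C0 : 0 < C) (S0 : 0 < S)
  (Ct : C = cos t0) (St : S = sin t0) (t0r : 0 < t0 < pi / 2).
Let C1 : C != 0 := lt0r_neq0 C0.
Let S1 : S != 0 := lt0r_neq0 S0.

Ltac jcase := move=> /=; repeat (apply: ord4P); rewrite /tab4 /=.
Ltac fld := field: CS; rewrite ?C1 ?S1.
Ltac by_jet h := refine (@has_jet_eq _ _ _ _ _ h _ _ _); jcase.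

Let dd := C ^+ 2 - S ^+ 2.

Lemma has_jet_ww : has_jet (ww C S) (jtab dd [:: 0; 0; 0; - (4 * C * S)]
  [:: [:: -2; 0; 0; 0]; [:: 0; 2; 0; 0]; [:: 0; 0; 2 * dd; 0]; [:: 0; 0; 0; - (2 * dd)]]).
Proof.
have [_ hb _ hb'] := has_jet_ca (R := R); have [h11 h12 h21 h22] := has_jet_w C S.
by_jet (has_jet_add (has_jet_add (has_jet_mul h11 h21) (has_jet_mul h12 h22)) (has_jet_mul hb hb')); rewrite /dd; ring.
Qed.

Lemma has_jet_cos2 : has_jet (fun x => rho1 x * rho2 x * ww C S x) (jtab dd [:: 0; 0; 0; - (4 * C * S)]
  [:: [:: - (4 * C ^+ 2); 0; 0; 0]; [:: 0; 4 * S ^+ 2; 0; 0]; [:: 0; 0; 0; 0]; [:: 0; 0; 0; - (4 * dd)]]).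
Proof.
have [p1 p2 _ _] := has_jet_rho (R := R).
by_jet (has_jet_mul (has_jet_mul p1 p2) has_jet_ww); rewrite /dd; ring: CS.
Qed.

Lemma has_jet_th : has_jet (th C S) (th_tab C S t0).
Proof.
have c2 : cos (t0 *+ 2) = dd by rewrite cos_mulr2n -Ct /dd CS; ring.
have ddr : -1 < dd < 1.
  by have h1 := exprn_gt0 2 C0; have h2 := exprn_gt0 2 S0; move: CS h1 h2; rewrite /dd => ? ? ?; apply/andP; split; lra.
(* This root is sin(2 theta), with the positive sign because 0 < theta < pi/2; it makes the
   derivatives of [acos] rational in [C] and [S]. *)
have sq : Num.sqrt (1 - dd ^+ 2) = 2 * S * C.
  apply: sqrt_eq; first by rewrite !mulr_ge0 // ltW.
  by rewrite /dd; ring: CS.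
have q0 : 0 < 1 - dd ^+ 2 by rewrite -sqrtr_gt0 sq !mulr_gt0.
have a0 : acos dd = 2 * t0.
  have /andP[t1 t2] := t0r.
  by rewrite -c2 cosK ?mulr_natl // in_itv /= mulr2n; apply/andP; split; lra.
have d2 : is_derive dd (1 : R) (fun t => - (Num.sqrt (1 - t ^+ 2))^-1) (- dd / (2 * S * C) ^+ 3).
  have i1 := is_derive_id dd (1 : R).
  have := is_deriveNr (is_derive_comp_real (F := fun u => (Num.sqrt u)^-1) (f := fun t : R => 1 + - (t * t)) (x := dd)
    (a := - 2^-1 * (2 * S * C) ^- 3) _ (is_deriveDr (is_derive_cst (1 : R) dd (1 : R)) (is_deriveNr (is_deriveMr i1 i1)))).
  rewrite -expr2 => /(_ _)/is_derive_eq; apply; first by rewrite -sq; exact: is_derive_invsqrt.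
  by rewrite /cst; field; rewrite ?C1 ?S1.
have := has_jet_comp (F := acos) (F' := fun t => - (Num.sqrt (1 - t ^+ 2))^-1) has_jet_cos2 _ d2.
rewrite /= a0 sq => h.
have {}h := h _; have {h}hh := has_jet_mul (h _) (has_jet_cst 2^-1).
refine (@has_jet_eq _ _ _ _ _ (hh _) _ _ _).
- have /andP[dd1 dd2] := ddr.
  near=> t; apply: is_derive1_acos; apply/andP; split; near: t.
    by apply: open_nbhs_nbhs; split; [exact: open_gt | exact: dd1].
  by apply: open_nbhs_nbhs; split; [exact: open_lt | exact: dd2].
- by jcase; field.
- by jcase; field; rewrite ?C1 ?S1.
- by jcase; rewrite /dd; fld.
Unshelve. all: by end_near. Qed.

Lemma has_jet_fun_th (F F' : R -> R) F2 :
  (\forall t \near t0, is_derive (t : R) (1 : R) F (F' t)) -> is_derive t0 (1 : R) F' F2 ->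
  has_jet (fun x => F (th C S x)) (jcomp (F t0) (F' t0) F2 (th_tab C S t0)).
Proof. by move=> h1 h2; exact: (has_jet_comp has_jet_th h1 h2). Qed.

Lemma has_jet_cos_th : has_jet (fun x => cos (th C S x)) (jcomp C (- S) (- C) (th_tab C S t0)).
Proof.
have := @has_jet_fun_th cos (fun t => - sin t) (- cos t0); rewrite -Ct -St; apply.
  by near=> t; exact: is_derive_cos.
by rewrite [X in is_derive _ _ _ (- X)]Ct; apply: is_deriveNr; exact: is_derive_sin.
Unshelve. all: by end_near. Qed.

Lemma has_jet_sin_th : has_jet (fun x => sin (th C S x)) (jcomp S C (- S) (th_tab C S t0)).
Proof.
have := @has_jet_fun_th sin cos (- sin t0); rewrite -Ct -St; apply.
  by near=> t; exact: is_derive_sin.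
by rewrite [X in is_derive _ _ _ (- X)]St; exact: is_derive_cos.
Unshelve. all: by end_near. Qed.

Lemma has_jet_e u : [/\ has_jet (e1 C S u) (e1_tab C S u), has_jet (e2 C S u) (e2_tab C S u) &
  has_jet (e3 C S u) (e3_tab C S u)].
Proof.
have [n1 n2 n3] := has_jet_nu_eta CS C0 S0.
have [p1 p2 _ _] := has_jet_rho (R := R).
have [_ hb _ hb'] := has_jet_ca (R := R); have [h11 h12 h21 h22] := has_jet_w C S.
have c (k : R) := @has_jet_cst R 4 k.
have A1 := has_jet_mul p1 (has_jet_add (has_jet_add (has_jet_mul (c u.1.1) h11) (has_jet_mul (c u.1.2) h12)) (has_jet_mul (c u.2) hb)).
have A2 := has_jet_mul p2 (has_jet_add (has_jet_add (has_jet_mul (c u.1.1) h21) (has_jet_mul (c u.1.2) h22)) (has_jet_mul (c u.2) hb')).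
have ic : has_jet (fun x => (2 * cos (th C S x))^-1) (jtab (2 * C)^-1 [:: 0; 0; 0; S / (2 * C ^+ 2)]
   [:: [:: (2 * C)^-1; 0; 0; 0]; [:: 0; - (S ^+ 2 / (2 * C ^+ 3)); 0; 0]; [:: 0; 0; 0; 0]; [:: 0; 0; 0; (2 * C)^-1 + S ^+ 2 / C ^+ 3]]).
  have hv : jv (jmul (jcst 2) (jcomp C (- S) (- C) (th_tab C S t0))) != 0 by rewrite /= mulf_neq0 // pnatr_eq0.
  by by_jet (has_jet_inv hv (has_jet_mul (c 2) has_jet_cos_th)); by field; rewrite ?C1 ?S1.
have is_ : has_jet (fun x => (2 * sin (th C S x))^-1) (jtab (2 * S)^-1 [:: 0; 0; 0; - (C / (2 * S ^+ 2))]
   [:: [:: - (C ^+ 2 / (2 * S ^+ 3)); 0; 0; 0]; [:: 0; (2 * S)^-1; 0; 0]; [:: 0; 0; 0; 0]; [:: 0; 0; 0; (2 * S)^-1 + C ^+ 2 / S ^+ 3]]).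
  have hv : jv (jmul (jcst 2) (jcomp S C (- S) (th_tab C S t0))) != 0 by rewrite /= mulf_neq0 // pnatr_eq0.
  by by_jet (has_jet_inv hv (has_jet_mul (c 2) has_jet_sin_th)); by field; rewrite ?C1 ?S1.
have B1 := has_jet_mul (has_jet_add A1 A2) ic; have B2 := has_jet_mul (has_jet_sub A2 A1) is_.
have B3 := has_jet_mul (c 2) (has_jet_add (has_jet_add (has_jet_mul (c u.1.1) n1) (has_jet_mul (c u.1.2) n2)) (has_jet_mul (c u.2) n3)).
clear A1 A2 ic is_ n1 n2 n3 p1 p2 hb hb' h11 h12 h21 h22 c.
case: u B1 B2 B3 => [[u1 u2] u3] B1 B2 B3; split.
- by by_jet B1; by fld.
- by by_jet B2; by fld.
- apply: (has_jet_ext (f := fun x => 2 * (u1 * (nu1 C S x * eta C S x) + u2 * (nu2 C S x * eta C S x) + u3 * (nu3 C S x * eta C S x)))).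
    by move=> x; rewrite /e3 /=; ring.
  by by_jet B3; by fld.
Qed.

End ThetaTables.

(** * Christoffel symbols and curvature from moving-frame components *)

Section PullbackJets.
Context {R : realType} (C S : R) (C1 : C != 0) (S1 : S != 0).
Local Notation J4 := (@jet2 R 4).

(** Entries below the diagonal are read from above it: symmetry holds by construction, and the
    formulas below involve ten components instead of sixteen. *)
Definition symT {X : Type} (F : 'I_4 -> 'I_4 -> X) (a b : 'I_4) : X :=
  if (a <= b)%N then F a b else F b a.

Definition jsum4 (F : 'I_4 -> J4) : J4 := jadd (jadd (jadd (F o0) (F o1)) (F o2)) (F o3).

(* Jets at the base point of the components, in the chart, of a tensor whose
   components in the moving frame have jets T. *)
Definition jH (T : 'I_4 -> 'I_4 -> J4) (i j : 'I_4) : J4 :=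
  jsum4 (fun a => jsum4 (fun b => jmul (T a b) (jmul (phi_tab C S a i) (phi_tab C S b j)))).

Lemma jH_sym (F : 'I_4 -> 'I_4 -> J4) p q r : jd (jH (symT F) p q) r = jd (jH (symT F) q p) r.
Proof. rewrite /jH /jsum4 /symT /=; ring. Qed.

Lemma jval_jH (F : 'I_4 -> 'I_4 -> J4) p q : jv (jH (symT F) p q) = jv (symT F p q).
Proof.
by move: p q; apply: ord4P; apply: ord4P; rewrite /jH /jsum4 /symT /=; ring.
Qed.

Context (F : 'I_4 -> 'I_4 -> J4).

Ltac frame_case m := move: m; apply: ord4P;
  rewrite /chr1 /jH /jsum4 /symT /= /tab4 /=; field; rewrite ?C1 ?S1.
Ltac frame_lin := rewrite /riem_lin /dchr1 /jH /jsum4 /symT /= /tab4 /=; field; rewrite ?C1 ?S1.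

Lemma chr1_frame02 m : chr1 (jH (symT F)) m o0 o2 = tab4 [:: (1 / 2) * jd (F o0 o0) o2;
  (1 / 2) * jd (F o0 o1) o2 - (1 / 2) * jd (F o0 o2) o1 + (1 / 2) * jd (F o1 o2) o0
    + (1 / 2) * C^-1 * S * jv (F o0 o0) - (1 / 2) * C^-1 * S * jv (F o2 o2)
    + (1 / 2) * C * S^-1 * jv (F o1 o1) - (1 / 2) * C * S^-1 * jv (F o2 o2);
  (1 / 2) * jd (F o2 o2) o0 + C * S^-1 * jv (F o1 o2);
  - (1 / 2) * jd (F o0 o2) o3 + (1 / 2) * jd (F o0 o3) o2 + (1 / 2) * jd (F o2 o3) o0
    - (1 / 2) * C * S^-1 * jv (F o0 o2) + (1 / 2) * C * S^-1 * jv (F o1 o3)] m.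
Proof. by frame_case m. Qed.

Lemma chr1_frame12 m : chr1 (jH (symT F)) m o1 o2 = tab4 [:: (1 / 2) * jd (F o0 o1) o2
  + (1 / 2) * jd (F o0 o2) o1 - (1 / 2) * jd (F o1 o2) o0 - (1 / 2) * C^-1 * S * jv (F o0 o0)
  + (1 / 2) * C^-1 * S * jv (F o2 o2) - (1 / 2) * C * S^-1 * jv (F o1 o1) + (1 / 2) * C * S^-1 * jv (F o2 o2);
  (1 / 2) * jd (F o1 o1) o2;
  (1 / 2) * jd (F o2 o2) o1 - C^-1 * S * jv (F o0 o2);
  - (1 / 2) * jd (F o1 o2) o3 + (1 / 2) * jd (F o1 o3) o2 + (1 / 2) * jd (F o2 o3) o1
    - (1 / 2) * C^-1 * S * jv (F o0 o3) + (1 / 2) * C^-1 * S * jv (F o1 o2)] m.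
Proof. by frame_case m. Qed.

Lemma chr1_frame03 m : chr1 (jH (symT F)) m o0 o3 = tab4 [:: (1 / 2) * jd (F o0 o0) o3;
  (1 / 2) * jd (F o0 o1) o3 - (1 / 2) * jd (F o0 o3) o1 + (1 / 2) * jd (F o1 o3) o0
    - (1 / 2) * C^-1 * S * jv (F o0 o1) - (1 / 2) * C^-1 * S * jv (F o2 o3)
    - (1 / 2) * C * S^-1 * jv (F o0 o1) - (1 / 2) * C * S^-1 * jv (F o2 o3);
  (1 / 2) * jd (F o0 o2) o3 - (1 / 2) * jd (F o0 o3) o2 + (1 / 2) * jd (F o2 o3) o0
    - (1 / 2) * C * S^-1 * jv (F o0 o2) + (1 / 2) * C * S^-1 * jv (F o1 o3);
  (1 / 2) * jd (F o3 o3) o0 - C * S^-1 * jv (F o0 o3)] m.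
Proof. by frame_case m. Qed.

Lemma chr1_frame13 m : chr1 (jH (symT F)) m o1 o3 = tab4 [:: (1 / 2) * jd (F o0 o1) o3
  + (1 / 2) * jd (F o0 o3) o1 - (1 / 2) * jd (F o1 o3) o0 + (1 / 2) * C^-1 * S * jv (F o0 o1)
  + (1 / 2) * C^-1 * S * jv (F o2 o3) + (1 / 2) * C * S^-1 * jv (F o0 o1) + (1 / 2) * C * S^-1 * jv (F o2 o3);
  (1 / 2) * jd (F o1 o1) o3;
  (1 / 2) * jd (F o1 o2) o3 - (1 / 2) * jd (F o1 o3) o2 + (1 / 2) * jd (F o2 o3) o1
    - (1 / 2) * C^-1 * S * jv (F o0 o3) + (1 / 2) * C^-1 * S * jv (F o1 o2);
  (1 / 2) * jd (F o3 o3) o1 + C^-1 * S * jv (F o1 o3)] m.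
Proof. by frame_case m. Qed.

Lemma chr1_frame22 m : chr1 (jH (symT F)) m o2 o2 = tab4 [:: jd (F o0 o2) o2 - (1 / 2) * jd (F o2 o2) o0 - C * S^-1 * jv (F o1 o2);
  jd (F o1 o2) o2 - (1 / 2) * jd (F o2 o2) o1 + C^-1 * S * jv (F o0 o2);
  (1 / 2) * jd (F o2 o2) o2;
  - (1 / 2) * jd (F o2 o2) o3 + jd (F o2 o3) o2] m.
Proof. by frame_case m. Qed.

Lemma chr1_frame23 m : chr1 (jH (symT F)) m o2 o3 = tab4 [:: (1 / 2) * jd (F o0 o2) o3
  + (1 / 2) * jd (F o0 o3) o2 - (1 / 2) * jd (F o2 o3) o0 + (1 / 2) * C * S^-1 * jv (F o0 o2)
  - (1 / 2) * C * S^-1 * jv (F o1 o3);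
  (1 / 2) * jd (F o1 o2) o3 + (1 / 2) * jd (F o1 o3) o2 - (1 / 2) * jd (F o2 o3) o1
    + (1 / 2) * C^-1 * S * jv (F o0 o3) - (1 / 2) * C^-1 * S * jv (F o1 o2);
  (1 / 2) * jd (F o2 o2) o3;
  (1 / 2) * jd (F o3 o3) o2] m.
Proof. by frame_case m. Qed.

Lemma chr1_frame33 m : chr1 (jH (symT F)) m o3 o3 = tab4 [:: jd (F o0 o3) o3 - (1 / 2) * jd (F o3 o3) o0 + C * S^-1 * jv (F o0 o3);
  jd (F o1 o3) o3 - (1 / 2) * jd (F o3 o3) o1 - C^-1 * S * jv (F o1 o3);
  jd (F o2 o3) o3 - (1 / 2) * jd (F o3 o3) o2;
  (1 / 2) * jd (F o3 o3) o3] m.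
Proof. by frame_case m. Qed.

(** Five components of the linear part suffice: four for h^(1), which by pair symmetry give the
    gradient of v^(1), and the component 2323 of h^(2), which enters v^(2) at z = 0. *)
Lemma riem_lin_frame0323 : riem_lin (jH (symT F)) o0 o3 o2 o3 =
  (1 / 2) * jv (F o0 o2) - (1 / 2) * jh (F o0 o2) o3 o3 + (1 / 2) * jh (F o0 o3) o2 o3
    - (1 / 2) * jv (F o1 o3) - (1 / 2) * jh (F o2 o3) o0 o3 + jh (F o2 o3) o3 o0
    - (1 / 2) * jh (F o3 o3) o2 o0 - (1 / 2) * C * S^-1 * jd (F o0 o2) o3 + C * S^-1 * jd (F o0 o3) o2
    + (1 / 2) * C * S^-1 * jd (F o1 o3) o3 + (1 / 2) * C ^+ 2 * S ^- 2 * jv (F o0 o2)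
    - (1 / 2) * C ^+ 2 * S ^- 2 * jv (F o1 o3).
Proof. by frame_lin. Qed.

Lemma riem_lin_frame2123 : riem_lin (jH (symT F)) o2 o1 o2 o3 =
  jv (F o0 o2) + (1 / 2) * jh (F o1 o2) o3 o2 - (1 / 2) * jh (F o1 o3) o2 o2 - (1 / 2) * jh (F o2 o2) o3 o1
    + (1 / 2) * jh (F o2 o3) o1 o2 + C ^- 2 * S ^+ 2 * jv (F o0 o2) + C^-1 * S * jd (F o0 o2) o3
    - (1 / 2) * C^-1 * S * jd (F o0 o3) o2 + (1 / 2) * C^-1 * S * jd (F o1 o2) o2.
Proof. by frame_lin. Qed.

Lemma riem_lin_frame1323 : riem_lin (jH (symT F)) o1 o3 o2 o3 =
  - (1 / 2) * jv (F o0 o3) + (1 / 2) * jv (F o1 o2) - (1 / 2) * jh (F o1 o2) o3 o3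
    + (1 / 2) * jh (F o1 o3) o2 o3 - (1 / 2) * jh (F o2 o3) o1 o3 + jh (F o2 o3) o3 o1
    - (1 / 2) * jh (F o3 o3) o2 o1 - (1 / 2) * C ^- 2 * S ^+ 2 * jv (F o0 o3)
    + (1 / 2) * C ^- 2 * S ^+ 2 * jv (F o1 o2) - (1 / 2) * C^-1 * S * jd (F o0 o3) o3
    + (1 / 2) * C^-1 * S * jd (F o1 o2) o3 - C^-1 * S * jd (F o1 o3) o2.
Proof. by frame_lin. Qed.

Lemma riem_lin_frame2023 : riem_lin (jH (symT F)) o2 o0 o2 o3 =
  (1 / 2) * jh (F o0 o2) o3 o2 - (1 / 2) * jh (F o0 o3) o2 o2 + jv (F o1 o2) - (1 / 2) * jh (F o2 o2) o3 o0
    + (1 / 2) * jh (F o2 o3) o0 o2 - (1 / 2) * C * S^-1 * jd (F o0 o2) o2 - C * S^-1 * jd (F o1 o2) o3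
    + (1 / 2) * C * S^-1 * jd (F o1 o3) o2 + C ^+ 2 * S ^- 2 * jv (F o1 o2).
Proof. by frame_lin. Qed.

Lemma riem_lin_frame2323 : riem_lin (jH (symT F)) o2 o3 o2 o3 =
  - (1 / 2) * jh (F o2 o2) o3 o3 + jh (F o2 o3) o3 o2 - (1 / 2) * jh (F o3 o3) o2 o2.
Proof. by frame_lin. Qed.
End PullbackJets.

(** * Components in the moving frame *)

Section FrameTensors.
Context {R : realType}.
Implicit Types (X Y Z : R * R * R) (a b : 'I_4) (V W : R3xR3 R).

Section Components.
Context (c s A B : R).

(* Components of K_u, J_u, K_{p1+p2}, K_{p2-p1} as one-forms in the moving
   frame, where u is given by its coordinates in q1, q2, q3. *)
Definition kv (u : R * R * R) := tab4 [:: A * (s * u.1.1); B * (c * u.1.2); 3^-1 * u.2; 0].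
Definition jv_ (u : R * R * R) := tab4 [:: A * (c * u.1.2); B * (s * u.1.1); 0; - u.2].
Definition ksp := tab4 [:: A * (s * (2 * c)); 0; 0; 0].
Definition ksm := tab4 [:: 0; B * (c * (2 * s)); 0; 0].
Definition odv (u v : 'I_4 -> R) a b := (u a * v b + v a * u b) * 2^-1.
Definition c2 := 2 * (c * c) + -1.
Definition c4 := 2 * (c2 * c2) + -1.

Definition T0v := fun a b => tab4 (nth [::] [:: [:: A; 0; 0; 0]; [:: 0; B; 0; 0]; [:: 0; 0; 3^-1; 0]; [:: 0; 0; 0; 1]] a) b.

(** Differences are written as sums with coefficient [-1], so that [jT1] can copy the expression
    operation by operation. *)
Definition T1v (lc ld : R) X Y Z a b :=
  6 / 5 * (2 + -1 * c2) * odv ksp (kv X) a b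
  + -2 * ((1 + -1 * c2) * (2 + c2)) * odv ksm (jv_ X) a b
  + 6 / 5 * (2 + c2) * odv ksm (kv Y) a b
  + -2 * ((1 + c2) * (2 + -1 * c2)) * odv ksp (jv_ Y) a b
  + lc * odv (kv Z) (kv Z) a b + ld * odv (kv X) (jv_ Z) a b.

Definition gK (u : R * R * R) := A * (s * u.1.1 * (s * u.1.1)) + B * (c * u.1.2 * (c * u.1.2)) + 3^-1 * (u.2 * u.2).
Definition gJ (u : R * R * R) := A * (c * u.1.2 * (c * u.1.2)) + B * (s * u.1.1 * (s * u.1.1)) + u.2 * u.2.

(** Here [fa], [fb], [fg] stand for f_aa, f_bb and G(sin(2 theta)/sqrt 3), whose jets are found
    separately, and [A * B] is 1/(4 - cos(2 theta)^2). *)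
Definition T2v (fa fb fg lc ld : R) X Y Z a b :=
  9 * fa * odv (kv X) (kv X) a b + 9 * fb * odv (kv Y) (kv Y) a b
  + lc ^+ 2 * gK Z * odv (kv Z) (kv Z) a b
  + lc / 10 * (2 * (c * Z.1.1)) * (-5 + -14 * c2 + 3 * c4) * odv (kv X) (kv Z) a b
  + lc / 10 * (2 * (s * Z.1.2)) * (-5 + 14 * c2 + 3 * c4) * odv (kv Y) (kv Z) a b
  + ld ^+ 2 / 12 * gJ X * odv (jv_ Z) (jv_ Z) a b
  + ld * (9 / 40) * (2 * (s * X.1.2)) * (- (406 / 45) + - (92 / 45) * c2 + 2 / 5 * c4) * odv (kv X) (kv Z) a b
  + 9 * ld * (2 * (s * Z.1.2)) * (- (823 / 900) + 77 / 450 * c2 + 1 / 100 * c4) * odv (kv X) (kv X) a b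
  + ld * (9 / 40) * (2 * (c * X.1.1)) * (- (406 / 45) + 92 / 45 * c2 + 2 / 5 * c4) * odv (kv Y) (kv Z) a b
  + 9 * ld * (2 * (c * Z.1.1)) * (- (823 / 900) + - (77 / 450) * c2 + 1 / 100 * c4) * odv (kv X) (kv Y) a b
  + - (lc * ld / 4) * (2 * (c * Z.1.1) * (2 * (s * X.1.2)) + 2 * (c * X.1.1) * (2 * (s * Z.1.2))) * fg * odv (kv Z) (kv Z) a b
  + lc * ld * (2 * (c * Z.1.1) * (2 * (s * Z.1.2))) * (A * B) * odv (kv X) (kv Z) a b.

End Components.

Section AtPoint.
Context (p : R3xR3 R) (hp : M_nondeg p).
Local Notation c := (cos (theta p)).
Local Notation s := (sin (theta p)).
Local Notation A := ((2 - cos (2 * theta p))^-1).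
Local Notation B := ((2 + cos (2 * theta p))^-1).
Definition qcoord (u : 'rV[R]_3) : R * R * R := (dot u (q1 p), dot u (q2 p), dot u (q3 p)).

Definition tens (T : 'I_4 -> 'I_4 -> R) (V W : R3xR3 R) :=
  \sum_a \sum_b T a b * (coef p a V * coef p b W).

Lemma Kflat_kv u V : Kflat u p V = \sum_a kv c s A B (qcoord u) a * coef p a V.
Proof. rewrite KflatE // sum4 /kv /tab4 /=; ring. Qed.

Lemma Jflat_jv u V : Jflat u p V = \sum_a jv_ c s A B (qcoord u) a * coef p a V.
Proof. rewrite JflatE // sum4 /jv_ /tab4 /=; ring. Qed.

Lemma Kflat_sp V : Kflat (p.1 + p.2) p V = \sum_a ksp c s A a * coef p a V.
Proof.
have [[e1 e2 e3] _] := dot_sum_q hp.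
rewrite KflatE // e1 e2 e3 sum4 /ksp /tab4 /=; ring.
Qed.

Lemma Kflat_sm V : Kflat (p.2 - p.1) p V = \sum_a ksm c s B a * coef p a V.
Proof.
have [_ [e1 e2 e3]] := dot_sum_q hp.
rewrite KflatE // e1 e2 e3 sum4 /ksm /tab4 /=; ring.
Qed.

Lemma odot_tens (f g : 'I_4 -> R) (af ag : R3xR3 R -> R) V W :
  (forall V, af V = \sum_a f a * coef p a V) -> (forall V, ag V = \sum_a g a * coef p a V) ->
  odot af ag V W = tens (odv f g) V W.
Proof.
move=> hf hg; rewrite /odot !hf !hg /tens /odv !big_distrlr /= -big_split /= mulr_suml.
apply: eq_bigr => a _; rewrite -big_split /= mulr_suml; apply: eq_bigr => b _; ring.
Qed.

Lemma tensD T T' V W : tens T V W + tens T' V W = tens (fun a b => T a b + T' a b) V W.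
Proof.
rewrite /tens -big_split; apply: eq_bigr => a _ /=; rewrite -big_split; apply: eq_bigr => b _ /=.
by rewrite mulrDl.
Qed.

Lemma tensZ k T V W : k * tens T V W = tens (fun a b => k * T a b) V W.
Proof.
rewrite /tens mulr_sumr; apply: eq_bigr => a _; rewrite mulr_sumr; apply: eq_bigr => b _.
by rewrite mulrA.
Qed.

Lemma eq_tens T T' V W : (forall a b, T a b = T' a b) -> tens T V W = tens T' V W.
Proof. by move=> h; apply: eq_bigr => a _; apply: eq_bigr => b _; rewrite h. Qed.

Lemma g_tens V W : g p V W = tens (T0v A B) V W.
Proof. rewrite gE /tens !sum4 /T0v /tab4 /=; ring. Qed.

Lemma gKK u : g p (K u p) (K u p) = gK c s A B (qcoord u).
Proof. by rewrite gE; have [-> -> -> ->] := coef_K u hp; rewrite /gK /=; ring. Qed.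

Lemma gJJ u : g p (J u p) (J u p) = gJ c s A B (qcoord u).
Proof. by rewrite gE; have [-> -> -> ->] := coef_J u hp; rewrite /gJ /=; ring. Qed.

Let c2E : cos (2 * theta p) = c2 c. Proof. by rewrite cos2_theta /c2; ring. Qed.
Let c4E : cos (4%:R * theta p) = c4 c.
Proof.
rewrite (_ : 4%:R * theta p = (2 * theta p) *+ 2); last by ring.
by rewrite cos_mulr2n c2E /c4 mulr2n; ring.
Qed.

Lemma h1_tens lc ld V W : h1 lc ld p V W =
  tens (T1v c s A B lc ld (qcoord e_x) (qcoord e_y) (qcoord e_z)) V W.
Proof.
rewrite /h1 /h1a /h1b /h1c /h1d.
rewrite !(odot_tens _ _ Kflat_sp (Kflat_kv _)) !(odot_tens _ _ Kflat_sm (Kflat_kv _))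
  !(odot_tens _ _ Kflat_sp (Jflat_jv _)) !(odot_tens _ _ Kflat_sm (Jflat_jv _))
  !(odot_tens _ _ (Kflat_kv _) (Kflat_kv _)) !(odot_tens _ _ (Kflat_kv _) (Jflat_jv _)).
rewrite -!mulNr !tensZ !tensD; apply: eq_tens => a b.
rewrite /T1v /ck c2E; ring.
Qed.

Lemma h2_tens lc ld V W : h2 lc ld p V W =
  tens (T2v c s A B (faa p) (fbb p) (G (sin (2 * theta p) / Num.sqrt 3)) lc ld
    (qcoord e_x) (qcoord e_y) (qcoord e_z)) V W.
Proof.
set fa := faa p; set fb := fbb p; set fg := G _.
have [d1 d2] := dot_sum_e e_z hp; have [d3 d4] := dot_sum_e e_x hp.
transitivity (
    9 * fa * tens (odv (kv c s A B (qcoord e_x)) (kv c s A B (qcoord e_x))) V W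
    + 9 * fb * tens (odv (kv c s A B (qcoord e_y)) (kv c s A B (qcoord e_y))) V W
    + lc ^+ 2 * gK c s A B (qcoord e_z) * tens (odv (kv c s A B (qcoord e_z)) (kv c s A B (qcoord e_z))) V W
    + lc / 10 * (2 * (c * (qcoord e_z).1.1)) * (-5 + -14 * c2 c + 3 * c4 c) * tens (odv (kv c s A B (qcoord e_x)) (kv c s A B (qcoord e_z))) V W
    + lc / 10 * (2 * (s * (qcoord e_z).1.2)) * (-5 + 14 * c2 c + 3 * c4 c) * tens (odv (kv c s A B (qcoord e_y)) (kv c s A B (qcoord e_z))) V W
    + ld ^+ 2 / 12 * gJ c s A B (qcoord e_x) * tens (odv (jv_ c s A B (qcoord e_z)) (jv_ c s A B (qcoord e_z))) V W
    + ld * (9 / 40) * (2 * (s * (qcoord e_x).1.2)) * (- (406 / 45) + - (92 / 45) * c2 c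
      + 2 / 5 * c4 c) * tens (odv (kv c s A B (qcoord e_x)) (kv c s A B (qcoord e_z))) V W
    + 9 * ld * (2 * (s * (qcoord e_z).1.2)) * (- (823 / 900) + 77 / 450 * c2 c
      + 1 / 100 * c4 c) * tens (odv (kv c s A B (qcoord e_x)) (kv c s A B (qcoord e_x))) V W
    + ld * (9 / 40) * (2 * (c * (qcoord e_x).1.1)) * (- (406 / 45) + 92 / 45 * c2 c
      + 2 / 5 * c4 c) * tens (odv (kv c s A B (qcoord e_y)) (kv c s A B (qcoord e_z))) V W
    + 9 * ld * (2 * (c * (qcoord e_z).1.1)) * (- (823 / 900) + - (77 / 450) * c2 c
      + 1 / 100 * c4 c) * tens (odv (kv c s A B (qcoord e_x)) (kv c s A B (qcoord e_y))) V W
    + - (lc * ld / 4) * (2 * (c * (qcoord e_z).1.1) * (2 * (s * (qcoord e_x).1.2))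
      + 2 * (c * (qcoord e_x).1.1) * (2 * (s * (qcoord e_z).1.2))) * fg * tens (odv (kv c s A B (qcoord e_z))
      (kv c s A B (qcoord e_z))) V W
    + lc * ld * (2 * (c * (qcoord e_z).1.1) * (2 * (s * (qcoord e_z).1.2))) * (A * B) * tens (odv (kv c s A B
      (qcoord e_x)) (kv c s A B (qcoord e_z))) V W).
  rewrite /h2 /h2aa /h2bb /h2ab /h2cc /h2ac /h2bc /h2dd /h2ad /h2bd /h2cd gKK gJJ d1 d2 d3 d4.
  rewrite !(odot_tens _ _ (Kflat_kv _) (Kflat_kv _)) !(odot_tens _ _ (Jflat_jv _) (Jflat_jv _)).
  rewrite -/fa -/fb -/fg /ck c2E c4E.
  have A0 : 2 - c2 c != 0 by rewrite -c2E gt_eqF // subr_gt0 (le_lt_trans (cos_le1 _)) // ltr1n.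
  have B0 : 2 + c2 c != 0.
    by rewrite -c2E gt_eqF // -ltrBlDl sub0r (lt_le_trans _ (cos_geN1 _)) // ltrN2 ltr1n.
  have D0 : 4 - c2 c ^+ 2 != 0.
    by rewrite (_ : 4 - c2 c ^+ 2 = (2 - c2 c) * (2 + c2 c)) ?mulf_neq0 //; ring.
  (* All tensor values become plain real variables, so that [field] compares only their scalar
     coefficients. *)
  move: fa fb fg (gK _ _ _ _ _) (gJ _ _ _ _ _) => fa' fb' fg' gk gj.
  move: (tens (odv (kv _ _ _ _ (qcoord e_x)) (kv _ _ _ _ (qcoord e_x))) V W) => o1'.
  move: (tens (odv (kv _ _ _ _ (qcoord e_y)) (kv _ _ _ _ (qcoord e_y))) V W) => o2'.
  move: (tens (odv (kv _ _ _ _ (qcoord e_z)) (kv _ _ _ _ (qcoord e_z))) V W) => o3'.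
  move: (tens (odv (kv _ _ _ _ (qcoord e_x)) (kv _ _ _ _ (qcoord e_z))) V W) => o4'.
  move: (tens (odv (kv _ _ _ _ (qcoord e_y)) (kv _ _ _ _ (qcoord e_z))) V W) => o5'.
  move: (tens (odv (kv _ _ _ _ (qcoord e_x)) (kv _ _ _ _ (qcoord e_y))) V W) => o6'.
  move: (tens (odv (jv_ _ _ _ _ (qcoord e_z)) (jv_ _ _ _ _ (qcoord e_z))) V W) => o7'.
  rewrite /qcoord /fst /snd.
  move: (dot e_z (q1 p)) (dot e_z (q2 p)) (dot e_x (q1 p)) (dot e_x (q2 p)) => z1 z2 x1 x2.
  move: A0 B0 D0; move: (cos (theta p)) (sin (theta p)) (c2 c) (c4 c) => c s k k4 A0 B0 D0.
  by field; rewrite A0 B0 D0.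
by rewrite !tensZ !tensD; apply: eq_tens => a b; rewrite /T2v.
Qed.

End AtPoint.
End FrameTensors.

(** * Symmetric Hessians and the pair symmetry of the curvature *)

Section SymmetricJets.
Context {R : realType}.
Local Notation J4 := (@jet2 R 4).
Implicit Types (K L : J4).

(** The clauses of [has_jet] do not force mixed derivatives to commute. Symmetry is instead
    propagated through the jet operations from the tables. *)
Definition jsym K := forall r s, jh K r s = jh K s r.

Lemma jsym_cst k : jsym (jcst k). Proof. by []. Qed.
Lemma jsym_add K L : jsym K -> jsym L -> jsym (jadd K L).
Proof. by move=> hK hL r s /=; rewrite hK hL. Qed.
Lemma jsym_mul K L : jsym K -> jsym L -> jsym (jmul K L).
Proof. by move=> hK hL r s /=; rewrite (hK r s) (hL r s); ring. Qed.
Lemma jsym_comp f0 f1 f2 K : jsym K -> jsym (jcomp f0 f1 f2 K).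
Proof. by move=> hK r s /=; rewrite (hK r s); ring. Qed.

Lemma jsym_phi (C S : R) a i : jsym (phi_tab C S a i).
Proof.
by move: a i; apply: ord4P; apply: ord4P; rewrite /phi_tab; apply: ord4P; apply: ord4P.
Qed.

Lemma jsym_e (C S : R) u : [/\ jsym (e1_tab C S u), jsym (e2_tab C S u) & jsym (e3_tab C S u)].
Proof. by case: u => [[u1 u2] u3]; split; apply: ord4P; apply: ord4P. Qed.

Lemma jsym_th (C S t0 : R) : jsym (th_tab C S t0).
Proof. by apply: ord4P; apply: ord4P. Qed.

Lemma jsym_jH (C S : R) (T : 'I_4 -> 'I_4 -> J4) i j : (forall a b, jsym (T a b)) ->
  jsym (jH C S T i j).
Proof.
move=> h; have q a b : jsym (jmul (T a b) (jmul (phi_tab C S a i) (phi_tab C S b j))).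
  by apply: jsym_mul => //; apply: jsym_mul; exact: jsym_phi.
by rewrite /jH /jsum4; repeat apply: jsym_add.
Qed.

Lemma jH_symh (C S : R) (F : 'I_4 -> 'I_4 -> J4) p q r s :
  jh (jH C S (symT F) p q) r s = jh (jH C S (symT F) q p) r s.
Proof. rewrite /jH /jsum4 /symT /=; ring. Qed.

Context (a : 'I_4 -> 'I_4 -> J4).
Context (ad : forall p q r, jd (a p q) r = jd (a q p) r).
Context (ah : forall p q r s, jh (a p q) r s = jh (a q p) r s).
Context (as_ : forall p q r s, jh (a p q) r s = jh (a p q) s r).

Lemma chr1C l i j : chr1 a l i j = chr1 a l j i.
Proof. by rewrite /chr1 (ad i j); ring. Qed.

Lemma riem_lin_pair i j k l : riem_lin a i j k l = riem_lin a k l i j.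
Proof.
rewrite /riem_lin /dchr1 (as_ l k i j) (as_ j i k l) (ah k j) (ah l i) (ah k i) (ah l j).
rewrite (as_ j k i l) (as_ i l j k) (as_ j l i k) (as_ i k j l); ring.
Qed.

Lemma riem_lin_diag i k l : riem_lin a i i k l = 0.
Proof. by rewrite /riem_lin subrr. Qed.

End SymmetricJets.

(** * Jets of the moving-frame components *)

Section ComponentJets.
Context {R : realType}.
Local Notation U := 'rV[R]_4.
Local Notation J4 := (@jet2 R 4).
Local Notation "a +j b" := (jadd a b) (at level 50, left associativity).
Local Notation "a *j b" := (jmul a b) (at level 40, left associativity).
Local Notation "k %:j" := (jcst k) (at level 2, format "k %:j").

Section Defs.
Context (c s A B : J4).
Implicit Types (u X Y Z : J4 * J4 * J4).

Definition jtab4 (l : seq J4) (a : 'I_4) : J4 := nth (jcst 0) l a.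
Definition jkv u := jtab4 [:: A *j (s *j u.1.1); B *j (c *j u.1.2); 3^-1%:j *j u.2; 0%:j].
Definition jjv u := jtab4 [:: A *j (c *j u.1.2); B *j (s *j u.1.1); 0%:j; (-1)%:j *j u.2].
Definition jksp := jtab4 [:: A *j (s *j (2%:j *j c)); 0%:j; 0%:j; 0%:j].
Definition jksm := jtab4 [:: 0%:j; B *j (c *j (2%:j *j s)); 0%:j; 0%:j].
Definition jodv (u v : 'I_4 -> J4) a b := (u a *j v b +j v a *j u b) *j 2^-1%:j.
Definition jc2 := 2%:j *j (c *j c) +j (-1)%:j.
Definition jc4 := 2%:j *j (jc2 *j jc2) +j (-1)%:j.

Definition jT0 (a b : 'I_4) := nth (jcst 0) (nth [::] [:: [:: A; 0%:j; 0%:j; 0%:j]; [:: 0%:j; B; 0%:j; 0%:j];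
  [:: 0%:j; 0%:j; 3^-1%:j; 0%:j]; [:: 0%:j; 0%:j; 0%:j; 1%:j]] a) b.

Definition jT1 (lc ld : R) X Y Z a b :=
  (6 / 5)%:j *j (2%:j +j (-1)%:j *j jc2) *j jodv jksp (jkv X) a b
  +j (-2)%:j *j ((1%:j +j (-1)%:j *j jc2) *j (2%:j +j jc2)) *j jodv jksm (jjv X) a b
  +j (6 / 5)%:j *j (2%:j +j jc2) *j jodv jksm (jkv Y) a b
  +j (-2)%:j *j ((1%:j +j jc2) *j (2%:j +j (-1)%:j *j jc2)) *j jodv jksp (jjv Y) a b
  +j lc%:j *j jodv (jkv Z) (jkv Z) a b +j ld%:j *j jodv (jkv X) (jjv Z) a b.

Definition jgK u := A *j (s *j u.1.1 *j (s *j u.1.1)) +j B *j (c *j u.1.2 *j (c *j u.1.2)) +j 3^-1%:j *j (u.2 *j u.2).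
Definition jgJ u := A *j (c *j u.1.2 *j (c *j u.1.2)) +j B *j (s *j u.1.1 *j (s *j u.1.1)) +j u.2 *j u.2.

Definition jT2 (fa fb fg : J4) (lc ld : R) X Y Z a b :=
  9%:j *j fa *j jodv (jkv X) (jkv X) a b +j 9%:j *j fb *j jodv (jkv Y) (jkv Y) a b
  +j (lc ^+ 2)%:j *j jgK Z *j jodv (jkv Z) (jkv Z) a b
  +j (lc / 10)%:j *j (2%:j *j (c *j Z.1.1)) *j ((-5)%:j +j (-14)%:j *j jc2 +j 3%:j *j jc4) *j jodv (jkv X) (jkv Z) a b
  +j (lc / 10)%:j *j (2%:j *j (s *j Z.1.2)) *j ((-5)%:j +j 14%:j *j jc2 +j 3%:j *j jc4) *j jodv (jkv Y) (jkv Z) a b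
  +j (ld ^+ 2 / 12)%:j *j jgJ X *j jodv (jjv Z) (jjv Z) a b
  +j (ld * (9 / 40))%:j *j (2%:j *j (s *j X.1.2)) *j ((- (406 / 45))%:j +j (- (92 / 45))%:j *j jc2 +j (2 / 5)%:j *j jc4) *j jodv (jkv X) (jkv Z) a b
  +j (9 * ld)%:j *j (2%:j *j (s *j Z.1.2)) *j ((- (823 / 900))%:j +j (77 / 450)%:j *j jc2 +j (1 / 100)%:j *j jc4) *j jodv (jkv X) (jkv X) a b
  +j (ld * (9 / 40))%:j *j (2%:j *j (c *j X.1.1)) *j ((- (406 / 45))%:j +j (92 / 45)%:j *j jc2 +j (2 / 5)%:j *j jc4) *j jodv (jkv Y) (jkv Z) a b
  +j (9 * ld)%:j *j (2%:j *j (c *j Z.1.1)) *j ((- (823 / 900))%:j +j (- (77 / 450))%:j *j jc2 +j (1 / 100)%:j *j jc4) *j jodv (jkv X) (jkv Y) a b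
  +j (- (lc * ld / 4))%:j *j (2%:j *j (c *j Z.1.1) *j (2%:j *j (s *j X.1.2)) +j 2%:j *j (c *j X.1.1) *j (2%:j
    *j (s *j Z.1.2))) *j fg *j jodv (jkv Z) (jkv Z) a b
  +j (lc * ld)%:j *j (2%:j *j (c *j Z.1.1) *j (2%:j *j (s *j Z.1.2))) *j (A *j B) *j jodv (jkv X) (jkv Z) a b.

End Defs.

Context (c s A B fa fb fg : U -> R) (jc js jA jB jfa jfb jfg : J4).
Context (hc : has_jet c jc) (hs : has_jet s js) (hA : has_jet A jA) (hB : has_jet B jB)
  (hfa : has_jet fa jfa) (hfb : has_jet fb jfb) (hfg : has_jet fg jfg).
Context (X Y Z : U -> R * R * R) (jX jY jZ : J4 * J4 * J4).

Definition has_jet3 (u : U -> R * R * R) (ju : J4 * J4 * J4) :=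
  [/\ has_jet (fun x => (u x).1.1) ju.1.1, has_jet (fun x => (u x).1.2) ju.1.2 &
      has_jet (fun x => (u x).2) ju.2].

Context (hX : has_jet3 X jX) (hY : has_jet3 Y jY) (hZ : has_jet3 Z jZ).

Ltac jets := repeat first [assumption | exact: has_jet_cst | apply: has_jet_add | apply: has_jet_mul].

Lemma has_jet_kv u ju a : has_jet3 u ju ->
  has_jet (fun x => kv (c x) (s x) (A x) (B x) (u x) a) (jkv jc js jA jB ju a).
Proof.
by move=> [h1 h2 h3]; move: a; apply: ord4P; rewrite /kv /jkv /tab4 /jtab4 [nth _ _ _]/=; jets.
Qed.

Lemma has_jet_jv u ju a : has_jet3 u ju ->
  has_jet (fun x => jv_ (c x) (s x) (A x) (B x) (u x) a) (jjv jc js jA jB ju a).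
Proof.
move=> [h1 h2 h3]; move: a; apply: ord4P; rewrite /jv_ /jjv /tab4 /jtab4 [nth _ _ _]/=; try by jets.
exact: has_jet_opp.
Qed.

Lemma has_jet_ksp a : has_jet (fun x => ksp (c x) (s x) (A x) a) (jksp jc js jA a).
Proof. by move: a; apply: ord4P; rewrite /ksp /jksp /tab4 /jtab4 [nth _ _ _]/=; jets. Qed.

Lemma has_jet_ksm a : has_jet (fun x => ksm (c x) (s x) (B x) a) (jksm jc js jB a).
Proof. by move: a; apply: ord4P; rewrite /ksm /jksm /tab4 /jtab4 [nth _ _ _]/=; jets. Qed.

Lemma has_jet_odv (u v : U -> 'I_4 -> R) ju jv a b : (forall a, has_jet (fun x => u x a) (ju a)) ->
  (forall a, has_jet (fun x => v x a) (jv a)) ->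
  has_jet (fun x => odv (u x) (v x) a b) (jodv ju jv a b).
Proof. by move=> h1 h2; rewrite /odv /jodv; jets. Qed.

Lemma has_jet_c2 : has_jet (fun x => c2 (c x)) (jc2 jc).
Proof. by rewrite /c2 /jc2; jets. Qed.

Lemma has_jet_c4 : has_jet (fun x => c4 (c x)) (jc4 jc).
Proof. by have h := has_jet_c2; rewrite /c4 /jc4; jets. Qed.

Lemma has_jet_T0 a b : has_jet (fun x => T0v (A x) (B x) a b) (jT0 jA jB a b).
Proof.
by move: a b; apply: ord4P; apply: ord4P; rewrite /T0v /jT0 /tab4 [nth _ _ _]/=; jets.
Qed.

Lemma has_jet_T1 lc ld a b :
  has_jet (fun x => T1v (c x) (s x) (A x) (B x) lc ld (X x) (Y x) (Z x) a b) (jT1 jc js jA jB lc ld jX jY jZ a b).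
Proof.
have h2 := has_jet_c2.
have o1 := has_jet_odv a b has_jet_ksp (fun a => has_jet_kv a hX).
have o2 := has_jet_odv a b has_jet_ksm (fun a => has_jet_jv a hX).
have o3 := has_jet_odv a b has_jet_ksm (fun a => has_jet_kv a hY).
have o4 := has_jet_odv a b has_jet_ksp (fun a => has_jet_jv a hY).
have o5 := has_jet_odv a b (fun a => has_jet_kv a hZ) (fun a => has_jet_kv a hZ).
have o6 := has_jet_odv a b (fun a => has_jet_kv a hX) (fun a => has_jet_jv a hZ).
by rewrite /T1v /jT1; jets.
Qed.

Lemma has_jet_gK u ju : has_jet3 u ju -> has_jet (fun x => gK (c x) (s x) (A x) (B x) (u x)) (jgK jc js jA jB ju).
Proof. by move=> [h1 h2 h3]; rewrite /gK /jgK; jets. Qed.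

Lemma has_jet_gJ u ju : has_jet3 u ju -> has_jet (fun x => gJ (c x) (s x) (A x) (B x) (u x)) (jgJ jc js jA jB ju).
Proof. by move=> [h1 h2 h3]; rewrite /gJ /jgJ; jets. Qed.

Lemma has_jet_T2 lc ld a b :
  has_jet (fun x => T2v (c x) (s x) (A x) (B x) (fa x) (fb x) (fg x) lc ld (X x) (Y x) (Z x) a b)
    (jT2 jc js jA jB jfa jfb jfg lc ld jX jY jZ a b).
Proof.
have h2 := has_jet_c2; have h4 := has_jet_c4; have hK := has_jet_gK hZ; have hJ := has_jet_gJ hX.
have kX a := has_jet_kv a hX; have kY a := has_jet_kv a hY; have kZ a := has_jet_kv a hZ.
have jZ' a := has_jet_jv a hZ.
have o1 := has_jet_odv a b kX kX; have o2 := has_jet_odv a b kY kY; have o3 := has_jet_odv a b kZ kZ.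
have o4 := has_jet_odv a b kX kZ; have o5 := has_jet_odv a b kY kZ; have o6 := has_jet_odv a b kX kY.
have o7 := has_jet_odv a b jZ' jZ'.
have [x1 x2 x3] := hX; have [z1 z2 z3] := hZ.
by rewrite /T2v /jT2; jets.
Qed.

End ComponentJets.

(** * Closed forms at the base point *)

Section ClosedForms.
Context {R : realType} (C S t0 : R).
Context (CS : S ^+ 2 = 1 - C ^+ 2) (C0 : 0 < C) (S0 : 0 < S).
Local Notation J4 := (@jet2 R 4).
Let C1 : C != 0 := lt0r_neq0 C0.
Let S1 : S != 0 := lt0r_neq0 S0.

(* With C = cos theta: P = 2 - cos 2theta and M = 2 + cos 2theta. *)
Local Notation P := (3 - 2 * C ^+ 2).
Local Notation M := (1 + 2 * C ^+ 2).

Lemma P_gt0 : 0 < P.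
Proof. by have h1 := exprn_gt0 2 S0; move: CS h1 => ? ?; lra. Qed.
Lemma M_gt0 : 0 < M.
Proof. by have h1 := exprn_gt0 2 C0; move: h1 => ?; lra. Qed.
Let P1 : P != 0 := lt0r_neq0 P_gt0.
Let M1 : M != 0 := lt0r_neq0 M_gt0.

(** Jet of a function of theta alone, from its value and first two derivatives at the base point. *)
Definition tjet (f0 f1 f2 : R) : J4 := jcomp f0 f1 f2 (th_tab C S t0).
Definition bc := tjet C (- S) (- C).
Definition bs := tjet S C (- S).
Definition bA := tjet P^-1 (- (4 * S * C) / P ^+ 2)
  (- (4 * (2 * C ^+ 2 - 1)) / P ^+ 2 + 32 * S ^+ 2 * C ^+ 2 / P ^+ 3).
Definition bB := tjet M^-1 (4 * S * C / M ^+ 2)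
  (4 * (2 * C ^+ 2 - 1) / M ^+ 2 + 32 * S ^+ 2 * C ^+ 2 / M ^+ 3).
Definition be (u : R * R * R) : J4 * J4 * J4 := (e1_tab C S u, e2_tab C S u, e3_tab C S u).

Definition H0jet := jH C S (symT (jT0 bA bB)).

Ltac fld := field: CS; rewrite ?C1 ?S1 ?P1 ?M1.

Lemma chr1_H0_02 m : chr1 H0jet m o0 o2 = tab4 [:: 0; 4 * C * S / (3 * P * M); 0; 0] m.
Proof.
rewrite chr1_frame02 //; move: m; apply: ord4P; rewrite /tab4 /jT0 /= /tab4 /=; by fld.
Qed.
Lemma chr1_H0_12 m : chr1 H0jet m o1 o2 = tab4 [:: - (4 * C * S / (3 * P * M)); 0; 0; 0] m.
Proof. rewrite chr1_frame12 //; move: m; apply: ord4P; rewrite /tab4 /jT0 /= /tab4 /=; by fld. Qed.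
Lemma chr1_H0_03 m : chr1 H0jet m o0 o3 = tab4 [:: - (2 * C * S / P ^+ 2); 0; 0; 0] m.
Proof. rewrite chr1_frame03 //; move: m; apply: ord4P; rewrite /tab4 /jT0 /= /tab4 /=; by fld. Qed.
Lemma chr1_H0_13 m : chr1 H0jet m o1 o3 = tab4 [:: 0; 2 * C * S / M ^+ 2; 0; 0] m.
Proof. rewrite chr1_frame13 //; move: m; apply: ord4P; rewrite /tab4 /jT0 /= /tab4 /=; by fld. Qed.
(** The vanishing for the pairs 22, 23 and 33 has a geometric reason. Reflection in the plane of the
    two points is an isometry of g fixing the torus of pairs on their great circle, and on this
    torus g is flat with the chart coordinates linear up to third order. *)
Lemma chr1_H0_22 m : chr1 H0jet m o2 o2 = 0.
Proof. rewrite chr1_frame22 //; move: m; apply: ord4P; rewrite /tab4 /jT0 /= /tab4 /=; by fld. Qed.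
Lemma chr1_H0_23 m : chr1 H0jet m o2 o3 = 0.
Proof. rewrite chr1_frame23 //; move: m; apply: ord4P; rewrite /tab4 /jT0 /= /tab4 /=; by fld. Qed.
Lemma chr1_H0_33 m : chr1 H0jet m o3 o3 = 0.
Proof. rewrite chr1_frame33 //; move: m; apply: ord4P; rewrite /tab4 /jT0 /= /tab4 /=; by fld. Qed.

Local Notation k := (2 * C ^+ 2 - 1).

Section H1.
Context (lc ld x1 x2 x3 y1 y2 y3 z1 z2 z3 : R).
Definition F1 := jT1 bc bs bA bB lc ld (be (x1, x2, x3)) (be (y1, y2, y3)) (be (z1, z2, z3)).
Definition H1jet := jH C S (symT F1).

Ltac entries := rewrite /tab4 /F1 /jT1 /= /tab4 /=; by fld.

(** The [A] and [B] terms are the first two entries, lower index [o0] and [o1], of the first-kind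
    symbols of h^(1); the other two entries vanish. The digits are index pairs counted from 0. *)
Definition A22 := - (2 / 5 * C ^+ 2 * y3) + lc * z2 * z3 * S * (8 / 9 + 2 / 9 * k) / (P * M) - 2 / 3 * ld * x3 * z1 * C / (P * M).
Definition B22 := 2 / 5 * S ^+ 2 * x3 + lc * z1 * z3 * C * (2 / 9 * k - 8 / 9) / (P * M) + 2 / 3 * ld * x3 * z2 * S / (P * M).
Definition A33 := C ^+ 2 * y3 * (10 * k - 2) - ld * C * x1 * z3 / P ^+ 2.
Definition B33 := S ^+ 2 * x3 * (10 * k + 2) + ld * S * x2 * z3 / M ^+ 2.
Definition A23 := x3 * (k ^+ 2 / 2 + 3 / 10 * k - 2 / 5) + lc * z1 * z3 * C / (3 * P ^+ 2)
  - ld * S * (x2 * z3 * (2 / 3 + k / 6) / (P * M) + x3 * z2 * (5 / 6 - k / 6) / P ^+ 2).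
Definition B23 := y3 * (2 / 5 + 3 / 10 * k - k ^+ 2 / 2) - lc * z2 * z3 * S / (3 * M ^+ 2)
  + ld * C * (x1 * z3 * (2 / 3 - k / 6) / (P * M) + x3 * z1 * (5 / 6 + k / 6) / M ^+ 2).

Lemma chr1_H1_22 m : chr1 H1jet m o2 o2 = tab4 [:: A22; B22; 0; 0] m.
Proof. by rewrite chr1_frame22 //; move: m; apply: ord4P; rewrite /A22 /B22; entries. Qed.
Lemma chr1_H1_33 m : chr1 H1jet m o3 o3 = tab4 [:: A33; B33; 0; 0] m.
Proof. by rewrite chr1_frame33 //; move: m; apply: ord4P; rewrite /A33 /B33; entries. Qed.
Lemma chr1_H1_23 m : chr1 H1jet m o2 o3 = tab4 [:: A23; B23; 0; 0] m.
Proof. by rewrite chr1_frame23 //; move: m; apply: ord4P; rewrite /A23 /B23; entries. Qed.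

Definition N0 := tab4 [:: P^-1; M^-1; 3^-1; 1].

(* Half the gradient of the first-order coefficient of the sectional curvature. *)
Definition D0 := x3 * C * S * (28 / 15 + 13 / 15 * k + 5 / 3 * k ^+ 2) / P + lc * z1 * z3 * S * (5 / 3 + 2 / 3 * k) / P ^+ 3
  + ld * C * (x3 * z2 * (5 / 6 * k - 1 / 6) / P ^+ 3 - x2 * z3 * (4 / 3 + 5 / 6 * k) / (P ^+ 2 * M)).
Definition D1 := x3 * C * S * (26 / 15 + 4 / 5 * k - 2 / 3 * k ^+ 2) / M + lc * z1 * z3 * S * (8 / 9 + 5 / 9 * k) / (P ^+ 2 * M)
  + ld * C * (x3 * z2 * (5 / 6 * k - 4 / 9 - k ^+ 2 / 18) / (P ^+ 2 * M) + x2 * z3 * (k ^+ 2 / 18 - 8 / 9 - 2 / 3 * k) / (P * M ^+ 2)).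
Definition D2 := y3 * C * S * (28 / 15 - 13 / 15 * k + 5 / 3 * k ^+ 2) / M + lc * z2 * z3 * C * (5 / 3 - 2 / 3 * k) / M ^+ 3
  - ld * S * (x3 * z1 * (5 / 6 * k + 1 / 6) / M ^+ 3 + x1 * z3 * (4 / 3 - 5 / 6 * k) / (P * M ^+ 2)).
Definition D3 := y3 * C * S * (26 / 15 - 4 / 5 * k - 2 / 3 * k ^+ 2) / P + lc * z2 * z3 * C * (8 / 9 - 5 / 9 * k) / (P * M ^+ 2)
  + ld * S * (x1 * z3 * (k ^+ 2 / 18 - 8 / 9 + 2 / 3 * k) / (P ^+ 2 * M) - x3 * z1 * (5 / 6 * k + 4 / 9 + k ^+ 2 / 18) / (P * M ^+ 2)).

(** The products subtracted from [D0] are those that [riem1] adds to its linear part. With this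
    splitting they cancel in [riem1_values], where the symbols of h^(1) can stay abstract. *)
Lemma lin_H1_0323 : riem_lin H1jet o0 o3 o2 o3 = D0 - P * A23 * (- (2 * C * S / P ^+ 2)) + M * (4 * C * S / (3 * P * M)) * B33.
Proof. rewrite riem_lin_frame0323 // /D0 /A23 /B33; entries. Qed.
Lemma lin_H1_2123 : riem_lin H1jet o2 o1 o2 o3 = D1 + M * B22 * (2 * C * S / M ^+ 2) - P * (- (4 * C * S / (3 * P * M))) * A23.
Proof. rewrite riem_lin_frame2123 // /D1 /A23 /B22; entries. Qed.
Lemma lin_H1_1323 : riem_lin H1jet o1 o3 o2 o3 = D2 - M * B23 * (2 * C * S / M ^+ 2) + P * (- (4 * C * S / (3 * P * M))) * A33.
Proof. rewrite riem_lin_frame1323 // /D2 /A33 /B23; entries. Qed.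
Lemma lin_H1_2023 : riem_lin H1jet o2 o0 o2 o3 = D3 + P * A22 * (- (2 * C * S / P ^+ 2)) - M * (4 * C * S / (3 * P * M)) * B23.
Proof. rewrite riem_lin_frame2023 // /D3 /A22 /B23; entries. Qed.

Context (fa0 fa1 fa2 fb0 fb1 fb2 g0 g1 g2 : R).
Definition F2 := jT2 bc bs bA bB (tjet fa0 fa1 fa2) (tjet fb0 fb1 fb2) (tjet g0 g1 g2) lc ld
  (be (x1, x2, x3)) (be (y1, y2, y3)) (be (z1, z2, z3)).
Definition H2jet := jH C S (symT F2).

(** The one-form of K_u has m3-component <u, q3>/3, so the factor 9 in h_aa and h_bb cancels and
    f_aa contributes -(1/2) times the second derivative of f_aa <e_x, q3>^2 along m4. In that
    direction <e_x, q3> is constant to second order and theta is linear, leaving only f_aa''. *)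
Definition L2 := - fa2 / 2 * x3 ^+ 2 - fb2 / 2 * y3 ^+ 2
  + lc ^+ 2 * z3 ^+ 2 * (z1 ^+ 2 * (2 - 2 * k - k ^+ 2) / (9 * P ^+ 3) + z2 ^+ 2 * (2 + 2 * k - k ^+ 2) / (9 * M ^+ 3))
  + lc * x3 * z1 * z3 * C * k * (5 / 3 * k - 29 / 15) + lc * y3 * z2 * z3 * S * k * (5 / 3 * k + 29 / 15)
  + ld * S * x2 * x3 * z3 * (k ^+ 2 / 2 - 3 / 10 * k - 3 / 5) + ld * S * x3 ^+ 2 * z2 * (k ^+ 2 / 2 + 17 / 10 * k - 2 / 5)
  + ld * C * x1 * y3 * z3 * (k ^+ 2 / 2 + 3 / 10 * k - 3 / 5) + ld * C * x3 * y3 * z1 * (k ^+ 2 / 2 - 17 / 10 * k - 2 / 5)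
  + lc * ld / 18 * z3 ^+ 2 * (x1 * z2 + x2 * z1) * (C * S * g2 + 2 * k * g1 - 4 * C * S * g0)
  + lc * ld * x3 * z1 * z2 * z3 * C * S * (64 / 9 + 16 * k ^+ 2 + 8 / 9 * k ^+ 4) / (P ^+ 3 * M ^+ 3)
  + ld ^+ 2 * z3 ^+ 2 * (x2 ^+ 2 - x1 ^+ 2) * k / (4 * P * M).

Lemma lin_H2_2323 : riem_lin H2jet o2 o3 o2 o3 = L2.
Proof.
rewrite riem_lin_frame2323 // /L2 /tab4 /F2 /jT2 /= /tab4 /=; by fld.
Qed.

End H1.
End ClosedForms.

(** * The Hessian of v^(0) *)

Section Curvature0.
Context {R : realType} (C S t0 : R).
Context (CS : S ^+ 2 = 1 - C ^+ 2) (C0 : 0 < C) (S0 : 0 < S).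
Let C1 : C != 0 := lt0r_neq0 C0.
Let S1 : S != 0 := lt0r_neq0 S0.
Local Notation P := (3 - 2 * C ^+ 2).
Local Notation M := (1 + 2 * C ^+ 2).
Local Notation k := (2 * C ^+ 2 - 1).
Let P1 : P != 0 := lt0r_neq0 (P_gt0 CS S0).
Let M1 : M != 0 := lt0r_neq0 (M_gt0 C0).
Local Notation H0 := (H0jet C S t0).

Lemma H0_symd p q r : jd (H0 p q) r = jd (H0 q p) r.
Proof. exact: jH_sym. Qed.

Lemma H0_symh p q r s : jh (H0 p q) r s = jh (H0 q p) r s.
Proof. exact: jH_symh. Qed.

Lemma H0_hess p q r s : jh (H0 p q) r s = jh (H0 p q) s r.
Proof.
apply: jsym_jH => a b; rewrite /symT.
have h a' b' : jsym (jT0 (bA C S t0) (bB C S t0) a' b').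
  move: a' b'; apply: ord4P; apply: ord4P; rewrite /jT0 [nth _ _ _]/=;
  solve [exact: jsym_cst | apply: jsym_comp; exact: jsym_th].
by case: ifP.
Qed.

Definition R0 i j l m := riem_lin H0 i j l m + riem_diag (N0 C) H0 H0 i j l m.

Lemma R0_pair i j l m : R0 i j l m = R0 l m i j.
Proof.
rewrite /R0 (riem_lin_pair H0_symh H0_hess i j l m); congr (_ + _).
apply: eq_bigr => n _; rewrite !(chr1C H0_symd n _ i) !(chr1C H0_symd n _ j); ring.
Qed.

Lemma R0_diag i l m : R0 i i l m = 0.
Proof.
by rewrite /R0 riem_lin_diag add0r /riem_diag big1 // => n _; ring.
Qed.

Ltac fld := field: CS; rewrite ?C1 ?S1 ?P1 ?M1.
Ltac r0 := rewrite /R0 /riem_diag sum4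
  ?(chr1C H0_symd _ o2 o0) ?(chr1C H0_symd _ o2 o1) ?(chr1C H0_symd _ o3 o0)
  ?(chr1C H0_symd _ o3 o1) ?(chr1C H0_symd _ o3 o2) ?chr1_H0_02 ?chr1_H0_12 ?chr1_H0_03 ?chr1_H0_13 ?chr1_H0_22 ?chr1_H0_23
  ?chr1_H0_33 //; rewrite /N0 /riem_lin /dchr1 /H0jet /jH /jsum4 /symT /tab4 /= /tab4 /=; by fld.

Lemma R0_0303 : R0 o0 o3 o0 o3 = (5 + 2 * k) / P ^+ 3. Proof. r0. Qed.
Lemma R0_0123 : R0 o0 o1 o2 o3 = 4 * k / (P ^+ 2 * M ^+ 2). Proof. r0. Qed.
Lemma R0_0321 : R0 o0 o3 o2 o1 = (16 / 3 + 2 * k + 5 / 3 * k ^+ 2) / (P ^+ 2 * M ^+ 2). Proof. r0. Qed.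
Lemma R0_2121 : R0 o2 o1 o2 o1 = (16 / 9 + 4 / 3 * k - k ^+ 2 / 9) / (P * M ^+ 2). Proof. r0. Qed.
Lemma R0_1313 : R0 o1 o3 o1 o3 = (5 - 2 * k) / M ^+ 3. Proof. r0. Qed.
Lemma R0_1023 : R0 o1 o0 o2 o3 = - (4 * k) / (P ^+ 2 * M ^+ 2). Proof. r0. Qed.
Lemma R0_1320 : R0 o1 o3 o2 o0 = (16 / 3 - 2 * k + 5 / 3 * k ^+ 2) / (P ^+ 2 * M ^+ 2). Proof. r0. Qed.
Lemma R0_2020 : R0 o2 o0 o2 o0 = (16 / 9 - 4 / 3 * k - k ^+ 2 / 9) / (P ^+ 2 * M). Proof. r0. Qed.
Lemma R0_0313 : R0 o0 o3 o1 o3 = 0. Proof. r0. Qed.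
Lemma R0_0320 : R0 o0 o3 o2 o0 = 0. Proof. r0. Qed.
Lemma R0_1321 : R0 o1 o3 o2 o1 = 0. Proof. r0. Qed.
Lemma R0_2120 : R0 o2 o1 o2 o0 = 0. Proof. r0. Qed.

Definition h00 := 2 * (5 + 2 * k) / P ^+ 3.
Definition h01 := 2 * (8 / 3 + 5 / 3 * k) / (P ^+ 2 * M).
Definition h11 := 2 * (16 / 9 + 4 / 3 * k - k ^+ 2 / 9) / (P * M ^+ 2).
Definition h22 := 2 * (5 - 2 * k) / M ^+ 3.
Definition h23 := 2 * (8 / 3 - 5 / 3 * k) / (P * M ^+ 2).
Definition h33 := 2 * (16 / 9 - 4 / 3 * k - k ^+ 2 / 9) / (P ^+ 2 * M).

(** The zero blocks come from a symmetry: rotation by pi about q1 followed by exchange of the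
    factors is an isometry of g fixing the point. It keeps m1 and m4 and reverses m2 and m3, hence
    reverses z^1, z^2 and keeps z^3, z^4. *)
Lemma hess_R0 a b : quartic_hess R0 a b = tab4 (nth [::]
  [:: [:: h00; h01; 0; 0]; [:: h01; h11; 0; 0]; [:: 0; 0; h22; h23]; [:: 0; 0; h23; h33]] a) b.
Proof.
move: a b; apply: ord4P; apply: ord4P;
  rewrite /quartic_hess /tab4 [nth _ _ _]/= ?R0_diag ?(R0_pair o2 o1 o0 o3) ?(R0_pair o2 o3 o0 o1)
   ?(R0_pair o1 o3 o0 o3) ?(R0_pair o2 o0 o0 o3) ?(R0_pair o2 o1 o1 o3) ?(R0_pair o2 o0 o2 o1)
   ?(R0_pair o2 o0 o1 o3) ?(R0_pair o2 o3 o1 o0) ?(R0_pair o2 o3 o0 o0) ?(R0_pair o2 o3 o1 o1) ?R0_diag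
   ?R0_0303 ?R0_0123 ?R0_0321 ?R0_2121 ?R0_1313 ?R0_1023 ?R0_1320 ?R0_2020 ?R0_0313 ?R0_0320 ?R0_1321
   ?R0_2120 /= /h00 /h01 /h11 /h22 /h23 /h33; by fld.
Qed.

End Curvature0.

Section RiemannFirstVariation.
Context {R : realType} (N : 'I_4 -> R) (a0 a1 : 'I_4 -> 'I_4 -> @jet2 R 4).
Context (s0 : forall p q r, jd (a0 p q) r = jd (a0 q p) r) (s1 : forall p q r, jd (a1 p q) r = jd (a1 q p) r).

(** This condition removes the variation of the inverse metric, the term of [riem1] that is
    quadratic in the symbols of [a0]. *)
Definition chr1_cross0 i j l m := forall p q, chr1 a0 p j l * chr1 a0 q i m = 0 /\ chr1 a0 p i l * chr1 a0 q j m = 0.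

Lemma riem1_quad0 i j l m : chr1_cross0 i j l m ->
  riem1 N a0 a1 i j l m = riem_lin a1 i j l m + (riem_diag N a1 a0 i j l m + riem_diag N a0 a1 i j l m).
Proof.
move=> h; rewrite /riem1 [riem_quad _ _ _ _ _ _ _]big1 ?subr0 ?addrA // => p _; rewrite big1 // => q _.
by have [-> ->] := h p q; rewrite subrr mulr0.
Qed.

Lemma riem1_pair i j l m : chr1_cross0 i j l m ->
  (forall p q r s, jh (a1 p q) r s = jh (a1 q p) r s) -> (forall p q r s, jh (a1 p q) r s = jh (a1 p q) s r) ->
  riem1 N a0 a1 l m i j = riem1 N a0 a1 i j l m.
Proof.
move=> h h1 h2; rewrite !riem1_quad0 //; last first.
  move=> p q; have [e1 _] := h q p; have [_ e2] := h p q; split.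
    by rewrite mulrC (chr1C s0 q l j) (chr1C s0 p m i).
  by rewrite (chr1C s0 p l i) (chr1C s0 q m j).
rewrite (riem_lin_pair h1 h2 i j l m); congr (_ + _).
rewrite /riem_diag -!big_split; apply: eq_bigr => n _ /=.
rewrite (chr1C s0 n m i) (chr1C s0 n l j) (chr1C s1 n m i) (chr1C s1 n l j) (chr1C s0 n l i) (chr1C s0 n m j)
  (chr1C s1 n l i) (chr1C s1 n m j); ring.
Qed.

Lemma riem1_left i j l m (u w b d : 'I_4 -> R) :
  (forall n, chr1 a0 n j l = 0) -> (forall n, chr1 a0 n j m = 0) ->
  (forall n, chr1 a0 n i m = u n) -> (forall n, chr1 a0 n i l = w n) ->
  (forall n, chr1 a1 n j l = b n) -> (forall n, chr1 a1 n j m = d n) ->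
  riem1 N a0 a1 i j l m = riem_lin a1 i j l m + \sum_n (N n)^-1 * (b n * u n - w n * d n).
Proof.
move=> z1 z2 hu hw hb hd; rewrite riem1_quad0; last by move=> p q; rewrite z1 z2 mul0r mulr0.
congr (_ + _); rewrite /riem_diag -big_split; apply: eq_bigr => n _ /=.
by rewrite z1 z2 hu hw hb hd; ring.
Qed.

Lemma riem1_right i j l m (u w b d : 'I_4 -> R) :
  (forall n, chr1 a0 n i l = 0) -> (forall n, chr1 a0 n i m = 0) ->
  (forall n, chr1 a0 n j l = u n) -> (forall n, chr1 a0 n j m = w n) ->
  (forall n, chr1 a1 n i m = b n) -> (forall n, chr1 a1 n i l = d n) ->
  riem1 N a0 a1 i j l m = riem_lin a1 i j l m + \sum_n (N n)^-1 * (u n * b n - d n * w n).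
Proof.
move=> z1 z2 hu hw hb hd; rewrite riem1_quad0; last by move=> p q; rewrite z1 z2 mul0r mulr0.
congr (_ + _); rewrite /riem_diag -big_split; apply: eq_bigr => n _ /=.
by rewrite z1 z2 hu hw hb hd; ring.
Qed.
End RiemannFirstVariation.

(** * The gradient of v^(1) *)

Section Gradient1.
Context {R : realType} (C S t0 : R).
Context (CS : S ^+ 2 = 1 - C ^+ 2) (C0 : 0 < C) (S0 : 0 < S).
Let C1 : C != 0 := lt0r_neq0 C0.
Let S1 : S != 0 := lt0r_neq0 S0.
Local Notation P := (3 - 2 * C ^+ 2).
Local Notation M := (1 + 2 * C ^+ 2).
Let P1 : P != 0 := lt0r_neq0 (P_gt0 CS S0).
Let M1 : M != 0 := lt0r_neq0 (M_gt0 C0).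
Local Notation H0 := (H0jet C S t0).
Context (lc ld x1 x2 x3 y1 y2 y3 z1 z2 z3 : R).
Local Notation H1 := (H1jet C S t0 lc ld x1 x2 x3 y1 y2 y3 z1 z2 z3).

Lemma H1_symd p q r : jd (H1 p q) r = jd (H1 q p) r.
Proof. exact: jH_sym. Qed.

Lemma H1_symh p q r s : jh (H1 p q) r s = jh (H1 q p) r s.
Proof. exact: jH_symh. Qed.

Ltac jsyms := repeat first
  [assumption | exact: jsym_cst | apply: jsym_mul | apply: jsym_add].

Lemma H1_hess p q r s : jh (H1 p q) r s = jh (H1 p q) s r.
Proof.
apply: jsym_jH => a b; rewrite /symT.
have jt f0 f1 f2 : jsym (tjet C S t0 f0 f1 f2) by apply: jsym_comp; exact: jsym_th.
have js := jt S C (- S); have jc := jt C (- S) (- C).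
have jA : jsym (bA C S t0) by exact: jt.
have jB : jsym (bB C S t0) by exact: jt.
have je u : [/\ jsym (be C S u).1.1, jsym (be C S u).1.2 & jsym (be C S u).2] := jsym_e C S u.
have h a' b' : jsym (F1 C S t0 lc ld x1 x2 x3 y1 y2 y3 z1 z2 z3 a' b').
  have jk u a'' : jsym (jkv (bc C S t0) (bs C S t0) (bA C S t0) (bB C S t0) (be C S u) a'').
    have [j1 j2 j3] := je u; move: a''; apply: ord4P; rewrite /jkv /jtab4 [nth _ _ _]/=; jsyms.
  have jj u a'' : jsym (jjv (bc C S t0) (bs C S t0) (bA C S t0) (bB C S t0) (be C S u) a'').
    have [j1 j2 j3] := je u; move: a''; apply: ord4P; rewrite /jjv /jtab4 [nth _ _ _]/=; jsyms.
  have jp a'' : jsym (jksp (bc C S t0) (bs C S t0) (bA C S t0) a'').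
    move: a''; apply: ord4P; rewrite /jksp /jtab4 [nth _ _ _]/=; jsyms.
  have jm a'' : jsym (jksm (bc C S t0) (bs C S t0) (bB C S t0) a'').
    move: a''; apply: ord4P; rewrite /jksm /jtab4 [nth _ _ _]/=; jsyms.
  have jc2' : jsym (jc2 (bc C S t0)).
    by rewrite /jc2; jsyms.
  by rewrite /F1 /jT1 /jodv;
    repeat first [exact: jk | exact: jj | exact: jp | exact: jm | exact: jc2' | exact: jsym_cst
      | apply: jsym_add | apply: jsym_mul].
by case: ifP.
Qed.

Ltac fld := field: CS; rewrite ?C1 ?S1 ?P1 ?M1.
Local Notation D0' := (D0 C S lc ld x2 x3 z1 z2 z3).
Local Notation D1' := (D1 C S lc ld x2 x3 z1 z2 z3).
Local Notation D2' := (D2 C S lc ld x1 x3 y3 z1 z2 z3).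
Local Notation D3' := (D3 C S lc ld x1 x3 y3 z1 z2 z3).
Local Notation r1 := (riem1 (N0 C) H0 H1).

Let s0 := @H0_symd R C S t0.
Let s1 := H1_symd.
Local Notation chr1_cross0 := (chr1_cross0 H0).

Lemma chr1_H0_zero : [/\ chr1_cross0 o0 o3 o2 o3, chr1_cross0 o2 o1 o2 o3, chr1_cross0 o1 o3 o2 o3 & chr1_cross0 o2 o0 o2 o3].
Proof.
by split=> p q; split; rewrite ?(chr1C s0 p o3 o2) ?chr1_H0_22 ?chr1_H0_23 ?chr1_H0_33 // ?mul0r ?mulr0.
Qed.

Lemma riem1_values : [/\ r1 o0 o3 o2 o3 = D0', r1 o2 o1 o2 o3 = D1', r1 o1 o3 o2 o3 = D2' & r1 o2 o0 o2 o3 = D3'].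
Proof.
have c32 n : chr1 H0 n o3 o2 = 0 by rewrite (chr1C s0) chr1_H0_23.
have c33 n : chr1 H0 n o3 o3 = 0 by rewrite chr1_H0_33.
have c22 n : chr1 H0 n o2 o2 = 0 by rewrite chr1_H0_22.
have c23 n : chr1 H0 n o2 o3 = 0 by rewrite chr1_H0_23.
have c03 := chr1_H0_03 t0 CS C0 S0; have c13 := chr1_H0_13 t0 CS C0 S0.
have c02 := chr1_H0_02 t0 CS C0 S0; have c12 := chr1_H0_12 t0 CS C0 S0.
have b22 := chr1_H1_22 t0 CS C0 S0 lc ld x1 x2 x3 y1 y2 y3 z1 z2 z3.
have b33 := chr1_H1_33 t0 CS C0 S0 lc ld x1 x2 x3 y1 y2 y3 z1 z2 z3.
have b23 := chr1_H1_23 t0 CS C0 S0 lc ld x1 x2 x3 y1 y2 y3 z1 z2 z3.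
have b32 n : chr1 H1 n o3 o2 = tab4 [:: A23 C S lc ld x2 x3 z1 z2 z3; B23 C S lc ld x1 x3 y3 z1 z2 z3; 0; 0] n.
  by rewrite (chr1C s1) b23.
split.
- rewrite (riem1_left (N0 C) c32 c33 c03 c02 b32 b33) lin_H1_0323 // sum4 /N0 /tab4 [nth _ _ _]/=.
  move: (D0 _ _ _ _ _ _ _ _ _) (A23 _ _ _ _ _ _ _ _ _) (B23 _ _ _ _ _ _ _ _ _ _) (A33 _ _ _ _ _) (B33 _ _ _ _ _ _) => ? ? ? ? ?.
  by rewrite /=; fld.
- rewrite (riem1_right (N0 C) c22 c23 c12 c13 b23 b22) lin_H1_2123 // sum4 /N0 /tab4 [nth _ _ _]/=.
  move: (D1 _ _ _ _ _ _ _ _ _) (A23 _ _ _ _ _ _ _ _ _) (B23 _ _ _ _ _ _ _ _ _ _) (A22 _ _ _ _ _ _ _ _ _) (B22 _ _ _ _ _ _ _ _) => ? ? ? ? ?.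
  by rewrite /=; fld.
- rewrite (riem1_left (N0 C) c32 c33 c13 c12 b32 b33) lin_H1_1323 // sum4 /N0 /tab4 [nth _ _ _]/=.
  move: (D2 _ _ _ _ _ _ _ _ _ _) (A23 _ _ _ _ _ _ _ _ _) (B23 _ _ _ _ _ _ _ _ _ _) (A33 _ _ _ _ _) (B33 _ _ _ _ _ _) => ? ? ? ? ?.
  by rewrite /=; fld.
- rewrite (riem1_right (N0 C) c22 c23 c02 c03 b23 b22) lin_H1_2023 // sum4 /N0 /tab4 [nth _ _ _]/=.
  move: (D3 _ _ _ _ _ _ _ _ _ _) (A23 _ _ _ _ _ _ _ _ _) (B23 _ _ _ _ _ _ _ _ _ _) (A22 _ _ _ _ _ _ _ _ _) (B22 _ _ _ _ _ _ _ _) => ? ? ? ? ?.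
  by rewrite /=; fld.
Qed.

(** Each entry of the gradient is a sum of two components that pair symmetry identifies, whence the
    factor 2. *)
Lemma grad_riem1 a : quartic_grad r1 a = 2 * tab4 [:: D0'; D1'; D2'; D3'] a.
Proof.
have [q0 q1 q2 q3] := chr1_H0_zero; have [e0 e1 e2 e3] := riem1_values.
by rewrite /quartic_grad (riem1_pair (N0 C) s0 s1 q0 H1_symh H1_hess) (riem1_pair (N0 C) s0 s1 q1 H1_symh
  H1_hess) (riem1_pair (N0 C) s0 s1 q2 H1_symh H1_hess) (riem1_pair (N0 C) s0 s1 q3 H1_symh H1_hess) e0 e1 e2
  e3;
  move: a; apply: ord4P; rewrite /tab4 [nth _ _ _]/= mulrDl mul1r.
Qed.

End Gradient1.

(** * The algebraic identity for V^(2) *)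

Section FinalIdentity.
Context {R : realType} (C S : R).
Context (CS : S ^+ 2 = 1 - C ^+ 2) (C0 : 0 < C) (S0 : 0 < S).
Let C1 : C != 0 := lt0r_neq0 C0.
Let S1 : S != 0 := lt0r_neq0 S0.
Local Notation P := (3 - 2 * C ^+ 2).
Local Notation M := (1 + 2 * C ^+ 2).
Local Notation k := (2 * C ^+ 2 - 1).
Let P1 : P != 0 := lt0r_neq0 (P_gt0 CS S0).
Let M1 : M != 0 := lt0r_neq0 (M_gt0 C0).
Context (lc ld x1 x2 x3 y1 y2 y3 z1 z2 z3 : R).
Local Notation D0' := (D0 C S lc ld x2 x3 z1 z2 z3).
Local Notation D1' := (D1 C S lc ld x2 x3 z1 z2 z3).
Local Notation D2' := (D2 C S lc ld x1 x3 y3 z1 z2 z3).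
Local Notation D3' := (D3 C S lc ld x1 x3 y3 z1 z2 z3).
Local Notation A22' := (A22 C S lc ld x3 y3 z1 z2 z3).
Local Notation A23' := (A23 C S lc ld x2 x3 z1 z2 z3).
Local Notation A33' := (A33 C ld x1 y3 z3).
Local Notation B22' := (B22 C S lc ld x3 z1 z2 z3).
Local Notation B23' := (B23 C S lc ld x1 x3 y3 z1 z2 z3).
Local Notation B33' := (B33 C S ld x2 x3 z3).
Local Notation h00 := (h00 C).
Local Notation h01 := (h01 C).
Local Notation h11 := (h11 C).
Local Notation h22 := (h22 C).
Local Notation h23 := (h23 C).
Local Notation h33 := (h33 C).

Lemma det_upper : h00 * h11 - h01 ^+ 2 = 16 / 9 * C ^+ 2 * (4 + k) / (P ^+ 3 * M ^+ 2).
Proof. by rewrite /h00 /h11 /h01; field; rewrite ?P1 ?M1. Qed.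

Lemma det_lower : h22 * h33 - h23 ^+ 2 = 16 / 9 * S ^+ 2 * (4 - k) / (P ^+ 2 * M ^+ 3).
Proof. by rewrite /h22 /h33 /h23; field: CS; rewrite ?P1 ?M1. Qed.

(** The coefficient of [x3 ^+ 2] without its f_aa'' term, as a function of cos(2 theta); the
    denominator is a factor of [det_upper]. The substitution of -cos(2 theta) gives the coefficient
    of [y3 ^+ 2]. *)
Definition ra (c : R) := ((- (2149 / 450)) - 3481 / 450 * c + 3367 / 150 * c ^+ 2 + 592 / 225 * c ^+ 3
  - (40 * 10 ^+ 3 + 801) / 1800 * c ^+ 4 + 1307 / 600 * c ^+ 5 + 653 / 72 * c ^+ 6 - 25 / 72 * c ^+ 7) / (4 + c).
Definition Cq := x3 ^+ 2 * (z1 ^+ 2 * (2 + 2 * k - k ^+ 2) / (12 * M ^+ 3) + z2 ^+ 2 * (2 - 2 * k - k ^+ 2) / (12 * P ^+ 3))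
  - k * (2 + k ^+ 2) / (3 * P ^+ 2 * M ^+ 2) * x3 * z3 * (x1 * z1 - x2 * z2).

Lemma k4 : 4 + k != 0 /\ 4 - k != 0.
Proof.
have h1 := exprn_gt0 2 C0; have h2 := exprn_gt0 2 S0; move: CS h1 h2 => ? ? ?.
by split; rewrite gt_eqF //; lra.
Qed.

(** The left side is the linear part of h^(2), the quadratic part of h^(1), and -(1/2) times the
    inverse Hessian on the gradient, written block by block with adjugates; the gradient being
    [2 * D], the factor is 2. The hypothesis prescribes the second derivative of cos(theta)
    sin(theta) G, and its right side is what cancels the remaining terms in [lc * ld]. *)
Lemma V2_algebra (fa2 fb2 g0 g1 g2 : R) :
  C * S * g2 + 2 * k * g1 - 4 * C * S * g0 = - (12 * C * S * (4 + k ^+ 2) / (P * M) ^+ 2) ->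
  L2 C S lc ld x1 x2 x3 y3 z1 z2 z3 fa2 fb2 g0 g1 g2
  + P * (A23' ^+ 2 - A22' * A33') + M * (B23' ^+ 2 - B22' * B33')
  - 2 * (h11 * D0' ^+ 2 - 2 * h01 * D0' * D1' + h00 * D1' ^+ 2) / (h00 * h11 - h01 ^+ 2)
  - 2 * (h33 * D2' ^+ 2 - 2 * h23 * D2' * D3' + h22 * D3' ^+ 2) / (h22 * h33 - h23 ^+ 2)
  = (ra k - fa2 / 2) * x3 ^+ 2 + (ra (- k) - fb2 / 2) * y3 ^+ 2 + ld ^+ 2 * Cq.
Proof.
move=> hg; rewrite /L2 hg det_upper det_lower.
have [k1 k2] := k4.
rewrite /A22 /A23 /A33 /B22 /B23 /B33 /D0 /D1 /D2 /D3 /h00 /h11 /h01 /h22 /h33 /h23 /ra /Cq.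
by field: CS; rewrite ?C1 ?S1 ?P1 ?M1 ?k1 ?k2.
Qed.
End FinalIdentity.

Section V2Value.
Context {R : realType} (y : R3xR3 R) (hy : M_nondeg y).
Local Notation C := (cos (theta y)).
Local Notation S := (sin (theta y)).
Local Notation t0 := (theta y).
Local Notation P := (3 - 2 * C ^+ 2).
Local Notation M := (1 + 2 * C ^+ 2).
Local Notation k := (2 * C ^+ 2 - 1).
Context (CS : S ^+ 2 = 1 - C ^+ 2) (C0 : 0 < C) (S0 : 0 < S).
Let C1 : C != 0 := lt0r_neq0 C0.
Let S1 : S != 0 := lt0r_neq0 S0.
Let P1 : P != 0 := lt0r_neq0 (P_gt0 CS S0).
Let M1 : M != 0 := lt0r_neq0 (M_gt0 C0).

Lemma det_neq0 : h00 C * h11 C - h01 C ^+ 2 != 0 /\ h22 C * h33 C - h23 C ^+ 2 != 0.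
Proof.
have [k1 k2] := k4 CS C0 S0; rewrite (det_upper CS C0 S0) (det_lower CS C0 S0); move: P1 M1 C1 S1 k1 k2.
move: (3 - 2 * C ^+ 2) (1 + 2 * C ^+ 2) (4 + _) (4 - _) => p m a b p1 m1 c1 s1 a1 b1.
by split; rewrite !mulf_neq0 ?invr_neq0 ?mulf_neq0 ?expf_neq0 // pnatr_eq0.
Qed.

Let N0_neq0 i : N0 C i != 0.
Proof. by move: i; apply: ord4P; rewrite /N0 /tab4 /= ?invr_neq0 ?oner_neq0 ?pnatr_eq0. Qed.

Let jval_H0 : jval (H0jet C S t0) = diag_mx (\row_i N0 C i).
Proof.
apply/matrixP => i j; rewrite !mxE /H0jet jval_jH.
by move: i j; apply: ord4P; apply: ord4P; rewrite /symT /N0 /tab4 /=.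
Qed.

Let hess_unit : (\matrix_(a, b) quartic_hess (R0 C S t0) a b : 'M[R]_4) \in unitmx.
Proof.
have [d1 d2] := det_neq0.
(* The inverse is exhibited block by block: adjugate over determinant. *)
pose K : 'M[R]_4 := \matrix_(a, b) tab4 (nth [::]
  [:: [:: h11 C / (h00 C * h11 C - h01 C ^+ 2); - h01 C / (h00 C * h11 C - h01 C ^+ 2); 0; 0];
      [:: - h01 C / (h00 C * h11 C - h01 C ^+ 2); h00 C / (h00 C * h11 C - h01 C ^+ 2); 0; 0];
      [:: 0; 0; h33 C / (h22 C * h33 C - h23 C ^+ 2); - h23 C / (h22 C * h33 C - h23 C ^+ 2)];
      [:: 0; 0; - h23 C / (h22 C * h33 C - h23 C ^+ 2); h22 C / (h22 C * h33 C - h23 C ^+ 2)]] a) b.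
suff /mulmx1_unit[] : (\matrix_(a, b) quartic_hess (R0 C S t0) a b : 'M[R]_4) *m K = 1%:M by [].
apply/matrixP => a b; rewrite mxE sum4 !mxE !hess_R0 //.
move: (h00 C) (h01 C) (h11 C) (h22 C) (h23 C) (h33 C) d1 d2 => u1 u2 u3 u4 u5 u6 d1 d2.
by move: a b; apply: ord4P; apply: ord4P; rewrite /tab4 /=; field; rewrite ?e1 ?e2.
Qed.

Context (lc ld x1 x2 x3 y1 y2 y3 z1 z2 z3 fa0 fa1 fa2 fb0 fb1 fb2 g0 g1 g2 : R).
Local Notation H1' := (H1jet C S t0 lc ld x1 x2 x3 y1 y2 y3 z1 z2 z3).
Local Notation H2' := (H2jet C S t0 lc ld x1 x2 x3 y1 y2 y3 z1 z2 z3 fa0 fa1 fa2 fb0 fb1 fb2 g0 g1 g2).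
Local Notation D0' := (D0 C S lc ld x2 x3 z1 z2 z3).
Local Notation D1' := (D1 C S lc ld x2 x3 z1 z2 z3).
Local Notation D2' := (D2 C S lc ld x1 x3 y3 z1 z2 z3).
Local Notation D3' := (D3 C S lc ld x1 x3 y3 z1 z2 z3).

Lemma V2_value :
  (forall i j, has_jet (fun x => pullback (chart y) g x i j) (H0jet C S t0 i j)) ->
  (forall i j, has_jet (fun x => pullback (chart y) (h1 lc ld) x i j) (H1' i j)) ->
  (forall i j, has_jet (fun x => pullback (chart y) (h2 lc ld) x i j) (H2' i j)) ->
  C * S * g2 + 2 * k * g1 - 4 * C * S * g0 = - (12 * C * S * (4 + k ^+ 2) / (P * M) ^+ 2) ->
  V2 lc ld y = (ra k - fa2 / 2) * x3 ^+ 2 + (ra (- k) - fb2 / 2) * y3 ^+ 2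
    + ld ^+ 2 * Cq C x1 x2 x3 z1 z2 z3.
Proof.
move=> j0 j1 j2 hg; have [d1 d2] := det_neq0.
(* Cramer's rule in each of the two blocks, for the right-hand side [- (2 * D)]. *)
pose zb := tab4 [:: - 2 * (h11 C * D0' - h01 C * D1') / (h00 C * h11 C - h01 C ^+ 2);
  - 2 * (h00 C * D1' - h01 C * D0') / (h00 C * h11 C - h01 C ^+ 2);
  - 2 * (h33 C * D2' - h23 C * D3') / (h22 C * h33 C - h23 C ^+ 2);
  - 2 * (h22 C * D3' - h23 C * D2') / (h22 C * h33 C - h23 C ^+ 2)].
have grad := grad_riem1 t0 CS C0 S0 lc ld x1 x2 x3 y1 y2 y3 z1 z2 z3.
have s0 := @H0_symd R C S t0.
have sym p q r : [/\ jd (H0jet C S t0 p q) r = jd (H0jet C S t0 q p) r, jd (H1' p q) r = jd (H1' q p) r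
  & jd (H2' p q) r = jd (H2' q p) r] by split; exact: jH_sym.
have c0 m : [/\ chr1 (H0jet C S t0) m o3 o2 = 0, chr1 (H0jet C S t0) m o2 o3 = 0,
    chr1 (H0jet C S t0) m o2 o2 = 0 & chr1 (H0jet C S t0) m o3 o3 = 0].
  by rewrite (chr1C s0 m o3 o2) chr1_H0_22 // chr1_H0_23 // chr1_H0_33.
rewrite (V2_jets (zb := zb) hy j0 j1 j2 jval_H0 N0_neq0 sym c0 hess_unit); last first.
  move=> a; rewrite sum4 grad !(hess_R0 t0 CS C0 S0 a) /zb.
  have gen (u1 u2 u3 u4 u5 u6 d0 d1' d2' d3 : R) : u1 * u3 - u2 ^+ 2 != 0 -> u4 * u6 - u5 ^+ 2 != 0 ->
     forall a : 'I_4, let H := tab4 (nth [::] [:: [:: u1; u2; 0; 0]; [:: u2; u3; 0; 0]; [:: 0; 0; u4; u5]; [:: 0; 0; u5; u6]] a) in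
     let z := tab4 [:: - 2 * (u3 * d0 - u2 * d1') / (u1 * u3 - u2 ^+ 2); - 2 * (u1 * d1' - u2 * d0) / (u1 * u3 - u2 ^+ 2);
        - 2 * (u6 * d2' - u5 * d3) / (u4 * u6 - u5 ^+ 2); - 2 * (u4 * d3 - u5 * d2') / (u4 * u6 - u5 ^+ 2)] in
     H o0 * z o0 + H o1 * z o1 + H o2 * z o2 + H o3 * z o3 = - (2 * tab4 [:: d0; d1'; d2'; d3] a).
    by move=> e1 e2; apply: ord4P; rewrite /tab4 /=; field; rewrite ?e1 ?e2.
  exact: gen.
have rd : riem_diag (N0 C) H1' H1' o2 o3 o2 o3 =
    P * (A23 C S lc ld x2 x3 z1 z2 z3 ^+ 2 - A22 C S lc ld x3 y3 z1 z2 z3 * A33 C ld x1 y3 z3)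
  + M * (B23 C S lc ld x1 x3 y3 z1 z2 z3 ^+ 2 - B22 C S lc ld x3 z1 z2 z3 * B33 C S ld x2 x3 z3).
  have s1 := @H1_symd R C S t0 lc ld x1 x2 x3 y1 y2 y3 z1 z2 z3.
  rewrite /riem_diag (eq_bigr (fun m => (N0 C m)^-1 *
    ((tab4 [:: A23 C S lc ld x2 x3 z1 z2 z3; B23 C S lc ld x1 x3 y3 z1 z2 z3; 0; 0] m) ^+ 2 -
     tab4 [:: A22 C S lc ld x3 y3 z1 z2 z3; B22 C S lc ld x3 z1 z2 z3; 0; 0] m * tab4 [:: A33 C ld x1 y3 z3; B33 C S ld x2 x3 z3; 0; 0] m))).
    by rewrite sum4 /N0 /tab4 /= !invrK; ring.
  by move=> m _; rewrite (chr1C s1 m o3 o2) expr2 chr1_H1_23 // chr1_H1_22 // chr1_H1_33.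
rewrite (lin_H2_2323 t0 CS C0 S0) rd sum4 !grad /zb.
rewrite -(V2_algebra CS C0 S0 lc ld _ _ _ _ _ _ _ _ _ hg).
move: (L2 _ _ _ _ _ _ _ _ _ _ _ _ _ _ _ _) (P * _) (M * _) => l p m.
rewrite /tab4 [nth _ _ o0]/= [nth _ _ o1]/= [nth _ _ o2]/= [nth _ _ o3]/=.
move: (D0 _ _ _ _ _ _ _ _ _) (D1 _ _ _ _ _ _ _ _ _) (D2 _ _ _ _ _ _ _ _ _ _) (D3 _ _ _ _ _ _ _ _ _ _) => w0 w1 w2 w3.
move: (h00 C) (h01 C) (h11 C) (h22 C) (h23 C) (h33 C) d1 d2 {zb} => u1 u2 u3 u4 u5 u6 d1 d2.
by rewrite /=; field; rewrite d1 d2.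
Qed.

End V2Value.

(** * The functions f_aa and f_bb *)

Section Remainder.
Context {R : realType}.
Implicit Types (f df : R -> R).

Lemma mean_value f df a b : (forall x, is_derive x (1 : R) f (df x)) ->
  exists2 c, `|c - a| <= `|b - a| & f b - f a = df c * (b - a).
Proof.
move=> h; have ct (u w : R) : {within `[u, w], continuous f}.
  apply: continuous_subspaceT => x; apply: differentiable_continuous.
  by apply/derivable1_diffP; have [] := h x.
have [ab|/ltW ba] := leP a b.
  have [c] := MVT_segment ab (fun x _ => h x) (ct a b); rewrite in_itv /= => /andP[c1 c2] e.
  by exists c => //; rewrite !ger0_norm ?subr_ge0 // lerB.
have [c] := MVT_segment ba (fun x _ => h x) (ct b a); rewrite in_itv /= => /andP[c1 c2] e.
exists c; first by rewrite !ler0_norm ?subr_le0 // lerN2 lerB.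
by rewrite -opprB e; ring.
Qed.

Lemma remainder_sqr f df ddf a h : (forall x, is_derive x (1 : R) f (df x)) ->
  (forall x, is_derive x (1 : R) df (ddf x)) -> (forall x, `|ddf x| <= 1) ->
  `|f (a + h) - f a - h * df a| <= h ^+ 2.
Proof.
move=> h1 h2 b.
have [c c1 ->] := mean_value a (a + h) h1; have [d _ e] := mean_value a c h2.
rewrite [a + h]addrC addrK in c1 *.
rewrite (_ : df c * h - h * df a = (df c - df a) * h); last by ring.
rewrite e !normrM -real_normK ?num_real // expr2 ler_wpM2r //.
by rewrite -[leRHS]mul1r ler_pM.
Qed.

Lemma cos_remainder (a h : R) : `|cos (a + h) - cos a + h * sin a| <= h ^+ 2.
Proof.
have := @remainder_sqr cos (fun x => - sin x) (fun x => - cos x) a h.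
by rewrite mulrN opprK; apply=> x; first [exact: is_deriveNr (is_derive_sin x) | exact: is_derive_cos | rewrite normrN cos_max].
Qed.

Lemma sin_remainder (a h : R) : `|sin (a + h) - sin a - h * cos a| <= h ^+ 2.
Proof.
by apply: (@remainder_sqr sin cos (fun x => - sin x)) => x;
  first [exact: is_derive_sin | exact: is_derive_cos | rewrite normrN ler_norml sin_le1 sin_geN1].
Qed.

(** Instead of uniform convergence of the derivatives, a quadratic remainder with summable constants
    is used. Summed over [n] it bounds the remainder of the sum by [B * h ^+ 2], so the difference
    quotient is off by at most a multiple of |h|. *)
Lemma is_derive_series (f df : nat -> R -> R) (K : nat -> R) t :
  (forall t, cvgn (series (f^~ t))) -> cvgn (series (df^~ t)) -> cvgn (series K) ->
  (forall n h, `|f n (t + h) - f n t - h * df n t| <= K n * h ^+ 2) ->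
  is_derive t (1 : R) (fun t => limn (series (f^~ t))) (limn (series (df^~ t))).
Proof.
move=> cf cd cK rem.
set F := fun t => _; set L := limn _; set B := limn (series K).
have bound h : `|F (t + h) - F t - h * L| <= B * h ^+ 2.
  pose r n := f n (t + h) - f n t - h * df n t.
  have cr : series r @ \oo --> F (t + h) - F t - h * L.
    have -> : series r = (fun n => series (f^~ (t + h)) n - series (f^~ t) n - h * series (df^~ t) n).
      by apply/funext => n; rewrite /series /= mulr_sumr -!sumrB.
    apply: cvgB; first by apply: cvgB; exact: cf.
    by apply: cvgM; [exact: cvg_cst | exact: cd].
  have cB : (fun n => series K n * h ^+ 2) @ \oo --> B * h ^+ 2.
    by apply: cvgM; [exact: cK | exact: cvg_cst].
  apply: (ler_cvg_to (cvg_norm cr) cB); near=> n.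
  rewrite /series /= (le_trans (ler_norm_sum _ _ _)) // mulr_suml ler_sum // => i _.
  exact: rem.
have q : h^-1 *: ((F \o shift t) (h *: (1 : R)) - F t) @[h --> (0 : R)^'] --> L.
  apply/cvgrPdist_le => e e0; have b0 : 0 < `|B| + 1 by rewrite ltr_wpDl.
  near=> h; have h0 : h != 0 by near: h; exact: nbhs_dnbhs_neq.
  have he : `|h| <= e / (`|B| + 1) by near: h; apply: dnbhs0_le; rewrite divr_gt0.
  have -> : L - h^-1 *: ((F \o shift t) (h *: (1 : R)) - F t) = - h^-1 * (F (t + h) - F t - h * L).
    rewrite /= (_ : h *: (1 : R) = h) ?(addrC h) ; last by rewrite /GRing.scale /= mulr1.
    by rewrite /GRing.scale /=; field.
  rewrite normrM normrN; apply: le_trans (ler_wpM2l (normr_ge0 _) (bound h)) _.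
  rewrite -(real_normK (num_real h)) normfV (_ : `|h|^-1 * (B * `|h| ^+ 2) = B * `|h|); last first.
    by field; rewrite normr_eq0.
  rewrite ler_pdivlMr // mulrC in he; apply: le_trans he.
  by rewrite ler_wpM2r // (le_trans (ler_norm _)) // lerDl.
by split; [apply/cvg_ex; exists L | apply/cvg_lim].
Unshelve. all: by end_near. Qed.

End Remainder.

(** * The series in f_aa and f_bb *)

Section TrigonometricSeries.
Context {R : realType} (r : R) (r1 : `|r| < 1).

Lemma is_cvg_series_natX : cvgn (series (fun n => n%:R * `|r| ^+ n)).
Proof.
have s0 := normr_ge0 r; move: (`|r|) s0 r1 => s s0 s1.
(* Closed form of the arithmetico-geometric partial sums; it bounds them by s / (1 - s)^2. *)
have e n : (1 - s) ^+ 2 * series (fun n => n%:R * s ^+ n) n = s - n%:R * s ^+ n + (n%:R - 1) * s ^+ n.+1.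
  elim: n => [|n IH]; first by rewrite /series /= big_geq // mulr0 !mul0r; ring.
  by rewrite seriesSr mulrDr IH /= -natr1 !exprS; ring.
apply: nondecreasing_is_cvgn.
  by apply/nondecreasing_seqP => n; rewrite seriesSr lerDl mulr_ge0 // exprn_ge0.
exists (s / (1 - s) ^+ 2) => _ [n _ <-].
have q0 : 0 < (1 - s) ^+ 2 by rewrite exprn_gt0 // subr_gt0.
rewrite ler_pdivlMr // mulrC e -[leRHS]addr0 -addrA lerD2l.
rewrite addrC subr_le0 exprS mulrA; apply: ler_wpM2r; first by rewrite exprn_ge0.
case: n {e} => [|n]; first by rewrite sub0r mulN1r oppr_le0.
by rewrite -natr1 addrK (le_trans (ler_wpM2l (ler0n _ _) (ltW s1))) // mulr1 lerDl.
Qed.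

(** One majorant for all three series and their remainders: the division by n^2 in [ser0] absorbs
    two derivatives, so the quadratic remainder of [ser1] costs one factor n. *)
Let K n := n.+1%:R * `|r| ^+ n.+1.

Lemma is_cvg_series_natXS : cvgn (series K).
Proof.
have e : series K = (fun n => series (fun n => n%:R * `|r| ^+ n) n.+1).
  apply/funext => n; rewrite /series /= [RHS]big_nat_recl // mul0r add0r; exact: eq_bigr.
by rewrite e; apply/cvg_ex; exists (limn (series (fun n => n%:R * `|r| ^+ n))); rewrite cvg_shiftS; exact: is_cvg_series_natX.
Qed.

Lemma is_cvg_series_bounded (u : nat -> R) (c : R) : (forall n, `|u n| <= c * K n) -> cvgn (series u).
Proof.
move=> h; apply: normed_cvg.
have hc : cvgn (series (fun n => c * K n)) by apply: is_cvg_seriesZ; exact: is_cvg_series_natXS.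
apply: series_le_cvg hc => n //=.
by apply: le_trans (h n).
Qed.

(** The index is shifted by one because the sums in f_aa and f_bb start at 1; [ser1] and [ser2] are
    the termwise derivatives in [t]. *)
Definition ser0 (t : R) n := r ^+ n.+1 * cos (n.+1%:R * (2 * t)) / n.+1%:R ^+ 2.
Definition ser1 (t : R) n := - 2 * (r ^+ n.+1 * sin (n.+1%:R * (2 * t)) / n.+1%:R).
Definition ser2 (t : R) n := - 4 * (r ^+ n.+1 * cos (n.+1%:R * (2 * t))).

Let n1 n : (n.+1%:R : R) != 0. Proof. by rewrite pnatr_eq0. Qed.
Let n_ge1 n : (1 : R) <= n.+1%:R. Proof. by rewrite ler1n. Qed.

Let bound n (a b : R) : `|a| <= 1 -> `|b| <= 1 -> `|r ^+ n.+1 * a * b| <= K n.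
Proof.
move=> ha hb; rewrite !normrM normrX /K mulrC; apply: ler_pM; rewrite ?mulr_ge0 ?exprn_ge0 //.
  exact: le_trans hb (n_ge1 n).
by rewrite ler_piMr ?exprn_ge0.
Qed.

Let inv_le1 n m : `|(n.+1%:R : R) ^- m| <= 1.
Proof.
rewrite ger0_norm ?invr_ge0 ?exprn_ge0 // invf_le1 ?exprn_gt0 ?ltr0n //; exact: exprn_ege1.
Qed.

Let sin_max' (x : R) : `|sin x| <= 1. Proof. by rewrite ler_norml sin_le1 sin_geN1. Qed.

Lemma is_cvg_ser0 t : cvgn (series (ser0 t)).
Proof.
apply: (@is_cvg_series_bounded _ 1) => n; rewrite mul1r; apply: bound; [exact: cos_max | exact: inv_le1].
Qed.

Lemma is_cvg_ser1 t : cvgn (series (ser1 t)).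
Proof.
apply: (@is_cvg_series_bounded _ 2) => n; rewrite /ser1 normrM normrN (ger0_norm (ler0n R 2)) ler_wpM2l //.
by apply: bound; [exact: sin_max' | have := inv_le1 n 1; rewrite expr1].
Qed.

Lemma is_cvg_ser2 t : cvgn (series (ser2 t)).
Proof.
apply: (@is_cvg_series_bounded _ 4) => n; rewrite /ser2 normrM normrN (ger0_norm (ler0n R 4)) ler_wpM2l //.
by rewrite -[X in `|X|]mulr1; apply: bound; [exact: cos_max | rewrite normr1].
Qed.

Lemma is_derive_ser0 t : is_derive t (1 : R) (fun t => limn (series (ser0 t))) (limn (series (ser1 t))).
Proof.
apply: (is_derive_series (f := fun n t => ser0 t n) (df := fun n t => ser1 t n) (K := fun n => 4 * K n)).
- exact: is_cvg_ser0.
- exact: is_cvg_ser1.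
- by apply: is_cvg_seriesZ; exact: is_cvg_series_natXS.
move=> n h; rewrite /ser0 /ser1 /K.
move: (n1 n) (n_ge1 n); have := normrX n.+1 r;
  move: (n.+1%:R : R) (r ^+ n.+1) (`|r| ^+ n.+1) => m rn arn ern m0 m1; have arn0 : 0 <= arn by rewrite -ern.
rewrite (_ : m * (2 * (t + h)) = m * (2 * t) + m * (2 * h)); last by ring.
rewrite (_ : _ - _ = rn * m ^- 2 * (cos (m * (2 * t) + m * (2 * h)) - cos (m * (2 * t)) + (m * (2 * h)) * sin (m * (2 * t)))); last by field.
rewrite normrM normrM ern.
have q := cos_remainder (m * (2 * t)) (m * (2 * h)).
apply: le_trans (ler_wpM2l _ q) _; first by rewrite mulr_ge0 ?arn0 ?exprn_ge0.
rewrite ger0_norm ?invr_ge0 ?sqr_ge0 //.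
rewrite (_ : arn * m ^- 2 * (m * (2 * h)) ^+ 2 = 4 * arn * h ^+ 2); last by field.
rewrite ler_wpM2r ?sqr_ge0 // ler_wpM2l // ler_peMl // exprn_ge0 //.
Qed.

Lemma is_derive_ser1 t : is_derive t (1 : R) (fun t => limn (series (ser1 t))) (limn (series (ser2 t))).
Proof.
apply: (is_derive_series (f := fun n t => ser1 t n) (df := fun n t => ser2 t n) (K := fun n => 8 * K n)).
- exact: is_cvg_ser1.
- exact: is_cvg_ser2.
- by apply: is_cvg_seriesZ; exact: is_cvg_series_natXS.
move=> n h; rewrite /ser1 /ser2 /K.
move: (n1 n) (n_ge1 n); have := normrX n.+1 r;
  move: (n.+1%:R : R) (r ^+ n.+1) (`|r| ^+ n.+1) => m rn arn ern m0 m1; have arn0 : 0 <= arn by rewrite -ern.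
rewrite (_ : m * (2 * (t + h)) = m * (2 * t) + m * (2 * h)); last by ring.
rewrite (_ : _ - _ = - (2 * rn * m^-1) * (sin (m * (2 * t) + m * (2 * h)) - sin (m * (2 * t)) - (m * (2 * h)) * cos (m * (2 * t)))); last by field.
rewrite normrM normrN normrM normrM ern.
have q := sin_remainder (m * (2 * t)) (m * (2 * h)).
apply: le_trans (ler_wpM2l _ q) _; first by rewrite !mulr_ge0 ?arn0 ?exprn_ge0.
rewrite !ger0_norm ?invr_ge0 //; last by rewrite (le_trans ler01).
by rewrite (_ : 2 * arn * m^-1 * (m * (2 * h)) ^+ 2 = 8 * (m * arn) * h ^+ 2) -?mulrA //; field.
Qed.

Lemma lim_ser2 t : limn (series (ser2 t)) = - 4 * ((r * cos (2 * t) - r ^+ 2) / (1 - 2 * r * cos (2 * t) + r ^+ 2)).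
Proof.
set x := 2 * t; set q := 1 - _ + _.
pose u n := r ^+ n * cos (n%:R * x).
have q0 : q != 0.
  have : 0 < (1 - `|r|) ^+ 2 by rewrite exprn_gt0 // subr_gt0.
  rewrite (_ : (1 - `|r|) ^+ 2 = 1 - 2 * `|r| + r ^+ 2); last by rewrite -(real_normK (num_real r)); ring.
  move=> h; rewrite gt_eqF //; apply: lt_le_trans h _.
  have : r * cos x <= `|r|.
    by rewrite (le_trans (ler_norm _)) // normrM ler_piMr // cos_max.
  by rewrite /q; lra.
have u0 : u @ \oo --> (0 : R).
  have h := cvg_series_cvg_0 (@is_cvg_ser2 t); rewrite -cvg_shiftS.
  have h' := cvgM (cvg_cst (- 4^-1 : R)) h; rewrite mulr0 in h'.
  rewrite (_ : [sequence u n.+1]_n = (fun n => - 4^-1 * ser2 t n)); first exact: h'.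
  by apply/funext => n; rewrite /= /u /ser2 -/x; field.
(* Multiplied by [q] the sum telescopes, by the recurrence of cos(n x) in [n]; the boundary terms
   [u n] and [u n.+1] tend to 0. *)
have part n : series (ser2 t) n = - 4 / q * (r * cos x - r ^+ 2 - u n.+1 + r ^+ 2 * u n).
  elim: n => [|n IH].
    by rewrite /series /= big_geq // /u !expr0 expr1 mul0r cos0 !mul1r; ring.
  rewrite seriesSr IH /ser2 /u -/x.
  have e : cos (n.+2%:R * x) = 2 * cos x * cos (n.+1%:R * x) - cos (n%:R * x).
    rewrite (_ : n.+2%:R * x = n.+1%:R * x + x); last by rewrite -natr1; ring.
    rewrite (_ : n%:R * x = n.+1%:R * x - x); last by rewrite -natr1; ring.
    by rewrite cosD cosB; ring.
  by rewrite e !exprS /q; field.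
apply: cvg_lim => //; rewrite (_ : series _ = fun n => - 4 / q * (r * cos x - r ^+ 2 - u n.+1 + r ^+ 2 * u n)); last exact/funext.
rewrite (_ : - 4 * ((r * cos x - r ^+ 2) / q) = - 4 / q * (r * cos x - r ^+ 2 - 0 + r ^+ 2 * 0)); last by field.
have u1 : (fun n => u n.+1) @ \oo --> (0 : R) by rewrite cvg_shiftS.
exact: (cvgM (cvg_cst (- 4 / q)) (cvgD (cvgB (cvg_cst (r * cos x - r ^+ 2)) u1) (cvgM (cvg_cst (r ^+ 2)) u0))).
Qed.

End TrigonometricSeries.

Section TrigonometricProfile.
Context {R : realType}.
Implicit Types (s t : R).

Definition wt : R := 42 * 10 ^+ 3 + 25.
Definition ser_wt : R := wt / 6 * Num.sqrt (5 / 3).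

(* [profile (-1)] is f_aa and [profile 1] is f_bb, as functions of theta. *)
Definition profile_coef s : seq (nat * R) := [::
  (2, s * (2203 * 10 ^+ 3 + 841) / 1920);
  (4, (5579 * 10 ^+ 3 + 141) / (153 * 10 ^+ 3 + 600));
  (6, s * (214 * 10 ^+ 3 + 597) / (103 * 10 ^+ 3 + 680));
  (8, (48 * 10 ^+ 3 + 211) / (307 * 10 ^+ 3 + 200));
  (10, s * 251 / (19 * 10 ^+ 3 + 200));
  (12, 25 / (165 * 10 ^+ 3 + 888))]%N.

(** The number r = 4 - sqrt 15 is the root of r^2 - 8 r + 1 inside the unit disc. Hence the Poisson
    denominator 1 - 2 s r cos(2 t) + r^2 equals 2 r (4 - s cos(2 t)), which matches the denominator
    of [ra]. *)
Definition ratio s : R := s * (4 - Num.sqrt 15).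
Definition profile s t := \sum_(x <- profile_coef s) x.2 * cos (x.1%:R * t) - ser_wt * limn (series (ser0 (ratio s) t)).
Definition profile' s t := \sum_(x <- profile_coef s) x.2 * - (x.1%:R * sin (x.1%:R * t)) - ser_wt * limn (series (ser1 (ratio s) t)).
Definition profile'' s t := \sum_(x <- profile_coef s) x.2 * - (x.1%:R * (x.1%:R * cos (x.1%:R * t))) - ser_wt * limn (series (ser2 (ratio s) t)).

Lemma series_shift1 (f : nat -> R) (u : nat -> R) : (forall n, f n.+1 = u n) -> cvgn (series u) ->
  \big[+%R/0]_(1 <= n <oo) f n = limn (series u).
Proof.
move=> h cu; apply: cvg_lim => //; rewrite -cvg_shiftS.
rewrite (_ : [sequence _]_n = series u); first exact: cu.
by apply/funext => n; rewrite /series /= big_add1; apply: eq_bigr => i _.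
Qed.

Lemma sqrt15 : [/\ (Num.sqrt 15 : R) ^+ 2 = 15, 3 < (Num.sqrt 15 : R) & (Num.sqrt 15 : R) < 4].
Proof.
have e : (Num.sqrt 15 : R) ^+ 2 = 15 by rewrite sqr_sqrtr.
have p : 0 <= (Num.sqrt 15 : R) by exact: sqrtr_ge0.
by split=> //; nra.
Qed.

Lemma ratio_lt1 s : s ^+ 2 = 1 -> `|ratio s| < 1.
Proof.
have [w2 w3 w4] := sqrt15.
move=> /eqP; rewrite sqrf_eq1 => /orP[] /eqP ->; rewrite /ratio ?mulN1r ?mul1r ?normrN gtr0_norm; lra.
Qed.

Lemma faaE p : faa p = profile (-1) (theta p) :> R.
Proof.
rewrite /faa /profile /profile_coef !big_cons big_nil /=.
rewrite (series_shift1 (u := ser0 (ratio (-1)) (theta p))) => [|n|]; first last.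
  by apply: is_cvg_ser0; apply: ratio_lt1; rewrite sqrrN expr1n.
  rewrite /ser0 /ratio mulN1r opprB (addrC _ (-4)) /ck natrM; congr (_ * cos _ / _); ring.
rewrite /ck /ser_wt /wt; ring.
Qed.

Lemma fbbE p : fbb p = profile 1 (theta p) :> R.
Proof.
rewrite /fbb /profile /profile_coef !big_cons big_nil /=.
rewrite (series_shift1 (u := ser0 (ratio 1) (theta p))) => [|n|]; first last.
  by apply: is_cvg_ser0; apply: ratio_lt1; rewrite expr1n.
  rewrite /ser0 /ratio mul1r /ck natrM; congr (_ * cos _ / _); ring.
rewrite /ck /ser_wt /wt; ring.
Qed.

Lemma is_derive_cosM (m t : R) : is_derive t (1 : R) (fun t => cos (m * t)) (- (m * sin (m * t))).
Proof.
have h := is_deriveMr (is_derive_cst m t (1 : R)) (is_derive_id t (1 : R)).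
apply: (is_derive_eq (is_derive_comp_real (F := cos) (is_derive_cos (m * t)) h)).
by rewrite /cst; ring.
Qed.

Lemma is_derive_sinM (m t : R) : is_derive t (1 : R) (fun t => sin (m * t)) (m * cos (m * t)).
Proof.
have h := is_deriveMr (is_derive_cst m t (1 : R)) (is_derive_id t (1 : R)).
apply: (is_derive_eq (is_derive_comp_real (F := sin) (is_derive_sin (m * t)) h)).
by rewrite /cst; ring.
Qed.

Lemma is_derive_Ml (c t : R) (f : R -> R) df : is_derive t (1 : R) f df -> is_derive t (1 : R) (fun t => c * f t) (c * df).
Proof.
move=> h; apply: (is_derive_eq (is_deriveMr (is_derive_cst c t (1 : R)) h)).
by rewrite /cst mul0r addr0.
Qed.

Lemma is_derive_profile s t : s ^+ 2 = 1 -> is_derive t (1 : R) (profile s) (profile' s t).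
Proof.
move=> s1; apply: is_deriveDr; last first.
  by apply: is_deriveNr; apply: is_derive_Ml; apply: is_derive_ser0; exact: ratio_lt1.
apply: is_derive_sumr => x; apply: is_derive_Ml; exact: is_derive_cosM.
Qed.

Lemma is_derive_profile' s t : s ^+ 2 = 1 -> is_derive t (1 : R) (profile' s) (profile'' s t).
Proof.
move=> s1; apply: is_deriveDr; last first.
  by apply: is_deriveNr; apply: is_derive_Ml; apply: is_derive_ser1; exact: ratio_lt1.
apply: is_derive_sumr => x; apply: is_derive_Ml; apply: is_deriveNr; apply: is_derive_Ml; exact: is_derive_sinM.
Qed.

(** This is the mean of [ra (cos (2 * t))] over a period: a periodic f_aa with f_aa'' = 2 (ra -
    kappa) exists for no other constant. *)
Definition kappa : R := ser_wt - (3472 * 10 ^+ 3 + 117) / 384.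

Lemma kappa_gt0 : 0 < kappa.
Proof.
(* The two terms of [kappa] differ by less than one part in twenty thousand. The bound 1.29095 for
   sqrt(5/3) = 1.290994... is sharp enough, while 1.2909 would give a negative number. *)
have h : (129 * 10 ^+ 3 + 95) / 10 ^+ 5 <= (Num.sqrt (5 / 3) : R).
  have q0 : 0 <= (129 * 10 ^+ 3 + 95) / 10 ^+ 5 :> R by rewrite divr_ge0 // ?addr_ge0 ?mulr_ge0 ?exprn_ge0.
  rewrite -[leLHS]ger0_norm // -sqrtr_sqr ler_wsqrtr //.
  by rewrite expr_div_n ler_pdivrMr ?exprn_gt0 // -subr_ge0; lra.
by rewrite /kappa /ser_wt /wt; move: (Num.sqrt (5 / 3)) h => q h; lra.
Qed.

Lemma ser_wt_sqrt15 : ser_wt * Num.sqrt 15 = 5 * wt / 6.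
Proof.
rewrite /ser_wt -mulrA -sqrtrM ?divr_ge0 // (_ : 5 / 3 * 15 = 5 ^+ 2 :> R); last by field.
by rewrite sqrtr_sqr ger0_norm //; field.
Qed.

Lemma lim_ser2_ratio s t : s ^+ 2 = 1 -> ser_wt * limn (series (ser2 (ratio s) t)) =
  2 * ser_wt - 2 * (5 * wt / 6) / (4 - s * cos (2 * t)).
Proof.
move=> s1; rewrite lim_ser2 ?ratio_lt1 // -ser_wt_sqrt15 /ratio.
have [w2 w3 w4] := sqrt15; move: (Num.sqrt 15) w2 w3 w4 => w w2 w3 w4.
have d0 : 4 - s * cos (2 * t) != 0.
  rewrite gt_eqF // subr_gt0; have := cos_le1 (2 * t); have := cos_geN1 (2 * t).
  by move: s1 => /eqP; rewrite sqrf_eq1 => /orP[] /eqP -> ? ?; lra.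
have w0 : 4 - w != 0 by rewrite gt_eqF // subr_gt0.
have -> : 1 - 2 * (s * (4 - w)) * cos (2 * t) + (s * (4 - w)) ^+ 2 = 2 * (4 - w) * (4 - s * cos (2 * t)).
  ring: s1 w2.
rewrite (_ : s * (4 - w) * _ - _ = (4 - w) * (s * cos (2 * t) - (4 - w))); last by ring: s1.
by field; rewrite d0 w0.
Qed.

(** Written as polynomials in cos(2 t), the finite sums cancel the polynomial part of [ra]; the pole
    part of the Poisson kernel cancels its denominator, and the constant part leaves the irrational
    term of [kappa]. *)
Lemma ra_profile s t : s ^+ 2 = 1 -> ra (- (s * cos (2 * t))) - profile'' s t / 2 = kappa.
Proof.
move=> s1; rewrite /profile'' lim_ser2_ratio // /profile_coef !big_cons big_nil /=.
have ch (x y z : R) : x = y + 2 * t -> z = y - 2 * t -> cos x = 2 * cos (2 * t) * cos y - cos z.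
  by move=> -> ->; rewrite cosD cosB; ring.
have e4 : cos (4%:R * t) = 2 * cos (2 * t) ^+ 2 - 1.
  by rewrite (@ch _ (2 * t) 0) ?cos0; [ring|ring|ring].
have e6 : cos (6%:R * t) = 4 * cos (2 * t) ^+ 3 - 3 * cos (2 * t).
  by rewrite (@ch _ (4%:R * t) (2 * t)) ?e4; [ring|ring|ring].
have e8 : cos (8%:R * t) = 8 * cos (2 * t) ^+ 4 - 8 * cos (2 * t) ^+ 2 + 1.
  by rewrite (@ch _ (6%:R * t) (4%:R * t)) ?e6 ?e4; [ring|ring|ring].
have e10 : cos (10%:R * t) = 16 * cos (2 * t) ^+ 5 - 20 * cos (2 * t) ^+ 3 + 5 * cos (2 * t).
  by rewrite (@ch _ (8%:R * t) (6%:R * t)) ?e8 ?e6; [ring|ring|ring].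
have e12 : cos (12%:R * t) = 32 * cos (2 * t) ^+ 6 - 48 * cos (2 * t) ^+ 4 + 18 * cos (2 * t) ^+ 2 - 1.
  by rewrite (@ch _ (10%:R * t) (8%:R * t)) ?e10 ?e8; [ring|ring|ring].
rewrite e4 e6 e8 e10 e12.
have d0 : 4 - s * cos (2 * t) != 0.
  rewrite gt_eqF // subr_gt0; have := cos_le1 (2 * t); have := cos_geN1 (2 * t).
  by move: s1 => /eqP; rewrite sqrf_eq1 => /orP[] /eqP -> ? ?; lra.
rewrite /kappa /ra /wt; move: ser_wt => w.
move: (cos (2 * t)) d0 => c d0.
by move: s1 d0 => /eqP; rewrite sqrf_eq1 => /orP[] /eqP -> d0; field; move: d0; rewrite ?mulN1r ?mul1r ?opprK.
Qed.

End TrigonometricProfile.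

(** * The formula for V^(2) *)

Section QuotientDerivative.
Context {R : realType}.
Implicit Types (t : R).

Lemma is_derive_quot (f h : R -> R) t df dh : h t != 0 ->
  is_derive t (1 : R) f df -> is_derive t (1 : R) h dh ->
  is_derive t (1 : R) (fun u => f u / h u) (df / h t - f t * dh / h t ^+ 2).
Proof.
move=> h0 hf hh; apply: (is_derive_eq (is_deriveMr hf (is_derive_comp_real (F := fun u => u^-1) (is_derive_inv h0) hh))).
by field.
Qed.

(* cos t sin t G(sin 2t / sqrt 3) *)
Definition atan_term t : R := Num.sqrt 3 / 2 * atan (sin (2 * t) / Num.sqrt 3).
Definition atan_term' t : R := 3 * cos (2 * t) / (4 - cos (2 * t) ^+ 2).

Lemma four_sub_cos2 t : 4 - cos (2 * t) ^+ 2 != 0.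
Proof.
have := sqr_ge0 (sin (2 * t)); rewrite sin2cos2 => h.
by rewrite gt_eqF //; lra.
Qed.

Lemma is_derive_atan_term t : is_derive t (1 : R) atan_term (atan_term' t).
Proof.
have s3 : (Num.sqrt 3 : R) ^+ 2 = 3 by rewrite sqr_sqrtr.
have s30 : (Num.sqrt 3 : R) != 0 by rewrite gt_eqF // sqrtr_gt0.
have h := is_deriveMr (is_derive_sinM 2 t) (is_derive_cst (Num.sqrt 3 : R)^-1 t (1 : R)).
apply: (is_derive_eq (is_derive_Ml (Num.sqrt 3 / 2) (is_derive_comp_real (F := @atan R) (is_derive1_atan _) h))).
have := four_sub_cos2 t; rewrite /atan_term' /cst.
have := sin2cos2 (2 * t); move: (sin (2 * t)) (cos (2 * t)) (Num.sqrt 3) s3 s30 => s c w s3 s30 e d0.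
rewrite mulr0 add0r expr_div_n s3 e.
have e1 : 1 + (1 - c ^+ 2) / 3 = (4 - c ^+ 2) / 3 by field.
by rewrite e1; field; rewrite s30 d0.
Qed.

Lemma is_derive_atan_term' t : is_derive t (1 : R) atan_term'
  (- (6 * sin (2 * t) * (4 + cos (2 * t) ^+ 2) / (4 - cos (2 * t) ^+ 2) ^+ 2)).
Proof.
have hc := is_derive_cosM 2 t; have d0 := four_sub_cos2 t.
have h2 := is_deriveDr (is_derive_cst (4 : R) t (1 : R)) (is_deriveNr (is_deriveMr hc hc)).
have e : (fun u : R => 4 + - (cos (2 * u) * cos (2 * u))) = (fun u => 4 - cos (2 * u) ^+ 2).
  by apply/funext => u; rewrite expr2.
rewrite /cst e in h2; apply: (is_derive_eq (is_derive_quot (h := fun u => 4 - cos (2 * u) ^+ 2) d0 (is_derive_Ml 3 hc) h2)).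
by field.
Qed.

(** For theta in (0, pi/2) the argument of [G] is nonzero, so [G] is this quotient. Its derivative
    [G_th'] is read off from the product rule for [cos t * sin t * G_th t = atan_term t], which
    keeps the arctangent inside [G_th]. *)
Definition G_th t : R := atan_term t / (cos t * sin t).
Definition G_th' t : R := (atan_term' t - cos (2 * t) * G_th t) / (cos t * sin t).

Lemma is_derive_cs t : is_derive t (1 : R) (fun t => cos t * sin t) (cos (2 * t)).
Proof.
apply: (is_derive_eq (is_deriveMr (is_derive_cos t) (is_derive_sin t))).
by rewrite (_ : 2 * t = t + t) ?cosD; ring.
Qed.

Lemma is_derive_G_th t : cos t * sin t != 0 -> is_derive t (1 : R) G_th (G_th' t).
Proof.
move=> h0; apply: (is_derive_eq (is_derive_quot (h := fun t => cos t * sin t) h0 (is_derive_atan_term t) (is_derive_cs t))).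
by rewrite /G_th' /G_th; move: (cos t * sin t) h0 => q h0; field.
Qed.

(** The combination on the left is the second derivative of cos t sin t G, that is, of [atan_term].
    The arctangent has disappeared, so the right side is rational in cos t and sin t. *)
Lemma is_derive_G_th' t : cos t * sin t != 0 -> exists2 g2, is_derive t (1 : R) G_th' g2 &
  cos t * sin t * g2 + 2 * (2 * cos t ^+ 2 - 1) * G_th' t - 4 * cos t * sin t * G_th t =
  - (12 * cos t * sin t * (4 + (2 * cos t ^+ 2 - 1) ^+ 2) / ((3 - 2 * cos t ^+ 2) * (1 + 2 * cos t ^+ 2)) ^+ 2).
Proof.
move=> h0.
have h1 := is_deriveMr (is_derive_cosM 2 t) (is_derive_G_th h0).
have h2 := is_deriveDr (is_derive_atan_term' t) (is_deriveNr h1).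
have e : atan_term' t + - (cos (2 * t) * G_th t) = cos t * sin t * G_th' t by rewrite /G_th' [RHS]mulrC divfK.
have := is_derive_quot (h := fun t => cos t * sin t) h0 h2 (is_derive_cs t); rewrite /= e => h3.
eexists; first exact: h3.
have := four_sub_cos2 t.
have -> : sin (2 * t) = 2 * (cos t * sin t) by rewrite (_ : 2 * t = t + t) ?sinD; ring.
have -> : cos (2 * t) = 2 * cos t ^+ 2 - 1.
  by rewrite (_ : 2 * t = t + t) ?cosD -?expr2 ?sin2cos2; ring.
have -> : 4 * cos t * sin t = 4 * (cos t * sin t) by ring.
have -> : 12 * cos t * sin t = 12 * (cos t * sin t) by ring.
have -> : (3 - 2 * cos t ^+ 2) * (1 + 2 * cos t ^+ 2) = 4 - (2 * cos t ^+ 2 - 1) ^+ 2 by ring.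
move: (2 * cos t ^+ 2 - 1) (cos t * sin t) (G_th' t) (G_th t) h0 => c q g' g h0 d0.
by field; rewrite d0 h0.
Qed.

Lemma G_thE t : cos t * sin t != 0 -> G (sin (2 * t) / Num.sqrt 3) = G_th t.
Proof.
move=> h0.
have s3 : (Num.sqrt 3 : R) ^+ 2 = 3 by rewrite sqr_sqrtr.
have s30 : (Num.sqrt 3 : R) != 0 by rewrite gt_eqF // sqrtr_gt0.
have e : sin (2 * t) = 2 * (cos t * sin t) by rewrite (_ : 2 * t = t + t) ?sinD; ring.
rewrite /G_th /atan_term e; move: (cos t * sin t) h0 => q h0.
have q0 : 2 * q / Num.sqrt 3 != 0 by rewrite !mulf_neq0 ?invr_neq0 // pnatr_eq0.
rewrite /G (negPf q0); move: (atan (2 * q / Num.sqrt 3)); move: (Num.sqrt 3) s3 s30 => w s3 s30 a.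
by field: s3; rewrite s30 h0.
Qed.

End QuotientDerivative.

Section Assembly.
Context {R : realType} (y : R3xR3 R) (hy : M_nondeg y).
Local Notation C := (cos (theta y)).
Local Notation S := (sin (theta y)).
Local Notation t0 := (theta y).
Local Notation U := 'rV[R]_4.
Local Notation J4 := (@jet2 R 4).
Let CS : S ^+ 2 = 1 - C ^+ 2 := CS1 y.
Let C0 : 0 < C. Proof. by have [] := nondegP hy. Qed.
Let S0 : 0 < S. Proof. by have [] := nondegP hy. Qed.
Let C1 : C != 0 := lt0r_neq0 C0.
Let S1 : S != 0 := lt0r_neq0 S0.
Let P1 : 3 - 2 * C ^+ 2 != 0 := lt0r_neq0 (P_gt0 CS S0).
Let M1 : 1 + 2 * C ^+ 2 != 0 := lt0r_neq0 (M_gt0 C0).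

Lemma has_jet_sum4 (F : 'I_4 -> U -> R) (J : 'I_4 -> J4) : (forall a, has_jet (F a) (J a)) ->
  has_jet (fun x => \sum_a F a x) (jsum4 J).
Proof.
move=> h; apply: (has_jet_ext (f := fun x => F o0 x + F o1 x + F o2 x + F o3 x)).
  by move=> x; rewrite sum4.
by repeat apply: has_jet_add.
Qed.

Lemma nusq_near : \forall x \near (0 : U), 0 < nusq C S x.
Proof.
have [_ _ _ [e c _]] := has_jet_nu C S.
apply: (c (fun r => 0 < r)); apply: open_nbhs_nbhs; split; first exact: open_gt.
by rewrite /= e /jtab /= !mulr_gt0 ?exprn_gt0.
Qed.

(** The components [Tv] have to describe [T] only where [nusq] is positive, which holds near the
    origin; there the frame components of the coordinate fields are [phi]. Symmetry of [Tv] permits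
    the use of [symT]. *)
Lemma has_jet_pullback (T : tensor2) (Tv : U -> 'I_4 -> 'I_4 -> R) (jT : 'I_4 -> 'I_4 -> J4) i j :
  (forall x, 0 < nusq C S x -> forall V W, T (chart y x) V W = tens (chart y x) (Tv x) V W) ->
  (forall x a b, Tv x a b = Tv x b a) -> (forall a b, has_jet (fun x => Tv x a b) (jT a b)) ->
  has_jet (fun x => pullback (chart y) T x i j) (jH C S (symT jT) i j).
Proof.
move=> hT sT hj.
apply: (has_jet_near (f := fun x => \sum_a \sum_b Tv x a b * (phi C S a i x * phi C S b j x))); last first.
  apply: has_jet_sum4 => a; apply: has_jet_sum4 => b; apply: has_jet_mul.
    rewrite /symT; case: ifP => _ //.
    by apply: (has_jet_ext (f := fun x => Tv x b a)) => // x; exact: sT.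
  by apply: has_jet_mul; exact: has_jet_phi.
near=> x; have n0 : 0 < nusq C S x by near: x; exact: nusq_near.
rewrite mxE hT // !(derive_chart hy) /tens; apply: eq_bigr => a _; apply: eq_bigr => b _.
by rewrite !(coef_chart hy).
Unshelve. all: by end_near. Qed.

Let jets_e u : has_jet3 (fun x => (e1 C S (qcoord y u) x, e2 C S (qcoord y u) x, e3 C S (qcoord y u) x)) (be C S (qcoord y u)).
Proof. by have [h1 h2 h3] := has_jet_e CS C0 S0 (erefl C) (erefl S) (theta_range hy) (qcoord y u). Qed.

Let jets_cos : has_jet (fun x => cos (th C S x)) (bc C S t0).
Proof. exact: (has_jet_cos_th CS C0 S0 (erefl C) (erefl S) (theta_range hy)). Qed.

Let jets_sin : has_jet (fun x => sin (th C S x)) (bs C S t0).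
Proof. exact: (has_jet_sin_th CS C0 S0 (erefl C) (erefl S) (theta_range hy)). Qed.

Let jets_A : has_jet (fun x => (2 - cos (2 * th C S x))^-1) (bA C S t0).
Proof.
have h := has_jet_add (has_jet_cst 3) (has_jet_mul (has_jet_cst (-2)) (has_jet_mul jets_cos jets_cos)).
apply: (has_jet_ext (f := fun x => (3 + -2 * (cos (th C S x) * cos (th C S x)))^-1)).
  by move=> x; rewrite (_ : 2 * th C S x = th C S x + th C S x) ?cosD -?expr2 ?sin2cos2; [congr (_^-1); ring | ring].
have hv : jv (jadd (jcst 3) (jmul (jcst (-2)) (jmul (bc C S t0) (bc C S t0)))) != 0.
  by rewrite /= (_ : _ + _ = 3 - 2 * C ^+ 2) //; ring.
by refine (@has_jet_eq _ _ _ _ _ (has_jet_inv hv h) _ _ _); rewrite /=; repeat (apply: ord4P); rewrite /tab4 /=; field: CS; rewrite ?C1 ?S1 ?P1.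
Qed.

Let jets_B : has_jet (fun x => (2 + cos (2 * th C S x))^-1) (bB C S t0).
Proof.
have h := has_jet_add (has_jet_cst 1) (has_jet_mul (has_jet_cst 2) (has_jet_mul jets_cos jets_cos)).
apply: (has_jet_ext (f := fun x => (1 + 2 * (cos (th C S x) * cos (th C S x)))^-1)).
  by move=> x; rewrite (_ : 2 * th C S x = th C S x + th C S x) ?cosD -?expr2 ?sin2cos2; [congr (_^-1); ring | ring].
have hv : jv (jadd (jcst 1) (jmul (jcst 2) (jmul (bc C S t0) (bc C S t0)))) != 0.
  by rewrite /= (_ : _ + _ = 1 + 2 * C ^+ 2) //; ring.
by refine (@has_jet_eq _ _ _ _ _ (has_jet_inv hv h) _ _ _); rewrite /=; repeat (apply: ord4P); rewrite /tab4 /=; field: CS; rewrite ?C1 ?S1 ?M1.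
Qed.

Lemma jets_profile s : s ^+ 2 = 1 ->
  has_jet (fun x => profile s (th C S x)) (tjet C S t0 (profile s t0) (profile' s t0) (profile'' s t0)).
Proof.
move=> s1; have h : \forall t \near t0, is_derive (t : R) (1 : R) (profile s) (profile' s t).
  by near=> t; exact: is_derive_profile.
exact: (has_jet_fun_th CS C0 S0 (erefl C) (theta_range hy) h (is_derive_profile' t0 s1)).
Unshelve. all: by end_near. Qed.

Lemma T1v_sym (c s A B lc ld : R) X Y Z a b : T1v c s A B lc ld X Y Z a b = T1v c s A B lc ld X Y Z b a.
Proof.
have o u v : odv u v a b = odv u v b a :> R by rewrite /odv; ring.
by rewrite /T1v /T2v !o.
Qed.

Lemma T2v_sym (c s A B fa fb fg lc ld : R) X Y Z a b :
  T2v c s A B fa fb fg lc ld X Y Z a b = T2v c s A B fa fb fg lc ld X Y Z b a.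
Proof.
have o u v : odv u v a b = odv u v b a :> R by rewrite /odv; ring.
by rewrite /T1v /T2v !o.
Qed.

Lemma T0v_sym (A B : R) a b : T0v A B a b = T0v A B b a.
Proof. by move: a b; apply: ord4P; apply: ord4P. Qed.

Let ev u (x : U) := (e1 C S (qcoord y u) x, e2 C S (qcoord y u) x, e3 C S (qcoord y u) x).

Let qcoord_chart u x : 0 < nusq C S x -> qcoord (chart y x) u = ev u x.
Proof. by move=> n0; rewrite /qcoord /ev; have [-> -> ->] := e_chart hy u n0. Qed.

Lemma jets_g i j : has_jet (fun x => pullback (chart y) g x i j) (H0jet C S t0 i j).
Proof.
apply: (has_jet_pullback (Tv := fun x => T0v (2 - cos (2 * th C S x))^-1 (2 + cos (2 * th C S x))^-1)).
- by move=> x n0 V W; rewrite g_tens (th_chart hy).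
- by move=> x a b; exact: T0v_sym.
- by move=> a b; exact: has_jet_T0.
Qed.

Lemma jets_h1 lc ld i j : has_jet (fun x => pullback (chart y) (h1 lc ld) x i j)
  (H1jet C S t0 lc ld (dot e_x (q1 y)) (dot e_x (q2 y)) (dot e_x (q3 y)) (dot e_y (q1 y)) (dot e_y (q2 y))
     (dot e_y (q3 y)) (dot e_z (q1 y)) (dot e_z (q2 y)) (dot e_z (q3 y)) i j).
Proof.
apply: (has_jet_pullback (Tv := fun x => T1v (cos (th C S x)) (sin (th C S x)) (2 - cos (2 * th C S x))^-1
  (2 + cos (2 * th C S x))^-1 lc ld (ev e_x x) (ev e_y x) (ev e_z x))).
- by move=> x n0 V W; rewrite (h1_tens (chart_nondeg hy n0)) (th_chart hy) !qcoord_chart.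
- by move=> x a b; exact: T1v_sym.
- by move=> a b; apply: has_jet_T1 => //; exact: jets_e.
Qed.

Lemma V2_formula lc ld : V2 lc ld y = kappa * (dot e_x (q3 y) ^+ 2 + dot e_y (q3 y) ^+ 2)
  + ld ^+ 2 * Cq C (dot e_x (q1 y)) (dot e_x (q2 y)) (dot e_x (q3 y))
      (dot e_z (q1 y)) (dot e_z (q2 y)) (dot e_z (q3 y)).
Proof.
have [g2 dg hg] := is_derive_G_th' (t := t0) (mulf_neq0 C1 S1).
have hG : has_jet (fun x => G (sin (2 * th C S x) / Num.sqrt 3)) (tjet C S t0 (G_th t0) (G_th' t0) g2).
  have nz : \forall t \near t0, cos t * sin t != 0.
    have c : {for t0, continuous (fun t : R => cos t * sin t)}.
      by apply: continuousM; [exact: continuous_cos | exact: continuous_sin].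
    apply: (c (fun r => r != 0)); apply: open_nbhs_nbhs; split; first exact: open_neq.
    by rewrite /= mulf_neq0.
  have h : \forall t \near t0, is_derive (t : R) (1 : R) G_th (G_th' t).
    by near=> t; apply: is_derive_G_th; near: t.
  have := has_jet_fun_th CS C0 S0 (erefl C) (theta_range hy) h dg.
  apply: has_jet_near.
  have [e c _] := has_jet_th CS C0 S0 (erefl C) (theta_range hy).
  near=> x; rewrite G_thE //; near: x.
  by apply: (c (fun t => cos t * sin t != 0)); rewrite e.
have j2 i j : has_jet (fun x => pullback (chart y) (h2 lc ld) x i j)
  (H2jet C S t0 lc ld (dot e_x (q1 y)) (dot e_x (q2 y)) (dot e_x (q3 y)) (dot e_y (q1 y)) (dot e_y (q2 y))
     (dot e_y (q3 y)) (dot e_z (q1 y)) (dot e_z (q2 y)) (dot e_z (q3 y)) (profile (-1) t0) (profile' (-1) t0)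
     (profile'' (-1) t0) (profile 1 t0) (profile' 1 t0) (profile'' 1 t0) (G_th t0) (G_th' t0) g2 i j).
  apply: (has_jet_pullback (Tv := fun x => T2v (cos (th C S x)) (sin (th C S x)) (2 - cos (2 * th C S x))^-1
    (2 + cos (2 * th C S x))^-1 (profile (-1) (th C S x)) (profile 1 (th C S x))
    (G (sin (2 * th C S x) / Num.sqrt 3)) lc ld (ev e_x x) (ev e_y x) (ev e_z x))).
  - by move=> x n0 V W; rewrite (h2_tens (chart_nondeg hy n0)) faaE fbbE (th_chart hy) !qcoord_chart.
  - by move=> x a b; exact: T2v_sym.
  - have p1 : has_jet (fun x => profile (-1) (th C S x)) _ := jets_profile (etrans (sqrrN 1) (expr1n _ 2)).
    have p2 : has_jet (fun x => profile 1 (th C S x)) _ := jets_profile (expr1n _ 2).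
    by move=> a b; exact: (has_jet_T2 jets_cos jets_sin jets_A jets_B p1 p2 hG (jets_e e_x) (jets_e e_y) (jets_e e_z) lc ld a b).
rewrite (V2_value hy CS C0 S0 jets_g (jets_h1 lc ld) j2 hg).
have c2 : cos (2 * t0) = 2 * C ^+ 2 - 1 by exact: cos2_theta.
have := ra_profile (s := -1) t0; have := ra_profile (s := 1) t0.
rewrite mulN1r opprK mul1r c2 sqrrN expr1n => /(_ erefl) -> /(_ erefl) ->.
by rewrite -mulrDr.
Unshelve. all: by end_near. Qed.

End Assembly.

(** * Bounds from orthonormality *)

Section Bounds.
Context {R : realType} (y : R3xR3 R) (hy : M_nondeg y).
Local Notation x1 := (dot e_x (q1 y)).
Local Notation x2 := (dot e_x (q2 y)).
Local Notation x3 := (dot e_x (q3 y)).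
Local Notation y3 := (dot e_y (q3 y)).
Local Notation z1 := (dot e_z (q1 y)).
Local Notation z2 := (dot e_z (q2 y)).
Local Notation z3 := (dot e_z (q3 y)).
Local Notation C := (cos (theta y)).

Lemma dot_delta (i : 'I_3) (u : 'rV[R]_3) : dot (delta_mx 0 i) u = u 0 i.
Proof.
rewrite /dot (bigD1 i) //= big1 => [|j /negPf ji]; last by rewrite mxE eqxx ji mul0r.
by rewrite mxE !eqxx mul1r addr0.
Qed.

(** The rows [q1], [q2], [q3] are orthonormal, and a right inverse of a square matrix is also a left
    inverse, so the columns are orthonormal too. *)
Lemma q_orthonormal_columns (i j : 'I_3) :
  q1 y 0 i * q1 y 0 j + q2 y 0 i * q2 y 0 j + q3 y 0 i * q3 y 0 j = (i == j)%:R.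
Proof.
have [_ _ _ _ _ _ _ n11 n22 n33 n12 n13 n23 _ _ _] := nondegP hy.
pose q (k : 'I_3) := tnth [tuple q1 y; q2 y; q3 y] k.
pose Q : 'M[R]_3 := \matrix_(k, l) q k 0 l.
have QT : Q *m Q^T = 1%:M.
  apply/matrixP => k l; rewrite !mxE.
  transitivity (dot (q k) (q l)); first by apply: eq_bigr => m _; rewrite !mxE.
  case: k l => [[|[|[|//]]]] hk [[|[|[|//]]]] hl; rewrite /q /tnth /= ?n11 ?n22 ?n33 ?n12 ?n13 ?n23 //;
    by rewrite dotC ?n12 ?n13 ?n23.
have /matrixP/(_ i j) := mulmx1C QT; rewrite !mxE !big_ord_recl big_ord0 !mxE addr0 => <-.
exact/esym/addrA.
Qed.

Lemma q_coordinates : [/\ x3 ^+ 2 + y3 ^+ 2 = z1 ^+ 2 + z2 ^+ 2, z1 ^+ 2 + z2 ^+ 2 + z3 ^+ 2 = 1,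
  x1 ^+ 2 + x2 ^+ 2 + x3 ^+ 2 = 1 & x1 * z1 + x2 * z2 + x3 * z3 = 0].
Proof.
have [_ _ _ _ _ _ _ _ _ n33 _ _ _ _ _ _] := nondegP hy.
have hz := q_orthonormal_columns 2 2; have hx := q_orthonormal_columns 0 0.
have hxz := q_orthonormal_columns 0 2.
rewrite eqxx in hz; rewrite eqxx in hx; rewrite (_ : (0 == 2 :> 'I_3) = false) // in hxz.
rewrite dotE in n33; rewrite /e_x /e_y /e_z !dot_delta !expr2; split=> //.
by apply: (addIr (q3 y 0 2 * q3 y 0 2)); rewrite hz n33.
Qed.

Lemma Cq_bound : `|Cq C x1 x2 x3 z1 z2 z3| <= 2 * (z1 ^+ 2 + z2 ^+ 2).
Proof.
have [_ hz hx hxz] := q_coordinates; have [_ _ C0 S0 CS _ _ _ _ _ _ _ _ _ _ _] := nondegP hy.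
have P1 := P_gt0 CS S0; have M1 := M_gt0 C0.
have h1 := exprn_gt0 2 C0; have h2 := exprn_gt0 2 S0.
rewrite /Cq.
set k := 2 * C ^+ 2 - 1.
have k1 : -1 < k by rewrite /k; lra.
have k2 : k < 1 by rewrite /k; lra.
have -> : 3 - 2 * C ^+ 2 = 2 - k by rewrite /k; ring.
have -> : 1 + 2 * C ^+ 2 = 2 + k by rewrite /k; ring.
have n3 : 2 + k != 0 by rewrite gt_eqF //; lra.
have n4 : 2 - k != 0 by rewrite gt_eqF //; lra.
have quot (a b : R) : 0 < b -> `|a| <= b -> `|a / b| <= 1.
  by move=> b0 ab; rewrite normrM normfV (gtr0_norm b0) ler_pdivrMr // mul1r.
have al : `|(2 + 2 * k - k ^+ 2) / (12 * (2 + k) ^+ 3)| <= 1.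
  have p : 1 <= (2 + k) ^+ 3 by apply: exprn_ege1; lra.
  by apply: quot; [lra | rewrite ler_norml; apply/andP; split; nra].
have be : `|(2 - 2 * k - k ^+ 2) / (12 * (2 - k) ^+ 3)| <= 1.
  have p : 1 <= (2 - k) ^+ 3 by apply: exprn_ege1; lra.
  by apply: quot; [lra | rewrite ler_norml; apply/andP; split; nra].
have ga : `|k * (2 + k ^+ 2) / (3 * (2 - k) ^+ 2 * (2 + k) ^+ 2)| <= 1.
  have p : 9 <= (2 - k) ^+ 2 * (2 + k) ^+ 2.
    rewrite -exprMn (_ : (2 - k) * (2 + k) = 4 - k ^+ 2); last by ring.
    have u1 : k ^+ 2 <= 1 by nra.
    by move: (k ^+ 2) u1 (sqr_ge0 k) => u u1 u0; nra.
  rewrite -(mulrA 3); apply: quot; first by lra.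
  by rewrite ler_norml; apply/andP; split; nra.
move: (k * (2 + k ^+ 2) / (3 * (2 - k) ^+ 2 * (2 + k) ^+ 2)) ga => ga ga1.
rewrite -(mulrA (z1 ^+ 2)) -(mulrA (z2 ^+ 2)).
move: (_ / (12 * (2 + k) ^+ 3)) (_ / (12 * (2 - k) ^+ 3)) al be => a b a1 b1.
(* Orthogonality of e_x and e_z replaces x3 z3 by -(x1 z1 + x2 z2). The mixed term becomes a
   difference of squares, and everything is a combination of z1^2 and z2^2. *)
have -> : x3 ^+ 2 * (z1 ^+ 2 * a + z2 ^+ 2 * b) - ga * x3 * z3 * (x1 * z1 - x2 * z2) =
  x3 ^+ 2 * z1 ^+ 2 * a + x3 ^+ 2 * z2 ^+ 2 * b + x1 ^+ 2 * z1 ^+ 2 * ga + x2 ^+ 2 * z2 ^+ 2 * - ga.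
  have -> : ga * x3 * z3 = - ga * (x1 * z1 + x2 * z2).
    by rewrite -mulrA mulNr -mulrN; congr (_ * _); apply: (addrI (x1 * z1 + x2 * z2)); rewrite hxz subrr.
  ring.
have sc (u w : R) : `|w| <= 1 -> 0 <= u -> `|u * w| <= u.
  by move=> w1 u0; rewrite normrM (ger0_norm u0) ler_piMr.
have s (u w : R) : 0 <= u ^+ 2 * w ^+ 2 by rewrite mulr_ge0 ?sqr_ge0.
have e1 := sc _ _ a1 (s x3 z1); have e2 := sc _ _ b1 (s x3 z2); have e3 := sc _ _ ga1 (s x1 z1).
have e4 : `|x2 ^+ 2 * z2 ^+ 2 * - ga| <= x2 ^+ 2 * z2 ^+ 2 by apply: sc => //; rewrite normrN.
apply: le_trans (ler_normD _ _) _; apply: le_trans (lerD (ler_normD _ _) e4) _.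
apply: le_trans (lerD (lerD (ler_normD _ _) e3) (lexx _)) _.
apply: le_trans (lerD (lerD (lerD e1 e2) (lexx _)) (lexx _)) _.
move: hx (sqr_ge0 x1) (sqr_ge0 x2) (sqr_ge0 x3) (sqr_ge0 z1) (sqr_ge0 z2).
move: (x1 ^+ 2) (x2 ^+ 2) (x3 ^+ 2) (z1 ^+ 2) (z2 ^+ 2) => u1 u2 u3 w1 w2 ? ? ? ? ? ?.
have f1 : u3 <= 1 by lra.
have f2 : u1 <= 1 by lra.
have f3 : u2 <= 1 by lra.
by nra.
Qed.

End Bounds.

Section LowerBound.
Context {R : realType}.

Lemma V2_lower_bound (lc ld : R) (y : R3xR3 R) : M_nondeg y ->
  (kappa - 2 * ld ^+ 2) * (1 - dot e_z (q3 y) ^+ 2) <= V2 lc ld y.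
Proof.
move=> hy; have [h1 h2 _ _] := q_coordinates hy; rewrite (V2_formula hy) h1.
have := Cq_bound hy; move: (Cq _ _ _ _ _ _ _) => c; rewrite ler_norml => /andP[c1 _].
have -> : 1 - dot e_z (q3 y) ^+ 2 = dot e_z (q1 y) ^+ 2 + dot e_z (q2 y) ^+ 2 by rewrite -h2 addrK.
move: (dot e_z (q1 y) ^+ 2 + dot e_z (q2 y) ^+ 2) c1 => w c1.
have := ler_wpM2l (sqr_ge0 ld) c1; move: (ld ^+ 2) kappa => u q h.
by rewrite -subr_ge0 (_ : _ - _ = u * c - u * - (2 * w)) ?subr_ge0 //; ring.
Qed.

Lemma dot_q3 (y : R3xR3 R) : dot e_z (q3 y) ^+ 2 = dot (cross y.1 y.2) e_z ^+ 2 / enorm (cross y.1 y.2) ^+ 2.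
Proof. by rewrite /q3 /normalize dotZr exprMn exprVn mulrC dotC. Qed.

End LowerBound.

Theorem proposition5p2 (R : realType) :
  (exists lambda0 delta : R,
     [/\ 0 < lambda0, 0 < delta &
       forall (lc ld : R) (y : R3xR3 R), M_nondeg y -> `|ld| <= lambda0 ->
         delta * (1 - dot (cross y.1 y.2) e_z ^+ 2 / enorm (cross y.1 y.2) ^+ 2)
           <= V2 lc ld y])
  /\ (forall (lc ld : R) (y : R3xR3 R), Sigma y -> M_nondeg y -> V2 lc ld y = 0).
Proof.
have k0 : 0 < kappa :> R := kappa_gt0.
split.
  (* The bound 1 gives [ld ^+ 2 <= |ld| <= kappa / 4], hence [kappa - 2 * ld ^+ 2 >= kappa / 2]. *)
  exists (Num.min 1 (kappa / 4)), (kappa / 2).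
  have l0 : 0 < Num.min 1 (kappa / 4) :> R by rewrite lt_min ltr01 divr_gt0.
  split; [exact: l0 | exact: divr_gt0 |].
  move=> lc ld y hy; rewrite le_min => /andP[l1 l2].
  rewrite -dot_q3; apply: le_trans (V2_lower_bound lc ld hy).
  have [_ h2 _ _] := q_coordinates hy.
  apply: ler_wpM2r; first by rewrite -h2 addrK addr_ge0 ?sqr_ge0.
  have : ld ^+ 2 <= kappa / 4.
    by rewrite -(real_normK (num_real ld)) expr2 (le_trans _ l2) // ler_piMl.
  by move: (ld ^+ 2) (kappa : R) => u w h; lra.
move=> lc ld y [_ s1 s2] hy; have [h1 _ _ _] := q_coordinates hy.
have z1 : dot e_z (q1 y) = 0 by rewrite /q1 /normalize dotZr dotDr dotC s1 dotC s2 addr0 mulr0.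
have z2 : dot e_z (q2 y) = 0 by rewrite /q2 /normalize dotZr dotDr dotNr dotC s2 dotC s1 subrr mulr0.
rewrite (V2_formula hy) h1 z1 z2 /Cq; ring.
Qed.
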